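(* For $k\in\{1,2,3\}$ let $c_k\in[1,4/3)$ and $\gamma_k:=1/c_k$ be such that \[ 4(1-\gamma_1)+\tfrac52(1-\gamma_2)+\tfrac52(1-\gamma_3)<1, \] \[ \tfrac52(1-\gamma_1)+4(1-\gamma_2)+\tfrac52(1-\gamma_3)<1, \] \[ \tfrac52(1-\gamma_1)+\tfrac52(1-\gamma_2)+4(1-\gamma_3)<1. \] Assume that $h_k\in\mathcal F_{c_k}$ for each $k\in\{1,2,3\}$, and let $\varphi_k$ be the inverse function of $h_k$. Then, as $\lambda\to\infty$ through positive integers, \[ r_{h_1,h_2,h_3}(\lambda)=\frac{\Gamma(\gamma_1)\Gamma(\gamma_2)\Gamma(\gamma_3)}{\Gamma(\gamma_1+\gamma_2+\gamma_3)}\,\lambda^2\varphi_1'(\lambda)\varphi_2'(\lambda)\varphi_3'(\lambda)+o\big(\lambda^2\varphi_1'(\lambda)\varphi_2'(\lambda)\varphi_3'(\lambda)\big), \] where $\Gamma$ is the Gamma function.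
   Context: The class $\mathcal F_c$, $c\in[1,2)$, is the family of all functions $h:[x_0,\infty)\to[1,\infty)$, for some $x_0\ge1$, such that: (i) $h\in C^3([x_0,\infty))$ and $h'(x)>0$, $h''(x)>0$ for every $x\ge x_0$; (ii) there exist a real-valued function $\vartheta\in C^2([x_0,\infty))$ and a constant $C_h>0$ such that $h(x)=C_hx^c\ell_h(x)$ with $\ell_h(x)=\exp\big(\int_{x_0}^x\frac{\vartheta(t)}{t}dt\big)$ for every $x\ge x_0$, and, if $c>1$, then $\lim_{x\to\infty}\vartheta(x)=\lim_{x\to\infty}x\vartheta'(x)=\lim_{x\to\infty}x^2\vartheta''(x)=0$; (iii) if $c=1$, then $\vartheta$ is positive and decreasing, for every $\varepsilon>0$ one has $1/\vartheta(x)\lesssim_\varepsilon x^\varepsilon$, $\lim_{x\to\infty}x/h(x)=0$, and $\lim_{x\to\infty}\vartheta(x)=\lim_{x\to\infty}\frac{x\vartheta'(x)}{\vartheta(x)}=\lim_{x\to\infty}\frac{x^2\vartheta''(x)}{\vartheta(x)}=0$. The constant $N_0$ is a fixed, sufficiently large positive integer depending only on $h_1,h_2,h_3$; in particular, for all $x\ge N_0$ each $h_k$ is defined and $h_k'(x)\ge1$, so that $m\mapsto\lfloor h_k(m)\rfloor$ is injective on integers $m\ge N_0$. For a positive integer $\lambda$, \[ r_{h_1,h_2,h_3}(\lambda):=\#\{(x_1,x_2,x_3)\in\mathbb Z^3:\ x_1,x_2,x_3\ge N_0,\ \lfloor h_1(x_1)\rfloor+\lfloor h_2(x_2)\rfloor+\lfloor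 h_3(x_3)\rfloor=\lambda\}. \] *)

(* Defs.v *)
From Stdlib Require Import Reals ZArith Ensembles Finite_sets.
From Coquelicot Require Import Coquelicot.

Local Open Scope R_scope.

(** [f'] is the derivative of [f] on [D] relative to [D]: one-sided at an
    endpoint of [D], the usual derivative at an interior point. *)
Definition is_derive_on (D : R -> Prop) (f f' : R -> R) : Prop :=
  forall x, D x ->
    filterdiff f (within D (locally x)) (fun y => scal y (f' x)).

(** [class_F c x0 h]: the restriction of [h] to [x0, +oo) belongs to the class
    F_c.  The values of [h] to the left of [x0] are never used. *)
Definition class_F (c x0 : R) (h : R -> R) : Prop :=
  let D := fun x => x0 <= x in
  1 <= x0 /\
  (forall x, D x -> 1 <= h x) /\
  (exists h' h'' h''' : R -> R,
     is_derive_on D h h' /\ is_derive_on D h' h'' /\ is_derive_on D h'' h''' /\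
     continuous_on D h''' /\
     (forall x, D x -> 0 < h' x /\ 0 < h'' x)) /\
  (exists (theta theta' theta'' : R -> R) (C_h : R),
     is_derive_on D theta theta' /\ is_derive_on D theta' theta'' /\
     continuous_on D theta'' /\
     0 < C_h /\
     (forall x, D x ->
        h x = C_h * Rpower x c * exp (RInt (fun t => theta t / t) x0 x)) /\
     (1 < c ->
        is_lim theta p_infty 0 /\
        is_lim (fun x => x * theta' x) p_infty 0 /\
        is_lim (fun x => x ^ 2 * theta'' x) p_infty 0) /\
     (c = 1 ->
        (forall x, D x -> 0 < theta x) /\
        (forall x y, D x -> x <= y -> theta y <= theta x) /\
        (forall eps, 0 < eps -> exists K, 0 < K /\
           forall x, D x -> 1 / theta x <= K * Rpower x eps) /\
        is_lim (fun x => x / h x) p_infty 0 /\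
        is_lim theta p_infty 0 /\
        is_lim (fun x => x * theta' x / theta x) p_infty 0 /\
        is_lim (fun x => x ^ 2 * theta'' x / theta x) p_infty 0)).

(** [phi] inverts [h : [x0, +oo) -> h([x0, +oo))]; it is unconstrained outside
    the range of [h]. *)
Definition is_inverse (x0 : R) (h phi : R -> R) : Prop :=
  forall x, x0 <= x -> phi (h x) = x.

(** [x0 < N0] is strict so that every [x >= N0] is interior to the domain of
    [h], where [Derive h x] is meaningful whatever [h] is to the left of [x0]. *)
Definition admissible_start (x0 : R) (h : R -> R) (N0 : Z) : Prop :=
  x0 < IZR N0 /\ forall x, IZR N0 <= x -> 1 <= Derive h x.

Definition representations (h1 h2 h3 : R -> R) (N0 : Z) (lambda : nat) :
    Ensemble (Z * Z * Z) :=
  fun '(m1, m2, m3) =>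
    (N0 <= m1)%Z /\ (N0 <= m2)%Z /\ (N0 <= m3)%Z /\
    (Int_part (h1 (IZR m1)) + Int_part (h2 (IZR m2)) + Int_part (h3 (IZR m3))
     = Z.of_nat lambda)%Z.

Definition Gamma (s : R) : R :=
  RInt_gen (fun t => Rpower t (s - 1) * exp (- t))
    (at_right 0) (Rbar_locally p_infty).

Definition main_order (phi1 phi2 phi3 : R -> R) (lambda : nat) : R :=
  INR lambda ^ 2 * Derive phi1 (INR lambda) * Derive phi2 (INR lambda)
    * Derive phi3 (INR lambda).

(* Main.v *)
Require Import Defs.
From Stdlib Require Import List FinFun FunctionalExtensionality PropExtensionality.
From Stdlib Require Import Reals ZArith Ensembles Finite_sets Lra Lia Psatz.
From Coquelicot Require Import Coquelicot.

Local Open Scope R_scope.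

(** The number of representations is a trilinear form [tri lambda f1 f2 f3], the
    sum of [f1 i * f2 j * f3 k] over [i + j + k = lambda], where [f_k n] counts the
    integers [m >= N0] with [floor (h_k m) = n] ([solutions_count]).  As [h_k] is
    increasing with inverse [phi_k], [f_k n] is the number of integers [m] with
    [phi_k n <= m < phi_k (n + 1)].  It therefore equals the gap
    [phi_k (n + 1) - phi_k n] plus a difference of two values of the sawtooth
    function along [phi_k] ([hits_eq]).

    Error terms.  Replacing the counts by the gaps one factor at a time leaves
    three forms in which one factor is a sawtooth difference.  Fourier analysis on
    a cyclic group bounds such a form by the uniform norm of the transform of that
    factor times the mean square norms of the other two ([tri_bound]).  The mean
    squares are at most about [phi_k lambda], because nearly all the counts are [0]
    or [1].
    For the uniform norm, the sawtooth is approximated by a Fejer mean, with an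
    error controlled by another Fejer kernel ([saw_approx]).  The exponential sums with
    phase [m phi_k n + n xi] that result are bounded by van der Corput's second
    derivative test, in terms of second differences of [phi_k]
    ([cos_sum_second_difference], [twisted_saw_bound], [twisted_range]).  With
    [delta_k = 1 - gamma_k], the error from the first factor is smaller than the
    main term as soon as [3 delta_1 + 2 (delta_2 + delta_3) < 1], which follows from
    the hypothesis on the exponents ([error_negligible]), and similarly for the
    other two factors.

    Main term.  The gaps are about [phi_k' n], and [phi_k'] varies regularly with
    index [gamma_k - 1].  So they are compared with multiples of the coefficients
    [negbin gamma_k n] of [(1 - x) ^ (- gamma_k)], which have the same order of
    growth.  These coefficients convolve exactly ([tri_negbin]) and are asymptotic
    to [n ^ (s - 1) / Gamma s] ([negbin_asymptotic], from the log-convexity of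
    [Gamma]).  This gives the quotient of Gamma values without a multiple integral
    ([tri_gaps_asymptotic]).

    The properties of [phi_k] that are used are collected in [profile]; they follow
    from the formulas for [h_k'] and [h_k''] in terms of [theta]
    ([class_F_facts], [class_F_profile]). *)

(** * Quotients and finite sums *)

Lemma le_div (a b c : R) : 0 < c -> a * c <= b -> a <= b / c.
Proof. intros Hc H. apply Rle_div_r; auto. Qed.

Lemma div_le (a b c : R) : 0 < c -> a <= b * c -> a / c <= b.
Proof. intros Hc H. apply Rle_div_l; auto. Qed.

Fixpoint Rsum (f : nat -> R) (n : nat) : R :=
  match n with O => 0 | S n => Rsum f n + f n end.

Lemma Rsum_ext f g n :
  (forall i, (i < n)%nat -> f i = g i) -> Rsum f n = Rsum g n.
Proof.
  induction n as [|n IH]; intros H; simpl; auto.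
  rewrite IH, H; auto; intros; apply H; lia.
Qed.

Lemma Rsum_le f g n :
  (forall i, (i < n)%nat -> f i <= g i) -> Rsum f n <= Rsum g n.
Proof.
  induction n as [|n IH]; intros H; simpl; try lra.
  apply Rplus_le_compat; [apply IH; intros|]; apply H; lia.
Qed.

Lemma Rsum_plus f g n : Rsum (fun i => f i + g i) n = Rsum f n + Rsum g n.
Proof. induction n; simpl; lra. Qed.

Lemma Rsum_minus f g n : Rsum (fun i => f i - g i) n = Rsum f n - Rsum g n.
Proof. induction n; simpl; lra. Qed.

Lemma Rsum_scal c f n : Rsum (fun i => c * f i) n = c * Rsum f n.
Proof. induction n as [|n IH]; simpl; [ring|rewrite IH; ring]. Qed.

Lemma Rsum_scal_r c f n : Rsum (fun i => f i * c) n = Rsum f n * c.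
Proof. induction n as [|n IH]; simpl; [ring|rewrite IH; ring]. Qed.

Lemma Rsum_const c n : Rsum (fun _ => c) n = INR n * c.
Proof. induction n as [|n IH]; [simpl; ring|]. rewrite S_INR; simpl; rewrite IH; ring. Qed.

Lemma Rsum_zero f n : (forall i, (i < n)%nat -> f i = 0) -> Rsum f n = 0.
Proof. intros H. rewrite (Rsum_ext f (fun _ => 0) n H), Rsum_const; ring. Qed.

Lemma Rsum_nonneg f n : (forall i, (i < n)%nat -> 0 <= f i) -> 0 <= Rsum f n.
Proof. intros H. rewrite <- (Rsum_zero (fun _ => 0) n); auto. apply Rsum_le; auto. Qed.

Lemma Rsum_abs f n : Rabs (Rsum f n) <= Rsum (fun i => Rabs (f i)) n.
Proof.
  induction n as [|n IH]; simpl; [rewrite Rabs_R0; lra|].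
  eapply Rle_trans; [apply Rabs_triang|lra].
Qed.

Lemma Rsum_abs_le f g n :
  (forall i, (i < n)%nat -> Rabs (f i) <= g i) -> Rabs (Rsum f n) <= Rsum g n.
Proof. intros H. eapply Rle_trans; [apply Rsum_abs|apply Rsum_le; auto]. Qed.

Lemma Rsum_split f n m :
  Rsum f (n + m) = Rsum f n + Rsum (fun i => f (n + i)%nat) m.
Proof.
  induction m as [|m IH]; simpl; [rewrite Nat.add_0_r; ring|].
  rewrite Nat.add_succ_r; simpl; rewrite IH; ring.
Qed.

Lemma Rsum_split_le f n m : (m <= n)%nat ->
  Rsum f n = Rsum f m + Rsum (fun i => f (m + i)%nat) (n - m).
Proof. intros H. rewrite <- Rsum_split. f_equal; lia. Qed.

Lemma Rsum_shift f n : Rsum f (S n) = f O + Rsum (fun i => f (S i)) n.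
Proof. change (S n) with (1 + n)%nat. rewrite Rsum_split; simpl; ring. Qed.

Lemma Rsum_exchange f n m :
  Rsum (fun i => Rsum (fun j => f i j) m) n
  = Rsum (fun j => Rsum (fun i => f i j) n) m.
Proof.
  induction n as [|n IH]; simpl.
  - symmetry; apply Rsum_zero; auto.
  - rewrite IH, <- Rsum_plus; reflexivity.
Qed.

Lemma Rsum_telescope f n : Rsum (fun i => f (S i) - f i) n = f n - f O.
Proof. induction n as [|n IH]; simpl; [ring|rewrite IH; ring]. Qed.

Lemma Rsum_mono f n m :
  (n <= m)%nat -> (forall i, (i < m)%nat -> 0 <= f i) -> Rsum f n <= Rsum f m.
Proof.
  intros H Hf. rewrite (Rsum_split_le f m n H).
  assert (0 <= Rsum (fun i => f (n + i)%nat) (m - n)); [|lra].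
  apply Rsum_nonneg; intros; apply Hf; lia.
Qed.

Lemma Rsum_if_eq f n k :
  Rsum (fun i => if Nat.eq_dec i k then f i else 0) n
  = if lt_dec k n then f k else 0.
Proof.
  induction n as [|n IH]; simpl; [destruct (lt_dec k 0); [lia|auto]|].
  rewrite IH. destruct (lt_dec k n), (lt_dec k (S n)), (Nat.eq_dec n k);
    subst; try lia; ring.
Qed.

Ltac abs_lra :=
  repeat match goal with H : Rabs _ <= _ |- _ => apply Rabs_le_between in H end;
  apply Rabs_le_between; lra.

(** * Cosine sums with controlled first and second differences *)

(** Summation by parts moves the differences onto [c], and the differences of
    a monotone bounded sequence have bounded total. *)
Lemma abel_monotone (c s : nat -> R) (A : R) (N : nat) :
  0 <= A ->
  (forall n, (n < N)%nat -> Rabs (c n) <= A) ->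
  (forall n, (S n < N)%nat -> c n <= c (S n)) ->
  (forall n, Rabs (s n) <= 1) ->
  Rabs (Rsum (fun n => c n * (s (S n) - s n)) N) <= 4 * A.
Proof.
  intros HA Hc Hm Hs.
  assert (Hs' : forall n, -1 <= s n <= 1) by (intros n; apply Rabs_le_between, Hs).
  destruct N as [|N]; [simpl; rewrite Rabs_R0; lra|].
  assert (Hc' : forall n, (n <= N)%nat -> - A <= c n <= A)
    by (intros n Hn; apply Rabs_le_between, Hc; lia).
  assert (H : forall M, (M <= N)%nat ->
    Rabs (Rsum (fun n => c n * (s (S n) - s n)) (S M) - c M * s (S M))
      <= A + (c M - c O)).
  { induction M as [|M IH]; intros HM.
    - simpl. replace (_ - _) with (- (c O * s O)) by ring.
      rewrite Rabs_Ropp, Rabs_mult.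
      specialize (Hc O ltac:(lia)); specialize (Hs O).
      pose proof (Rabs_pos (c O)); pose proof (Rabs_pos (s O)); nra.
    - specialize (IH ltac:(lia)). specialize (Hm M ltac:(lia)).
      cbn [Rsum] in *.
      match goal with |- Rabs ?x <= _ => match type of IH with Rabs ?y <= _ =>
        replace x with (y - (c (S M) - c M) * s (S M)) by ring end end.
      apply Rabs_le_between in IH. apply Rabs_le_between.
      specialize (Hs' (S M)). nra. }
  specialize (H N (le_n N)). apply Rabs_le_between in H. apply Rabs_le_between.
  pose proof (Hc' N (le_n N)); pose proof (Hc' O ltac:(lia));
  pose proof (Hs' (S N)). nra.
Qed.

Lemma sin_ge_third y : 0 <= y <= PI / 2 -> y / 3 <= sin y.
Proof.
  intros [H0 H1]. pose proof PI_4 as HP.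
  destruct (sin_bound y 0) as [H _]; [lra|lra|].
  unfold sin_approx, sin_term in H; simpl in H.
  eapply Rle_trans; [|apply H].
  unfold Rdiv. nra.
Qed.

Definition cot (x : R) : R := cos x / sin x.

Lemma cot_decreasing x y : 0 < x -> x <= y -> y < PI -> cot y <= cot x.
Proof.
  intros Hx Hxy Hy.
  assert (0 < sin x) by (apply sin_gt_0; lra).
  assert (0 < sin y) by (apply sin_gt_0; lra).
  assert (0 <= sin (y - x)) by (apply sin_ge_0; lra).
  rewrite sin_minus in H1.
  apply Rminus_le. unfold cot.
  replace (cos y / sin y - cos x / sin x)
    with (- ((sin y * cos x - cos y * sin x) / (sin x * sin y))) by (field; lra).
  assert (0 <= (sin y * cos x - cos y * sin x) / (sin x * sin y)); [|lra].
  apply Rdiv_le_0_compat; nra.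
Qed.

Lemma cot_bound t x : 0 < t <= PI -> t / 2 <= x <= PI - t / 2 -> Rabs (cot x) <= 6 / t.
Proof.
  intros Ht Hx.
  assert (Hs : t / 6 <= sin x).
  { destruct (Rle_dec x (PI / 2)).
    - pose proof (sin_ge_third x ltac:(lra)); lra.
    - rewrite <- sin_PI_x. pose proof (sin_ge_third (PI - x) ltac:(lra)); lra. }
  unfold cot, Rdiv. rewrite Rabs_mult, Rabs_inv, (Rabs_right (sin x)) by lra.
  assert (Rabs (cos x) <= 1) by (apply Rabs_le_between, COS_bound).
  assert (/ sin x <= 6 / t).
  { replace (6 / t) with (/ (t / 6)) by (field; lra). apply Rinv_le_contravar; lra. }
  assert (0 < / sin x) by (apply Rinv_0_lt_compat; lra).
  apply Rle_trans with (1 * / sin x); [apply Rmult_le_compat_r; lra|]. unfold Rdiv in *; lra.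
Qed.

Lemma cos_add_turns (x : R) (k : Z) : cos (x + 2 * IZR k * PI) = cos x.
Proof.
  destruct (Z_le_gt_dec 0 k) as [Hk|Hk].
  - rewrite <- (Z2Nat.id k Hk), <- INR_IZR_INZ. apply cos_period.
  - rewrite <- (cos_period (x + 2 * IZR k * PI) (Z.to_nat (- k))).
    rewrite INR_IZR_INZ, Z2Nat.id, opp_IZR by lia. f_equal; ring.
Qed.

Lemma sin_add_turns (x : R) (k : Z) : sin (x + 2 * IZR k * PI) = sin x.
Proof.
  rewrite <- (cos_shift x), <- (cos_shift (x + _)), <- (cos_add_turns (PI / 2 - x) (- k)).
  rewrite opp_IZR. f_equal. ring.
Qed.

(** Real part of the identity [z = (w - z) / (w / z - 1)] for [z = exp (i a)]
    and [w = exp (i b)]: the real part of [1 / (exp (i x) - 1)] is [- 1 / 2] and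
    its imaginary part is [- cot (x / 2) / 2]. *)
Lemma cos_as_difference a b :
  sin ((b - a) / 2) <> 0 ->
  cos a = - / 2 * (cos b - cos a) + / 2 * (cot ((b - a) / 2) * (sin b - sin a)).
Proof.
  intros H. set (d := (b - a) / 2) in *.
  assert (Hb : b = (a + d) + d) by (unfold d; field).
  assert (Ha : a = (a + d) - d) by ring.
  set (e := a + d) in *. rewrite Hb, Ha. clearbody e d. clear Ha Hb.
  rewrite cos_plus, cos_minus, sin_plus, sin_minus.
  unfold cot. field. auto.
Qed.

(** The Kusmin-Landau bound.  By [cos_as_difference] the sum is a telescoping
    sum plus a sum of differences of sines weighted by cotangents.  The weights are
    monotone because the increments of [f] are, so [abel_monotone] applies. *)
Lemma kusmin_landau (f : nat -> R) (N : nat) (t : R) :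
  0 < t <= PI ->
  (forall n, (n < N)%nat -> t <= f (S n) - f n <= 2 * PI - t) ->
  (forall n, (S n < N)%nat -> f (S (S n)) - f (S n) <= f (S n) - f n) ->
  Rabs (Rsum (fun n => cos (f n)) N) <= 1 + 12 / t.
Proof.
  intros Ht Hd Hm.
  rewrite (Rsum_ext _ (fun n => - / 2 * (cos (f (S n)) - cos (f n))
     + / 2 * (cot ((f (S n) - f n) / 2) * (sin (f (S n)) - sin (f n))))).
  2:{ intros i Hi. apply cos_as_difference.
      specialize (Hd i Hi). apply Rgt_not_eq, sin_gt_0; lra. }
  rewrite Rsum_plus, !Rsum_scal, (Rsum_telescope (fun n => cos (f n))).
  assert (H : Rabs (Rsum (fun n => cot ((f (S n) - f n) / 2) * (sin (f (S n)) - sin (f n))) N)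
     <= 4 * (6 / t)).
  { apply (abel_monotone (fun n => cot ((f (S n) - f n) / 2)) (fun n => sin (f n))).
    - apply Rlt_le, Rdiv_lt_0_compat; lra.
    - intros n Hn; specialize (Hd n Hn). apply cot_bound; lra.
    - intros n Hn. pose proof (Hd n ltac:(lia)). pose proof (Hd (S n) Hn).
      specialize (Hm n Hn). apply cot_decreasing; lra.
    - intros n. apply Rabs_le_between, SIN_bound. }
  apply Rabs_le_between in H. apply Rabs_le_between.
  pose proof (COS_bound (f N)); pose proof (COS_bound (f O)).
  unfold Rdiv in *; lra.
Qed.

Lemma decreasing_split (d : nat -> R) (c : R) (N : nat) :
  (forall n, (S n < N)%nat -> d (S n) <= d n) ->
  exists M, (M <= N)%nat /\ (forall n, (n < M)%nat -> c <= d n) /\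
    (forall n, (M <= n < N)%nat -> d n < c).
Proof.
  induction N as [|N IH]; intros H.
  - exists O; repeat split; intros; lia.
  - destruct IH as (M & HM & H1 & H2); [intros; apply H; lia|].
    destruct (Nat.eq_dec M N) as [->|HMN].
    + destruct (Rle_dec c (d N)) as [Hc|Hc].
      * exists (S N); repeat split; try intros n Hn; [lia| |lia].
        destruct (Nat.eq_dec n N); [subst; auto|apply H1; lia].
      * exists N; repeat split; try intros n Hn; [lia|auto|].
        replace n with N by lia; lra.
    + exists M; repeat split; try intros n Hn; [lia|auto|].
      destruct (Nat.eq_dec n N); [subst|apply H2; lia].
      eapply Rle_lt_trans; [|apply (H2 (N - 1)%nat); lia].
      replace (d N) with (d (S (N - 1))) by (f_equal; lia). apply H; lia.
Qed.

Lemma Rabs_sum_cos_le (f : nat -> R) (N : nat) :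
  Rabs (Rsum (fun n => cos (f n)) N) <= INR N.
Proof.
  rewrite <- (Rmult_1_r (INR N)), <- Rsum_const. apply Rsum_abs_le.
  intros; apply Rabs_le_between, COS_bound.
Qed.

Lemma strongly_decreasing_count (d : nat -> R) (mu w : R) (N : nat) :
  0 < mu ->
  (forall n, (S n < N)%nat -> d (S n) <= d n - mu) ->
  (forall n m, (n < N)%nat -> (m < N)%nat -> d n - d m <= w) ->
  0 <= w ->
  INR N <= w / mu + 1.
Proof.
  intros Hmu H Hw Hw0. destruct N as [|N].
  { simpl. assert (0 <= w / mu) by (apply Rdiv_le_0_compat; lra). lra. }
  assert (Hd : forall n, (n <= N)%nat -> d n <= d O - INR n * mu).
  { induction n as [|n IH]; intros Hn; [simpl; lra|].
    specialize (IH ltac:(lia)). specialize (H n ltac:(lia)). rewrite S_INR; lra. }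
  specialize (Hd N (le_n N)). specialize (Hw O N ltac:(lia) ltac:(lia)).
  rewrite S_INR. apply Rplus_le_compat_r. apply Rle_div_r; lra.
Qed.

Section SecondDifference.

Variables mu t : R.
Hypothesis Hmu : 0 < mu.
Hypothesis Ht : 0 < t <= PI.

Let B := 2 * (t / mu + 1) + (1 + 12 / t).

Definition concave_seq (f : nat -> R) (N : nat) : Prop :=
  forall n, (S n < N)%nat -> f (S (S n)) - f (S n) <= f (S n) - f n - mu.

Lemma concave_seq_shift f N k :
  concave_seq f N -> concave_seq (fun n => f (k + n)%nat) (N - k).
Proof.
  intros H n Hn. specialize (H (k + n)%nat ltac:(lia)).
  replace (k + S n)%nat with (S (k + n)) by lia.
  replace (k + S (S n))%nat with (S (S (k + n))) by lia. auto.
Qed.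

(** Only about [t / mu] indices have an increment within [t] of each end of the
    turn, and they are estimated trivially; the indices in between form an interval
    to which [kusmin_landau] applies. *)
Lemma cos_sum_one_turn (f : nat -> R) (N : nat) :
  concave_seq f N ->
  (forall n, (n < N)%nat -> 0 <= f (S n) - f n < 2 * PI) ->
  Rabs (Rsum (fun n => cos (f n)) N) <= B.
Proof.
  intros Hc Hd. set (d := fun n => f (S n) - f n).
  assert (Hdec : forall n, (S n < N)%nat -> d (S n) <= d n - mu) by exact Hc.
  destruct (decreasing_split d (2 * PI - t) N) as (M1 & HM1 & A1 & A2).
  { intros n Hn; specialize (Hdec n Hn); lra. }
  destruct (decreasing_split d t N) as (M2 & HM2 & B1 & B2).
  { intros n Hn; specialize (Hdec n Hn); lra. }
  assert (HB : 0 < 12 / t /\ 0 < t / mu) by (split; apply Rdiv_lt_0_compat; lra).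
  assert (C1 : INR M1 <= t / mu + 1).
  { apply (strongly_decreasing_count d); [auto| | |lra].
    - intros; apply Hdec; lia.
    - intros n m Hn Hm. specialize (A1 m Hm). specialize (Hd n ltac:(lia)).
      unfold d in *; lra. }
  assert (C2 : INR (N - M2) <= t / mu + 1).
  { apply (strongly_decreasing_count (fun n => d (M2 + n)%nat)); [auto| | |lra].
    - intros n Hn. specialize (Hdec (M2 + n)%nat ltac:(lia)).
      replace (M2 + S n)%nat with (S (M2 + n)) by lia. auto.
    - intros n m Hn Hm. specialize (B2 (M2 + n)%nat ltac:(lia)).
      specialize (Hd (M2 + m)%nat ltac:(lia)).
      unfold d in *; lra. }
  unfold B. destruct (le_dec M1 M2) as [HM|HM].
  - rewrite (Rsum_split_le _ N M2), (Rsum_split_le _ M2 M1) by lia.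
    pose proof (Rabs_sum_cos_le f M1) as E1.
    pose proof (Rabs_sum_cos_le (fun i => f (M2 + i)%nat) (N - M2)) as E2.
    assert (E3 : Rabs (Rsum (fun n => cos (f (M1 + n)%nat)) (M2 - M1)) <= 1 + 12 / t).
    { apply kusmin_landau; auto.
      - intros n Hn. specialize (A2 (M1 + n)%nat ltac:(lia)).
        specialize (B1 (M1 + n)%nat ltac:(lia)). unfold d in *.
        replace (M1 + S n)%nat with (S (M1 + n)) by lia. lra.
      - intros n Hn. specialize (Hdec (M1 + n)%nat ltac:(lia)). unfold d in *.
        replace (M1 + S n)%nat with (S (M1 + n)) by lia.
        replace (M1 + S (S n))%nat with (S (S (M1 + n))) by lia. lra. }
    abs_lra.
  - rewrite (Rsum_split_le _ N M2) by lia.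
    pose proof (Rabs_sum_cos_le f M2) as E1.
    pose proof (Rabs_sum_cos_le (fun i => f (M2 + i)%nat) (N - M2)) as E2.
    assert (INR M2 <= INR M1) by (apply le_INR; lia).
    abs_lra.
Qed.

Lemma cos_sum_turns (K : nat) (f : nat -> R) (N : nat) (k : Z) :
  concave_seq f N ->
  (forall n, (n < N)%nat ->
     2 * PI * IZR k <= f (S n) - f n < 2 * PI * (IZR k + INR K)) ->
  Rabs (Rsum (fun n => cos (f n)) N) <= INR K * B.
Proof.
  revert f N. induction K as [|K IH]; intros f N Hc Hd.
  - destruct N as [|N]; [simpl; rewrite Rabs_R0; lra|].
    specialize (Hd O ltac:(lia)). simpl in Hd. lra.
  - set (c := 2 * PI * (IZR k + INR K)).
    destruct (decreasing_split (fun n => f (S n) - f n) c N) as (M & HM & A1 & A2).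
    { intros n Hn; specialize (Hc n Hn); lra. }
    rewrite (Rsum_split_le _ N M) by lia.
    assert (E1 : Rabs (Rsum (fun n => cos (f n)) M) <= B).
    { (* subtracting the linear phase [c n] brings the increments into one turn *)
      rewrite (Rsum_ext _ (fun n => cos (f n - c * INR n))).
      2:{ intros i _. unfold c. set (u := (k + Z.of_nat K)%Z).
          replace (f i - _) with (f i + 2 * IZR (- (u * Z.of_nat i)) * PI).
          - symmetry. apply cos_add_turns.
          - rewrite opp_IZR, mult_IZR, <- INR_IZR_INZ. unfold u.
            rewrite plus_IZR, <- INR_IZR_INZ. ring. }
      apply (cos_sum_one_turn (fun n => f n - c * INR n)).
      - intros n Hn. specialize (Hc n ltac:(lia)). rewrite !S_INR. lra.
      - intros n Hn. specialize (A1 n Hn). specialize (Hd n ltac:(lia)).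
        rewrite S_INR in *. unfold c in *. lra. }
    assert (E2 : Rabs (Rsum (fun n => cos (f (M + n)%nat)) (N - M)) <= INR K * B).
    { apply (IH (fun n => f (M + n)%nat)); [apply concave_seq_shift; auto|].
      intros n Hn. specialize (A2 (M + n)%nat ltac:(lia)).
      specialize (Hd (M + n)%nat ltac:(lia)).
      replace (M + S n)%nat with (S (M + n)) by lia. unfold c in *; lra. }
    apply Rabs_le_between in E1. apply Rabs_le_between in E2.
    apply Rabs_le_between. rewrite S_INR. lra.
Qed.

(** Van der Corput's second derivative test, for finite differences: the
    increments of [f] visit at most [V + 2] full turns, and each turn costs [B]. *)
Lemma cos_sum_second_difference (f : nat -> R) (N : nat) (V : R) :
  concave_seq f N ->
  (forall n m, (n < N)%nat -> (m < N)%nat ->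
     (f (S n) - f n) - (f (S m) - f m) <= 2 * PI * V) ->
  0 <= V ->
  Rabs (Rsum (fun n => cos (f n)) N) <= (V + 2) * B.
Proof.
  intros Hc Hv HV.
  assert (HB : 0 < B).
  { unfold B. assert (0 < 12 / t /\ 0 < t / mu) by (split; apply Rdiv_lt_0_compat; lra). lra. }
  destruct N as [|N]; [simpl; rewrite Rabs_R0; nra|].
  (* the smallest increment is the last one; it fixes the first turn *)
  set (z := (f (S N) - f N) / (2 * PI)).
  destruct (archimed z) as [U1 U2].
  destruct (archimed V) as [V1 V2].
  assert (HVZ : (0 <= up V)%Z) by (apply le_IZR; lra).
  assert (E : INR (Z.to_nat (up V)) = IZR (up V))
    by (rewrite INR_IZR_INZ, Z2Nat.id; auto).
  apply Rle_trans with (INR (S (Z.to_nat (up V))) * B).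
  2:{ apply Rmult_le_compat_r; [lra|]. rewrite S_INR, E. lra. }
  apply (cos_sum_turns _ _ _ (up z - 1)); auto.
  assert (Hz : f (S N) - f N = 2 * PI * z) by (unfold z; field; lra).
  intros n Hn. rewrite S_INR, E, minus_IZR. split.
  - apply Rle_trans with (f (S N) - f N); [rewrite Hz; nra|].
    specialize (Hv n N Hn ltac:(lia)).
    clear - Hc Hn Hmu.
    assert (H : forall j, (j <= N)%nat -> f (S N) - f N <= f (S (N - j)) - f (N - j)%nat).
    { induction j as [|j IH]; intros Hj; [rewrite Nat.sub_0_r; lra|].
      specialize (IH ltac:(lia)). specialize (Hc (N - S j)%nat ltac:(lia)).
      replace (S (N - S j)) with (N - j)%nat in * by lia. lra. }
    specialize (H (N - n)%nat ltac:(lia)).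
    replace (N - (N - n))%nat with n in H by lia. lra.
  - specialize (Hv n N Hn ltac:(lia)). nra.
Qed.

End SecondDifference.

(** * The sawtooth and its Fejer approximation *)

(** [M] times the classical Fejer kernel of order [M], in the variable [y / PI]. *)
Definition fejer (M : nat) (y : R) : R :=
  INR M + 2 * Rsum (fun i => (INR M - INR (S i)) * cos (2 * INR (S i) * y)) M.

Lemma dirichlet_kernel (M : nat) (y : R) :
  sin y * (1 + 2 * Rsum (fun i => cos (2 * INR (S i) * y)) M) = sin ((2 * INR M + 1) * y).
Proof.
  induction M as [|M IH]; cbn [Rsum].
  - simpl. replace ((2 * 0 + 1) * y) with y by ring. ring.
  - replace (sin ((2 * INR (S M) + 1) * y))
      with (sin ((2 * INR M + 1) * y) + 2 * sin y * cos (2 * INR (S M) * y)).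
    + rewrite <- IH. ring.
    + replace ((2 * INR M + 1) * y) with (2 * INR (S M) * y - y) by (rewrite S_INR; ring).
      replace ((2 * INR (S M) + 1) * y) with (2 * INR (S M) * y + y) by ring.
      rewrite sin_minus, sin_plus. ring.
Qed.

Lemma fejer_succ (M : nat) (y : R) :
  fejer (S M) y = fejer M y + (1 + 2 * Rsum (fun i => cos (2 * INR (S i) * y)) M).
Proof.
  unfold fejer. cbn [Rsum].
  rewrite (Rsum_ext (fun i => (INR (S M) - INR (S i)) * cos (2 * INR (S i) * y))
    (fun i => (INR M - INR (S i)) * cos (2 * INR (S i) * y) + cos (2 * INR (S i) * y))).
  - rewrite Rsum_plus, (S_INR M). ring.
  - intros i _. rewrite (S_INR M). ring.
Qed.

Lemma fejer_closed (M : nat) (y : R) :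
  fejer M y * (sin y * sin y) = sin (INR M * y) * sin (INR M * y).
Proof.
  induction M as [|M IH].
  - unfold fejer; simpl. replace (0 * y) with 0 by ring. rewrite sin_0. ring.
  - rewrite fejer_succ, Rmult_plus_distr_r, IH.
    replace (_ * (sin y * sin y)) with (sin y * sin ((2 * INR M + 1) * y))
      by (rewrite <- dirichlet_kernel; ring).
    rewrite S_INR. set (a := INR M * y).
    replace ((2 * INR M + 1) * y) with (a + (a + y)) by (unfold a; ring).
    replace ((INR M + 1) * y) with (a + y) by (unfold a; ring).
    rewrite (sin_plus a (a + y)), sin_plus, cos_plus.
    pose proof (sin2_cos2 a) as Ea; pose proof (sin2_cos2 y) as Ey; unfold Rsqr in *.
    assert (cos a * cos a = 1 - sin a * sin a) by lra.
    assert (Ey' : cos y * cos y = 1 - sin y * sin y) by lra.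
    ring_simplify.
    replace (cos y ^ 2) with (1 - sin y * sin y) by (rewrite <- Ey'; ring).
    replace (cos a ^ 2) with (1 - sin a * sin a) by (rewrite <- H; ring).
    ring.
Qed.

Lemma fejer_nonneg (M : nat) (y : R) : sin y <> 0 -> 0 <= fejer M y.
Proof.
  intros H. assert (0 < sin y * sin y) by nra.
  pose proof (fejer_closed M y). nra.
Qed.

Lemma fejer_le (M : nat) (y : R) : sin y <> 0 -> fejer M y <= / (sin y * sin y).
Proof.
  intros H. assert (0 < sin y * sin y) by nra.
  apply Rmult_le_reg_r with (sin y * sin y); auto.
  rewrite fejer_closed, Rinv_l by lra.
  pose proof (SIN_bound (INR M * y)); nra.
Qed.

Lemma abs_sin_mult (m : nat) (y : R) : Rabs (sin (INR m * y)) <= INR m * Rabs (sin y).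
Proof.
  induction m as [|m IH].
  - simpl. replace (0 * y) with 0 by ring. rewrite sin_0, Rabs_R0. lra.
  - rewrite S_INR. replace ((INR m + 1) * y) with (INR m * y + y) by ring.
    rewrite sin_plus. eapply Rle_trans; [apply Rabs_triang|]. rewrite !Rabs_mult.
    assert (Rabs (cos y) <= 1) by (apply Rabs_le_between, COS_bound).
    assert (Rabs (cos (INR m * y)) <= 1) by (apply Rabs_le_between, COS_bound).
    pose proof (Rabs_pos (sin (INR m * y))); pose proof (Rabs_pos (sin y)).
    nra.
Qed.

Lemma Rsum_staircase M : 2 * Rsum (fun i => INR M - INR (S i)) M = INR M * (INR M - 1).
Proof.
  induction M as [|M IH]; [simpl; ring|]. cbn [Rsum].
  rewrite (Rsum_ext _ (fun i => (INR M - INR (S i)) + 1)).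
  - rewrite Rsum_plus, Rsum_const, !Rmult_plus_distr_l, IH, S_INR. ring.
  - intros i _. rewrite (S_INR M). ring.
Qed.

(** Near an integer multiple of [PI] all the cosines in the kernel are at least
    [1 / 2], since [sin (m y)] is at most [m] times [sin y] in absolute value. *)
Lemma fejer_large (L : nat) (y : R) :
  Rabs (sin y) * (2 * INR L) <= 1 -> INR L ^ 2 / 2 <= fejer L y.
Proof.
  intros H. unfold fejer.
  assert (/ 2 * Rsum (fun i => INR L - INR (S i)) L <=
    Rsum (fun i => (INR L - INR (S i)) * cos (2 * INR (S i) * y)) L).
  { rewrite <- Rsum_scal. apply Rsum_le. intros i Hi.
    assert (INR (S i) <= INR L) by (apply le_INR; lia).
    rewrite Rmult_comm. apply Rmult_le_compat_l; [lra|].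
    replace (2 * INR (S i) * y) with (2 * (INR (S i) * y)) by ring.
    rewrite cos_2a_sin. pose proof (abs_sin_mult (S i) y) as E.
    set (s := sin (INR (S i) * y)) in *.
    assert (0 <= Rabs s <= / 2).
    { split; [apply Rabs_pos|]. pose proof (Rabs_pos (sin y)). nra. }
    assert (s * s = Rabs s * Rabs s) by (rewrite <- Rabs_mult, Rabs_right; nra).
    nra. }
  pose proof (Rsum_staircase L). pose proof (pos_INR L). nra.
Qed.

(** The Fejer mean of order [M] of the Fourier series of [saw] below.  Its
    derivative is the Fejer kernel minus [1], which drives all estimates of the
    approximation error. *)
Definition trig_saw (M : nat) (y : R) : R :=
  Rsum (fun i => (1 - INR (S i) / INR M) / (PI * INR (S i))
                 * sin (2 * PI * INR (S i) * y)) M.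

Definition ceiling (y : R) : Z := (- Int_part (- y))%Z.

(** One half minus the fractional part, except that the value at integers is
    [- 1 / 2]: this is the error made when [ceiling y] is replaced by [y + 1 / 2]. *)
Definition saw (y : R) : R := IZR (ceiling y) - y - / 2.

Lemma is_derive_Rsum (f f' : nat -> R -> R) (n : nat) (x : R) :
  (forall i, (i < n)%nat -> is_derive (f i) x (f' i x)) ->
  is_derive (fun y => Rsum (fun i => f i y) n) x (Rsum (fun i => f' i x) n).
Proof.
  induction n as [|n IH]; intros H; cbn [Rsum].
  - apply @is_derive_const.
  - apply @is_derive_plus; [apply IH; intros|]; apply H; lia.
Qed.

Lemma is_derive_trig_saw (M : nat) (y : R) : (0 < M)%nat ->
  is_derive (trig_saw M) y (fejer M (PI * y) / INR M - 1).
Proof.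
  intros HM. assert (0 < INR M) by (apply lt_0_INR; lia). pose proof PI_RGT_0.
  evar_last.
  - apply (is_derive_Rsum (fun i y => (1 - INR (S i) / INR M) / (PI * INR (S i))
      * sin (2 * PI * INR (S i) * y))
      (fun i y => 2 / INR M * ((INR M - INR (S i)) * cos (2 * INR (S i) * (PI * y))))).
    intros i Hi. assert (0 < INR (S i)) by (apply lt_0_INR; lia).
    set (c := INR (S i)) in *. clearbody c. auto_derive; auto.
    replace (2 * PI * c * y) with (2 * c * (PI * y)) by ring.
    field. lra.
  - rewrite Rsum_scal. unfold fejer. field. lra.
Qed.

Lemma derivative_nonneg_le (f f' : R -> R) (a b : R) : a <= b ->
  (forall x, a <= x <= b -> is_derive f x (f' x)) ->
  (forall x, a < x < b -> 0 <= f' x) -> f a <= f b.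
Proof.
  intros Hab Hd Hp. destruct (Req_dec a b) as [->|Hne]; [lra|].
  destruct (MVT_cor2 f f' a b) as (c & Hc & Hcab); [lra| |].
  - intros c Hc. apply is_derive_Reals, Hd, Hc.
  - specialize (Hp c Hcab). nra.
Qed.

Lemma sin_half_turns (i : nat) : sin (PI * INR i) = 0.
Proof.
  induction i as [|i IH]; [simpl; rewrite Rmult_0_r; apply sin_0|].
  rewrite S_INR, Rmult_plus_distr_l, Rmult_1_r, neg_sin, IH. ring.
Qed.

Lemma trig_saw_half (M k : nat) : trig_saw M (INR k / 2) = 0.
Proof.
  apply Rsum_zero. intros i _.
  replace (2 * PI * INR (S i) * (INR k / 2)) with (PI * INR (S i * k)).
  - rewrite sin_half_turns. ring.
  - rewrite mult_INR. field.
Qed.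

Lemma trig_saw_period (M : nat) (y : R) (k : Z) : trig_saw M (y + IZR k) = trig_saw M y.
Proof.
  apply Rsum_ext. intros i _. f_equal.
  replace (2 * PI * INR (S i) * (y + IZR k)) with
    (2 * PI * INR (S i) * y + 2 * IZR (k * Z.of_nat (S i)) * PI).
  - apply sin_add_turns.
  - rewrite mult_IZR, <- INR_IZR_INZ. ring.
Qed.

Lemma trig_saw_error_decreasing (M : nat) (a b : R) : (0 < M)%nat ->
  0 <= a -> a <= b -> b <= 1 -> - b - trig_saw M b <= - a - trig_saw M a.
Proof.
  intros HM Ha Hab Hb. assert (0 < INR M) by (apply lt_0_INR; lia).
  assert (a + trig_saw M a <= b + trig_saw M b); [|lra].
  apply (derivative_nonneg_le (fun x => x + trig_saw M x) (fun x => 1 + (fejer M (PI * x) / INR M - 1))); auto.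
  - intros x Hx. apply @is_derive_plus; [apply @is_derive_id|apply is_derive_trig_saw; auto].
  - intros x Hx. assert (0 < sin (PI * x)) by (apply sin_gt_0; pose proof PI_RGT_0; nra).
    assert (0 <= fejer M (PI * x)) by (apply fejer_nonneg; lra).
    assert (0 <= fejer M (PI * x) / INR M) by (apply Rdiv_le_0_compat; auto). lra.
Qed.

(** On one period the error is monotone, because its derivative is minus a
    nonnegative kernel, and it runs from [1 / 2] to [- 1 / 2]. *)
Lemma trig_saw_error_le_half (M : nat) (y : R) : (0 < M)%nat -> 0 <= y <= 1 ->
  Rabs (/ 2 - y - trig_saw M y) <= / 2.
Proof.
  intros HM Hy.
  pose proof (trig_saw_error_decreasing M 0 y HM ltac:(lra) ltac:(lra) ltac:(lra)) as E0.
  pose proof (trig_saw_error_decreasing M y 1 HM ltac:(lra) ltac:(lra) ltac:(lra)) as E1.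
  pose proof (trig_saw_half M 0) as T0. pose proof (trig_saw_half M 2) as T2. simpl in T0, T2.
  replace (0 / 2) with 0 in T0 by field. replace ((1 + 1) / 2) with 1 in T2 by field.
  apply Rabs_le_between. lra.
Qed.

Lemma is_derive_scaled_cot (c x : R) : 0 < c -> sin (PI * x) <> 0 ->
  is_derive (fun x => cot (PI * x) / (PI * c)) x (- / (sin (PI * x) * sin (PI * x)) / c).
Proof.
  intros Hc H. pose proof PI_RGT_0. unfold cot. auto_derive; auto.
  pose proof (sin2_cos2 (PI * x)) as E. unfold Rsqr in E.
  replace (- / (sin (PI * x) * sin (PI * x)))
    with (- (sin (PI * x) * sin (PI * x) + cos (PI * x) * cos (PI * x)) / (sin (PI * x) * sin (PI * x)))
    by (rewrite E; field; auto).
  field; repeat split; auto; lra.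
Qed.

(** The derivative of the error is minus the Fejer kernel, which is at most
    [1 / (M sin^2)], the derivative of [- cot (PI y) / (PI M)].  The error and the
    cotangent both vanish at [1 / 2]. *)
Lemma trig_saw_error_decay (M : nat) (y : R) : (0 < M)%nat -> 0 < y < 1 ->
  Rabs (/ 2 - y - trig_saw M y) * sin (PI * y) <= / (PI * INR M).
Proof.
  intros HM Hy. pose proof PI_RGT_0 as HP.
  assert (HM' : 0 < INR M) by (apply lt_0_INR; lia).
  pose proof (trig_saw_half M 1) as T1. simpl in T1.
  set (g := fun x => x + trig_saw M x + cot (PI * x) / (PI * INR M)).
  assert (Hg : forall a b, 0 < a -> a <= b -> b < 1 -> g b <= g a).
  { intros a b Ha Hab Hb. apply Ropp_le_cancel.
    apply (derivative_nonneg_le (fun x => - g x) (fun x => - (1 + (fejer M (PI * x) / INR M - 1) +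
       - / (sin (PI * x) * sin (PI * x)) / INR M))); auto.
    - intros x Hx. assert (0 < sin (PI * x)) by (apply sin_gt_0; nra).
      apply @is_derive_opp. unfold g.
      apply @is_derive_plus; [apply @is_derive_plus; [apply @is_derive_id|apply is_derive_trig_saw; auto]|].
      apply is_derive_scaled_cot; lra.
    - intros x Hx. assert (0 < sin (PI * x)) by (apply sin_gt_0; nra).
      pose proof (fejer_le M (PI * x) ltac:(lra)).
      replace (- _) with ((/ (sin (PI * x) * sin (PI * x)) - fejer M (PI * x)) / INR M)
        by (field; lra).
      apply Rdiv_le_0_compat; lra. }
  assert (Hs : 0 < sin (PI * y)) by (apply sin_gt_0; nra).
  assert (Hh : g (1 / 2) = 1 / 2).
  { unfold g, cot. rewrite T1. replace (PI * (1 / 2)) with (PI / 2) by field.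
    rewrite cos_PI2. field. rewrite sin_PI2. repeat split; lra. }
  assert (Hcot : cot (PI * y) / (PI * INR M) * sin (PI * y) = cos (PI * y) / (PI * INR M)).
  { unfold cot. field. repeat split; lra. }
  assert (Hcb : - / (PI * INR M) <= cos (PI * y) / (PI * INR M) <= / (PI * INR M)).
  { assert (0 < / (PI * INR M)) by (apply Rinv_0_lt_compat; nra).
    pose proof (COS_bound (PI * y)). unfold Rdiv. nra. }
  destruct (Rle_dec y (1 / 2)).
  - pose proof (Hg y (1 / 2) ltac:(lra) ltac:(lra) ltac:(lra)) as E1.
    pose proof (trig_saw_error_decreasing M y (1 / 2) HM ltac:(lra) ltac:(lra) ltac:(lra)) as E2.
    rewrite Rabs_right by lra. unfold g in *.
    apply Rle_trans with (cot (PI * y) / (PI * INR M) * sin (PI * y)); [|lra].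
    apply Rmult_le_compat_r; lra.
  - pose proof (Hg (1 / 2) y ltac:(lra) ltac:(lra) ltac:(lra)) as E1.
    pose proof (trig_saw_error_decreasing M (1 / 2) y HM ltac:(lra) ltac:(lra) ltac:(lra)) as E2.
    rewrite Rabs_left1 by lra. unfold g in *.
    apply Rle_trans with (- (cot (PI * y) / (PI * INR M)) * sin (PI * y)); [|lra].
    apply Rmult_le_compat_r; lra.
Qed.

Lemma ceiling_bounds y : IZR (ceiling y) - 1 < y <= IZR (ceiling y).
Proof. unfold ceiling. rewrite opp_IZR. destruct (base_Int_part (- y)). lra. Qed.

(** At distance more than about [1 / L] from the integers the error of the
    approximation of order [L ^ 2] is at most [1 / L] by [trig_saw_error_decay].
    Closer to the integers it is at most [1 / 2], which [fejer_large] bounds by a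
    kernel of order [L].  Both terms on the right are trigonometric polynomials, so
    they can be summed along a sequence. *)
Lemma saw_approx (L : nat) (y : R) : (0 < L)%nat ->
  Rabs (saw y - trig_saw (L * L) y) <= / INR L + fejer L (PI * y) / INR L ^ 2.
Proof.
  intros HL. assert (HL' : 0 < INR L) by (apply lt_0_INR; lia).
  pose proof PI2_1 as HP2.
  pose proof (ceiling_bounds y) as Hc.
  (* the representative of [y] modulo 1 in the interval from 0 (excluded) to 1 *)
  set (u := y - (IZR (ceiling y) - 1)) in *.
  assert (Hu : 0 < u <= 1) by (unfold u; lra).
  assert (Ey : trig_saw (L * L) y = trig_saw (L * L) u).
  { rewrite <- (trig_saw_period _ u (ceiling y - 1)). f_equal. unfold u. rewrite minus_IZR. ring. }
  assert (Esin : Rabs (sin (PI * y)) = sin (PI * u)).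
  { rewrite <- (Rabs_right (sin (PI * u))) by (apply Rle_ge, sin_ge_0; nra).
    rewrite <- !(Rabs_Ropp (sin _)).
    assert (Hz : forall (k : Z) x, Rabs (sin (x + IZR k * PI)) = Rabs (sin x)).
    { intros k x. rewrite sin_plus, sin_eq_0_1 with (x := IZR k * PI) by (exists k; auto).
      assert (Hk : Rabs (cos (IZR k * PI)) = 1).
      { pose proof (sin2_cos2 (IZR k * PI)) as E.
        rewrite sin_eq_0_1 with (x := IZR k * PI) in E by (exists k; auto).
        unfold Rsqr in E.
        assert (E' : (Rabs (cos (IZR k * PI)) - 1) * (Rabs (cos (IZR k * PI)) + 1) = 0).
        { replace (_ * _) with (Rabs (cos (IZR k * PI)) * Rabs (cos (IZR k * PI)) - 1) by ring.
          rewrite <- Rabs_mult, Rabs_right by nra. lra. }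
        pose proof (Rabs_pos (cos (IZR k * PI))). nra. }
      rewrite Rmult_0_r, Rplus_0_r, Rabs_mult, Hk. ring. }
    rewrite !Rabs_Ropp. rewrite <- (Hz (ceiling y - 1)%Z (PI * u)). do 2 f_equal.
    unfold u. rewrite minus_IZR. ring. }
  replace (saw y - trig_saw (L * L) y) with (/ 2 - u - trig_saw (L * L) u)
    by (rewrite Ey; unfold saw, u; lra).
  destruct (Rle_dec (sin (PI * u) * (2 * INR L)) 1) as [Hs|Hs].
  - pose proof (fejer_large L (PI * y)) as F. rewrite Esin in F. specialize (F Hs).
    pose proof (trig_saw_error_le_half (L * L) u ltac:(nia) ltac:(lra)).
    assert (0 < / INR L) by (apply Rinv_0_lt_compat; auto).
    assert (/ 2 <= fejer L (PI * y) / INR L ^ 2); [|lra].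
    apply Rle_div_r; [apply pow_lt; auto|]. lra.
  - assert (Hs' : 0 < sin (PI * u)) by nra.
    assert (Hu1 : u < 1).
    { destruct (Req_dec u 1) as [E|]; [|lra]. rewrite E, Rmult_1_r, sin_PI in Hs'. lra. }
    pose proof (trig_saw_error_decay (L * L) u ltac:(nia) ltac:(lra)) as D.
    assert (0 <= fejer L (PI * y)).
    { apply fejer_nonneg. intros E. rewrite E, Rabs_R0 in Esin. lra. }
    assert (0 <= fejer L (PI * y) / INR L ^ 2) by (apply Rdiv_le_0_compat; [auto|apply pow_lt; auto]).
    assert (Rabs (/ 2 - u - trig_saw (L * L) u) <= / INR L); [|lra].
    set (e := Rabs _) in *.
    rewrite mult_INR in D.
    apply Rmult_le_reg_r with (sin (PI * u)); auto.
    eapply Rle_trans; [apply D|].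
    apply Rle_trans with (/ INR L * / (2 * INR L)).
    + rewrite <- Rinv_mult. apply Rinv_le_contravar; nra.
    + apply Rmult_le_compat_l; [apply Rlt_le, Rinv_0_lt_compat; auto|].
      apply Rmult_le_reg_r with (2 * INR L); [lra|]. rewrite Rinv_l; lra.
Qed.

(** * Sawtooth sums with a linear twist *)

Lemma sum_inv_sqrt (M : nat) : Rsum (fun i => / sqrt (INR (S i))) M <= 2 * sqrt (INR M).
Proof.
  induction M as [|M IH]; cbn [Rsum]; [change (INR 0) with 0; rewrite sqrt_0; lra|].
  assert (HM : 0 <= INR M) by apply pos_INR.
  assert (Hs : 0 < sqrt (INR (S M))) by (apply sqrt_lt_R0, lt_0_INR; lia).
  assert (E1 : sqrt (INR (S M)) * sqrt (INR (S M)) = INR M + 1)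
    by (rewrite sqrt_sqrt, S_INR; rewrite ?S_INR; lra).
  pose proof (sqrt_sqrt _ HM) as E0.
  set (a := sqrt (INR M)) in *. set (b := sqrt (INR (S M))) in *.
  assert (/ b <= 2 * (b - a)); [|lra].
  apply Rmult_le_reg_r with b; auto. rewrite Rinv_l by lra.
  nra.
Qed.

Lemma sum_inv_three_halves (M : nat) :
  Rsum (fun i => / (INR (S i) * sqrt (INR (S i)))) M <= 4.
Proof.
  apply Rle_trans with (4 - 4 / sqrt (INR (S M))).
  2:{ assert (0 < 4 / sqrt (INR (S M))); [|lra].
      apply Rdiv_lt_0_compat; [lra|]. apply sqrt_lt_R0, lt_0_INR; lia. }
  induction M as [|M IH]; cbn [Rsum].
  - simpl. rewrite sqrt_1. lra.
  - assert (Hn : 1 <= INR (S M)) by (rewrite S_INR; pose proof (pos_INR M); lra).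
    rewrite (S_INR (S M)). set (n := INR (S M)) in *.
    assert (Ha : 0 < sqrt n) by (apply sqrt_lt_R0; lra).
    assert (Ea : sqrt n * sqrt n = n) by (apply sqrt_sqrt; lra).
    assert (Eb : sqrt (n + 1) * sqrt (n + 1) = n + 1) by (apply sqrt_sqrt; lra).
    assert (Hab : sqrt n <= sqrt (n + 1)) by (apply sqrt_le_1; lra).
    clearbody n. set (a := sqrt n) in *. set (b := sqrt (n + 1)) in *. clearbody a b. subst n.
    assert (/ (a * a * a) <= 4 / a - 4 / b); [|lra].
    replace (4 / a - 4 / b) with ((4 * (b - a)) * / (a * b)) by (field; lra).
    replace (4 * (b - a)) with (4 * / (a + b)).
    2:{ apply Rmult_eq_reg_r with (a + b); [|lra]. field_simplify; [|lra]. nra. }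
    rewrite <- Rdiv_def. unfold Rdiv.
    replace (4 * / (a + b) * / (a * b)) with (/ (a * b * (a + b) / 4)) by (field; lra).
    apply Rinv_le_contravar; [|].
    + apply Rdiv_lt_0_compat; [|lra]. apply Rmult_lt_0_compat; nra.
    + assert (b * (a + b) <= 4 * (a * a)) by nra.
      unfold Rdiv. nra.
Qed.

Section TwistedSaw.

Variables (y : nat -> R) (N : nat) (mu V : R).
Hypothesis Hmu : 0 < mu.
Hypothesis HV : 0 <= V.
Hypothesis Hconcave : forall n, (S n < N)%nat ->
  y (S (S n)) - y (S n) <= y (S n) - y n - mu.
Hypothesis Hvar : forall n m, (n < N)%nat -> (m < N)%nat ->
  (y (S n) - y n) - (y (S m) - y m) <= V.

Let Bnd (m : R) := (m * V + 2) * (23 / (sqrt m * sqrt mu)).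

(** The linear phase [xi * n + al] does not affect second differences, so the
    second difference test gives a bound uniform in [xi] and [al]. *)
Lemma exp_sum_bound (m : nat) (xi al : R) : (0 < m)%nat -> INR m * mu <= 9 ->
  Rabs (Rsum (fun n => cos (2 * PI * INR m * y n + xi * INR n + al)) N) <= Bnd (INR m).
Proof.
  intros Hm Hm9. assert (Hm0 : 1 <= INR m) by (apply (le_INR 1); lia).
  pose proof PI2_3_2 as HP.
  assert (Hmm : 0 < INR m * mu) by nra.
  (* this [t] balances the two terms [t / (m mu)] and [1 / t] of the test *)
  set (t := sqrt (INR m * mu)).
  assert (Ht0 : 0 < t) by (apply sqrt_lt_R0; auto).
  assert (Htt : t * t = INR m * mu) by (apply sqrt_sqrt; lra).
  assert (Ht3 : t <= 3) by nra.
  eapply Rle_trans.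
  - apply (cos_sum_second_difference (INR m * mu) t Hmm ltac:(lra) _ N (INR m * V)).
    + intros n Hn. specialize (Hconcave n Hn). rewrite !S_INR.
      assert (INR m * (y (S (S n)) - y (S n) - (y (S n) - y n)) <= - (INR m * mu)) by nra.
      nra.
    + intros n k Hn Hk. specialize (Hvar n k Hn Hk). rewrite !S_INR.
      assert (INR m * (y (S n) - y n - (y (S k) - y k)) <= INR m * V) by nra. nra.
    + nra.
  - unfold Bnd. apply Rmult_le_compat_l; [nra|].
    rewrite <- sqrt_mult by lra. fold t.
    rewrite <- Htt. replace (t / (t * t)) with (/ t) by (field; lra).
    assert (3 <= 9 * / t).
    { apply Rmult_le_reg_r with t; auto. rewrite Rmult_assoc, Rinv_l; lra. }
    unfold Rdiv. lra.
Qed.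

Lemma Bnd_nonneg m : 0 < m -> 0 <= Bnd m.
Proof.
  intros Hm. unfold Bnd. apply Rmult_le_pos; [nra|].
  apply Rlt_le, Rdiv_lt_0_compat; [lra|]. apply Rmult_lt_0_compat; apply sqrt_lt_R0; auto.
Qed.

Lemma sum_Bnd (M : nat) :
  Rsum (fun i => Bnd (INR (S i)) / INR (S i)) M <= 23 / sqrt mu * (2 * V * sqrt (INR M) + 8).
Proof.
  assert (Hs : 0 < sqrt mu) by (apply sqrt_lt_R0; auto).
  rewrite (Rsum_ext _ (fun i => 23 / sqrt mu * (V * / sqrt (INR (S i))
     + 2 * / (INR (S i) * sqrt (INR (S i)))))).
  - rewrite Rsum_scal, Rsum_plus, !Rsum_scal.
    apply Rmult_le_compat_l; [apply Rlt_le, Rdiv_lt_0_compat; lra|].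
    pose proof (sum_inv_sqrt M); pose proof (sum_inv_three_halves M). nra.
  - intros i _. assert (0 < INR (S i)) by (apply lt_0_INR; lia).
    assert (0 < sqrt (INR (S i))) by (apply sqrt_lt_R0; auto).
    unfold Bnd. set (m := INR (S i)) in *.
    field_simplify; repeat split; try lra.
    all: replace (sqrt m ^ 2) with m by (rewrite <- E at 1; ring).
    all: try (field; repeat split; lra).
Qed.

Lemma twisted_trig_saw (L : nat) (xi al : R) : (0 < L)%nat -> INR (L * L) * mu <= 9 ->
  Rabs (Rsum (fun n => trig_saw (L * L) (y n) * cos (xi * INR n + al)) N)
    <= Rsum (fun i => Bnd (INR (S i)) / INR (S i)) (L * L).
Proof.
  intros HL H9. pose proof PI2_3_2 as HP.
  unfold trig_saw.
  rewrite (Rsum_ext _ (fun n => Rsum (fun i => (1 - INR (S i) / INR (L * L)) / (PI * INR (S i))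
     * (sin (2 * PI * INR (S i) * y n) * cos (xi * INR n + al))) (L * L))).
  2:{ intros n _. rewrite <- Rsum_scal_r. apply Rsum_ext. intros; ring. }
  rewrite Rsum_exchange. apply Rsum_abs_le. intros i Hi.
  rewrite Rsum_scal, Rabs_mult.
  assert (Hi1 : INR (S i) <= INR (L * L)) by (apply le_INR; lia).
  assert (Hm : 0 < INR (S i)) by (apply lt_0_INR; lia).
  assert (HB : Rabs (Rsum (fun n => sin (2 * PI * INR (S i) * y n) * cos (xi * INR n + al)) N)
     <= Bnd (INR (S i))).
  { rewrite (Rsum_ext _ (fun n =>
      / 2 * (cos (2 * PI * INR (S i) * y n + xi * INR n + (al - PI / 2))
      + cos (2 * PI * INR (S i) * y n + (- xi) * INR n + (- al - PI / 2))))).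
    - rewrite Rsum_scal, Rsum_plus.
      pose proof (exp_sum_bound (S i) xi (al - PI / 2) ltac:(lia) ltac:(nra)) as E1.
      pose proof (exp_sum_bound (S i) (- xi) (- al - PI / 2) ltac:(lia) ltac:(nra)) as E2.
      abs_lra.
    - intros n _. set (A := 2 * PI * INR (S i) * y n). set (b := xi * INR n + al).
      replace (A + xi * INR n + (al - PI / 2)) with (- (PI / 2 - (A + b))) by (unfold b; ring).
      replace (A + - xi * INR n + (- al - PI / 2)) with (- (PI / 2 - (A - b))) by (unfold b; ring).
      rewrite !cos_neg, !cos_shift, sin_plus, sin_minus. field. }
  rewrite (Rmult_comm (Bnd _) (/ INR (S i)) : Bnd _ / _ = _).
  apply Rmult_le_compat; auto using Rabs_pos.
  rewrite Rabs_right.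
  - apply Rle_trans with (1 / (1 * INR (S i))); [|right; field; lra].
    apply Rmult_le_compat.
    + assert (INR (S i) / INR (L * L) <= 1) by (apply Rle_div_l; lra). lra.
    + apply Rlt_le, Rinv_0_lt_compat. nra.
    + assert (0 < INR (S i) / INR (L * L)) by (apply Rdiv_lt_0_compat; lra). lra.
    + apply Rinv_le_contravar; nra.
  - apply Rle_ge, Rdiv_le_0_compat; [|nra].
    assert (INR (S i) / INR (L * L) <= 1) by (apply Rle_div_l; lra). lra.
Qed.

Lemma sum_fejer (L : nat) : (0 < L)%nat -> INR (L * L) * mu <= 9 ->
  Rsum (fun n => fejer L (PI * y n) / INR L ^ 2) N
    <= INR N / INR L + 2 * Rsum (fun i => Bnd (INR (S i)) / INR (S i)) L.
Proof.
  intros HL H9. assert (HL0 : 0 < INR L) by (apply lt_0_INR; lia).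
  rewrite (Rsum_ext _ (fun n => / INR L + 2 * Rsum (fun i => (INR L - INR (S i)) / INR L ^ 2
      * cos (2 * PI * INR (S i) * y n + 0 * INR n + 0)) L)).
  2:{ intros n _. unfold fejer. rewrite Rdiv_plus_distr. apply f_equal2; [field; lra|].
      unfold Rdiv. rewrite Rmult_assoc, <- Rsum_scal_r. f_equal. apply Rsum_ext. intros i _.
      replace (2 * PI * INR (S i) * y n + 0 * INR n + 0) with (2 * INR (S i) * (PI * y n)) by ring.
      ring. }
  rewrite Rsum_plus, Rsum_const, Rsum_scal, Rsum_exchange.
  apply Rplus_le_compat; [right; reflexivity|]. apply Rmult_le_compat_l; [lra|].
  apply Rsum_le. intros i Hi. rewrite Rsum_scal.
  assert (Hm : 0 < INR (S i)) by (apply lt_0_INR; lia).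
  assert (Hi1 : INR (S i) <= INR L) by (apply le_INR; lia).
  assert (HLL : INR (S i) * mu <= 9).
  { eapply Rle_trans; [apply Rmult_le_compat_r|exact H9]; [lra|]. apply le_INR; nia. }
  pose proof (exp_sum_bound (S i) 0 0 ltac:(lia) HLL) as E.
  apply Rabs_le_between in E. pose proof (Bnd_nonneg (INR (S i)) Hm).
  assert (0 <= (INR L - INR (S i)) / INR L ^ 2) by (apply Rdiv_le_0_compat; [lra|apply pow_lt; auto]).
  apply Rle_trans with ((INR L - INR (S i)) / INR L ^ 2 * Bnd (INR (S i))); [apply Rmult_le_compat_l; lra|].
  rewrite (Rmult_comm (Bnd _) (/ INR (S i)) : Bnd _ / _ = _). apply Rmult_le_compat_r; [auto|].
  apply Rle_trans with (/ INR L).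
  - apply Rle_div_l; [apply pow_lt; auto|]. replace (/ INR L * INR L ^ 2) with (INR L) by (field; lra). lra.
  - apply Rinv_le_contravar; auto.
Qed.

(** Replace [saw] by its trigonometric approximation of order [L ^ 2].  Each
    harmonic [m] then contributes [Bnd m / m], both in the approximation and, for
    [m < L], in the error term; [2 N / L] is the constant part of the error. *)
Theorem twisted_saw_bound (L : nat) (xi al : R) : (0 < L)%nat -> INR (L * L) * mu <= 9 ->
  Rabs (Rsum (fun n => saw (y n) * cos (xi * INR n + al)) N)
    <= 2 * INR N / INR L + 69 / sqrt mu * (2 * V * INR L + 8).
Proof.
  intros HL H9. assert (HL0 : 0 < INR L) by (apply lt_0_INR; lia).
  rewrite (Rsum_ext _ (fun n => trig_saw (L * L) (y n) * cos (xi * INR n + al)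
     + (saw (y n) - trig_saw (L * L) (y n)) * cos (xi * INR n + al))) by (intros; ring).
  rewrite Rsum_plus. eapply Rle_trans; [apply Rabs_triang|].
  pose proof (twisted_trig_saw L xi al HL H9) as E1.
  assert (E2 : Rabs (Rsum (fun n => (saw (y n) - trig_saw (L * L) (y n)) * cos (xi * INR n + al)) N)
     <= INR N / INR L + Rsum (fun n => fejer L (PI * y n) / INR L ^ 2) N).
  { unfold Rdiv at 1. rewrite <- Rsum_const, <- Rsum_plus. apply Rsum_abs_le. intros n _.
    rewrite Rabs_mult. pose proof (saw_approx L (y n) HL).
    assert (Rabs (cos (xi * INR n + al)) <= 1) by (apply Rabs_le_between, COS_bound).
    set (e := saw (y n) - trig_saw (L * L) (y n)) in *.
    pose proof (Rabs_pos e). nra. }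
  pose proof (sum_fejer L HL H9) as E3.
  assert (E4 : Rsum (fun i => Bnd (INR (S i)) / INR (S i)) L
    <= Rsum (fun i => Bnd (INR (S i)) / INR (S i)) (L * L)).
  { apply Rsum_mono; [nia|]. intros i _. assert (0 < INR (S i)) by (apply lt_0_INR; lia).
    apply Rdiv_le_0_compat; auto. apply Bnd_nonneg; auto. }
  pose proof (sum_Bnd (L * L)) as E5. rewrite mult_INR, sqrt_square in E5 by lra.
  unfold Rdiv in *. lra.
Qed.

End TwistedSaw.

(** * The trilinear form of an additive ternary problem *)

Definition tri (l : nat) (f g h : nat -> R) : R :=
  Rsum (fun i => Rsum (fun j => Rsum (fun k =>
    if Nat.eq_dec (i + j + k) l then f i * g j * h k else 0) (S l)) (S l)) (S l).

Lemma Rsum_ext2 f g n m :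
  (forall i j, (i < n)%nat -> (j < m)%nat -> f i j = g i j) ->
  Rsum (fun i => Rsum (fun j => f i j) m) n = Rsum (fun i => Rsum (fun j => g i j) m) n.
Proof. intros H. apply Rsum_ext; intros; apply Rsum_ext; auto. Qed.

Lemma tri_ext l f g h f' g' h' :
  (forall i, (i <= l)%nat -> f i = f' i) -> (forall i, (i <= l)%nat -> g i = g' i) ->
  (forall i, (i <= l)%nat -> h i = h' i) -> tri l f g h = tri l f' g' h'.
Proof.
  intros Hf Hg Hh. apply Rsum_ext; intros i Hi. apply Rsum_ext2; intros j k Hj Hk.
  rewrite Hf, Hg, Hh by lia. auto.
Qed.

Lemma tri_swap12 l f g h : tri l f g h = tri l g f h.
Proof.
  unfold tri. rewrite Rsum_exchange. apply Rsum_ext; intros i _. apply Rsum_ext2; intros j k _ _.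
  destruct (Nat.eq_dec (j + i + k) l), (Nat.eq_dec (i + j + k) l); try lia; ring.
Qed.

Lemma tri_swap23 l f g h : tri l f g h = tri l f h g.
Proof.
  unfold tri. apply Rsum_ext; intros i _. rewrite Rsum_exchange. apply Rsum_ext2; intros j k _ _.
  destruct (Nat.eq_dec (i + k + j) l), (Nat.eq_dec (i + j + k) l); try lia; ring.
Qed.

Lemma tri_minus_l l f f' g h : tri l (fun i => f i - f' i) g h = tri l f g h - tri l f' g h.
Proof.
  unfold tri. rewrite <- Rsum_minus. apply Rsum_ext; intros i _.
  rewrite <- Rsum_minus. apply Rsum_ext; intros j _.
  rewrite <- Rsum_minus. apply Rsum_ext; intros k _.
  destruct (Nat.eq_dec (i + j + k) l); ring.
Qed.

Lemma tri_telescope l f1 f2 f3 g1 g2 g3 :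
  tri l f1 f2 f3 - tri l g1 g2 g3
  = tri l (fun i => f1 i - g1 i) f2 f3
    + tri l (fun i => f2 i - g2 i) g1 f3
    + tri l (fun i => f3 i - g3 i) g1 g2.
Proof.
  rewrite !tri_minus_l, (tri_swap12 l f2 g1 f3), (tri_swap12 l g2 g1 f3),
    (tri_swap12 l f3 g1 g2), (tri_swap12 l g3 g1 g2),
    (tri_swap23 l g1 f3 g2), (tri_swap23 l g1 g3 g2). ring.
Qed.

Lemma Rsum_mult f g n m :
  Rsum f n * Rsum g m = Rsum (fun i => Rsum (fun j => f i * g j) m) n.
Proof.
  rewrite <- Rsum_scal_r. apply Rsum_ext; intros. rewrite <- Rsum_scal. auto.
Qed.

Lemma Rsum_mult3 f g h n :
  Rsum f n * (Rsum g n * Rsum h n)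
  = Rsum (fun i => Rsum (fun j => Rsum (fun k => f i * (g j * h k)) n) n) n.
Proof.
  rewrite (Rsum_mult g h), Rsum_mult. apply Rsum_ext2; intros i j _ _.
  symmetry; apply Rsum_scal.
Qed.

Lemma cos_orthogonality (Q : nat) (k : Z) : (0 < Q)%nat -> (Z.abs k < Z.of_nat Q)%Z ->
  Rsum (fun q => cos (2 * PI * INR q / INR Q * IZR k)) Q = if Z.eq_dec k 0 then INR Q else 0.
Proof.
  intros HQ Hk. assert (HQ0 : 0 < INR Q) by (apply lt_0_INR; auto).
  destruct (Z.eq_dec k 0) as [->|Hk0].
  - rewrite (Rsum_ext _ (fun _ => 1)); [rewrite Rsum_const; ring|].
    intros i _. rewrite Rmult_0_r. apply cos_0.
  - set (x := PI * IZR k / INR Q).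
    assert (Hx : sin x <> 0).
    { intros E. apply sin_eq_0_0 in E. destruct E as [m Hm].
      assert (E : IZR k = IZR (m * Z.of_nat Q)).
      { rewrite mult_IZR, <- INR_IZR_INZ. unfold x in Hm. pose proof PI_RGT_0.
        apply Rmult_eq_reg_l with (PI / INR Q).
        - replace (PI / INR Q * IZR k) with (PI * IZR k / INR Q) by (field; lra).
          rewrite Hm. field. lra.
        - apply Rgt_not_eq, Rdiv_lt_0_compat; lra. }
      apply eq_IZR in E. rewrite E, Z.abs_mul in Hk.
      assert (m <> 0)%Z by (intros ->; auto). nia. }
    apply Rmult_eq_reg_l with (2 * sin x); [|lra]. rewrite Rmult_0_r, <- Rsum_scal.
    rewrite (Rsum_ext _ (fun q => sin ((2 * INR (S q) - 1) * x) - sin ((2 * INR q - 1) * x))).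
    + rewrite (Rsum_telescope (fun q => sin ((2 * INR q - 1) * x))).
      replace ((2 * INR Q - 1) * x) with (- x + 2 * IZR k * PI) by (unfold x; field; lra).
      replace ((2 * INR 0 - 1) * x) with (- x) by (simpl; ring).
      rewrite sin_add_turns. ring.
    + intros q _. replace ((2 * INR (S q) - 1) * x) with (2 * INR q * x + x) by (rewrite S_INR; ring).
      replace ((2 * INR q - 1) * x) with (2 * INR q * x - x) by ring.
      replace (2 * PI * INR q / INR Q * IZR k) with (2 * INR q * x) by (unfold x; field; lra).
      rewrite sin_plus, sin_minus. ring.
Qed.

Lemma parseval (u : nat -> R) (N Q : nat) (s : R) : (0 < N <= Q)%nat ->
  Rsum (fun q => Rsum (fun j => u j * cos (2 * PI * INR q / INR Q * (INR j - s))) N ^ 2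
               + Rsum (fun j => u j * sin (2 * PI * INR q / INR Q * (INR j - s))) N ^ 2) Q
  = INR Q * Rsum (fun j => u j ^ 2) N.
Proof.
  intros HN.
  rewrite (Rsum_ext _ (fun q => Rsum (fun i => Rsum (fun j => u i * u j *
    cos (2 * PI * INR q / INR Q * IZR (Z.of_nat i - Z.of_nat j))) N) N)).
  - rewrite Rsum_exchange, <- Rsum_scal. apply Rsum_ext; intros i Hi.
    rewrite Rsum_exchange.
    rewrite (Rsum_ext _ (fun j => if Nat.eq_dec j i then INR Q * u j ^ 2 else 0)).
    + rewrite (Rsum_if_eq (fun j => INR Q * u j ^ 2)). destruct (lt_dec i N); [ring|lia].
    + intros j Hj. rewrite Rsum_scal, cos_orthogonality by lia.
      destruct (Z.eq_dec (Z.of_nat i - Z.of_nat j) 0), (Nat.eq_dec j i); subst; try lia; ring.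
  - intros q _. simpl (_ ^ 2). rewrite !Rmult_1_r, !Rsum_mult, <- Rsum_plus.
    apply Rsum_ext; intros i _. rewrite <- Rsum_plus. apply Rsum_ext; intros j _.
    set (th := 2 * PI * INR q / INR Q).
    replace (th * IZR (Z.of_nat i - Z.of_nat j)) with (th * (INR i - s) - th * (INR j - s)).
    + rewrite cos_minus. ring.
    + rewrite minus_IZR, <- !INR_IZR_INZ. ring.
Qed.

(** Orthogonality of additive characters modulo [Q].  The modulus [2 l + 1] is
    large enough for [i + j + k - l], which lies between [- l] and [2 l], to be
    divisible by it only when it is zero. *)
Lemma tri_fourier (l : nat) (f g h : nat -> R) :
  let Q := (2 * l + 1)%nat in
  tri l f g h = / INR Q * Rsum (fun q => let th := 2 * PI * INR q / INR Q in
    Rsum (fun i => Rsum (fun j => Rsum (fun k => f i * g j * h k *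
      cos (th * INR i + (th * INR j + th * (INR k - INR l)))) (S l)) (S l)) (S l)) Q.
Proof.
  intros Q. cbv zeta. assert (HQ : 0 < INR Q) by (apply lt_0_INR; unfold Q; lia).
  rewrite (Rsum_exchange _ Q (S l)). unfold tri. rewrite <- Rsum_scal. apply Rsum_ext; intros i Hi.
  rewrite (Rsum_exchange _ Q (S l)), <- Rsum_scal. apply Rsum_ext; intros j Hj.
  rewrite (Rsum_exchange _ Q (S l)), <- Rsum_scal. apply Rsum_ext; intros k Hk.
  rewrite Rsum_scal.
  rewrite (Rsum_ext _ (fun q => cos (2 * PI * INR q / INR Q *
     IZR (Z.of_nat i + Z.of_nat j + Z.of_nat k - Z.of_nat l)))).
  - rewrite cos_orthogonality by (unfold Q; lia).
    destruct (Z.eq_dec _ 0), (Nat.eq_dec (i + j + k) l); try lia; field; lra.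
  - intros q _. f_equal. rewrite minus_IZR, !plus_IZR, <- !INR_IZR_INZ. ring.
Qed.

Lemma cos_triple_product (f g h : nat -> R) (a b c : nat -> R) (N : nat) :
  Rsum (fun i => Rsum (fun j => Rsum (fun k => f i * g j * h k *
      cos (a i + (b j + c k))) N) N) N
  = Rsum (fun i => f i * cos (a i)) N *
      (Rsum (fun i => g i * cos (b i)) N * Rsum (fun i => h i * cos (c i)) N
       - Rsum (fun i => g i * sin (b i)) N * Rsum (fun i => h i * sin (c i)) N)
    - Rsum (fun i => f i * sin (a i)) N *
      (Rsum (fun i => g i * sin (b i)) N * Rsum (fun i => h i * cos (c i)) N
       + Rsum (fun i => g i * cos (b i)) N * Rsum (fun i => h i * sin (c i)) N).
Proof.
  rewrite !Rmult_minus_distr_l, !Rmult_plus_distr_l, !Rsum_mult3.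
  rewrite <- Rsum_minus, <- Rsum_plus, <- Rsum_minus. apply Rsum_ext; intros i _.
  rewrite <- Rsum_minus, <- Rsum_plus, <- Rsum_minus. apply Rsum_ext; intros j _.
  rewrite <- Rsum_minus, <- Rsum_plus, <- Rsum_minus. apply Rsum_ext; intros k _.
  rewrite cos_plus, sin_plus, cos_plus. ring.
Qed.

(** The circle method on the cyclic group of order [2 l + 1]: the transform of
    [e] is bounded uniformly, and the transforms of [u] and [v] are bounded in mean
    square by [parseval]. *)
Lemma tri_bound_weighted (l : nat) (e u v : nat -> R) (B t : R) :
  0 < t -> 0 <= B ->
  (forall xi al, Rabs (Rsum (fun n => e n * cos (xi * INR n + al)) (S l)) <= B) ->
  Rabs (tri l e u v)
    <= B * (t * Rsum (fun n => u n ^ 2) (S l) + / t * Rsum (fun n => v n ^ 2) (S l)).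
Proof.
  intros Ht HB He. rewrite tri_fourier. set (Q := (2 * l + 1)%nat). cbv zeta.
  assert (HQ : 0 < INR Q) by (apply lt_0_INR; unfold Q; lia).
  rewrite Rabs_mult, (Rabs_right (/ INR Q)) by (apply Rle_ge, Rlt_le, Rinv_0_lt_compat; auto).
  apply Rmult_le_reg_l with (INR Q); auto.
  rewrite <- Rmult_assoc, Rinv_r, Rmult_1_l by lra.
  replace (INR Q * _) with (B * (t * (INR Q * Rsum (fun n => u n ^ 2) (S l))
     + / t * (INR Q * Rsum (fun n => v n ^ 2) (S l)))) by ring.
  rewrite <- (parseval u (S l) Q 0), <- (parseval v (S l) Q (INR l)) by (unfold Q; lia).
  rewrite <- !Rsum_scal, <- Rsum_plus, <- Rsum_scal. apply Rsum_abs_le. intros q _.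
  set (th := 2 * PI * INR q / INR Q).
  rewrite (cos_triple_product e u v (fun i => th * INR i) (fun j => th * INR j)
    (fun k => th * (INR k - INR l))).
  rewrite (Rsum_ext (fun j => u j * cos (th * (INR j - 0))) (fun j => u j * cos (th * INR j)))
    by (intros; rewrite Rminus_0_r; auto).
  rewrite (Rsum_ext (fun j => u j * sin (th * (INR j - 0))) (fun j => u j * sin (th * INR j)))
    by (intros; rewrite Rminus_0_r; auto).
  assert (EP : Rabs (Rsum (fun i => e i * cos (th * INR i)) (S l)) <= B).
  { rewrite (Rsum_ext _ (fun i => e i * cos (th * INR i + 0))) by (intros; rewrite Rplus_0_r; auto).
    apply He. }
  assert (ER : Rabs (Rsum (fun i => e i * sin (th * INR i)) (S l)) <= B).
  { rewrite (Rsum_ext _ (fun i => e i * cos (th * INR i + - (PI / 2)))).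
    - apply He.
    - intros i _. replace (th * INR i + - (PI / 2)) with (- (PI / 2 - th * INR i)) by ring.
      rewrite cos_neg, cos_shift. auto. }
  set (P := Rsum (fun i => e i * cos (th * INR i)) (S l)) in *.
  set (R0 := Rsum (fun i => e i * sin (th * INR i)) (S l)) in *.
  set (Uc := Rsum (fun i => u i * cos (th * INR i)) (S l)).
  set (Us := Rsum (fun i => u i * sin (th * INR i)) (S l)).
  set (Vc := Rsum (fun i => v i * cos (th * (INR i - INR l))) (S l)).
  set (Vs := Rsum (fun i => v i * sin (th * (INR i - INR l))) (S l)).
  clearbody P R0 Uc Us Vc Vs. clear - Ht HB EP ER.
  assert (K : forall a b, Rabs (a * b) <= / 2 * (t * a ^ 2 + / t * b ^ 2)).
  { assert (H : forall a b, a * b <= / 2 * (t * a ^ 2 + / t * b ^ 2)).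
    { intros a b. apply Rmult_le_reg_l with t; auto.
      replace (t * (/ 2 * (t * a ^ 2 + / t * b ^ 2))) with (/ 2 * ((t * a) ^ 2 + b ^ 2)) by (field; lra).
      pose proof (pow2_ge_0 (t * a - b)). nra. }
    intros a b. apply Rabs_le. split; [|apply H].
    pose proof (H (- a) b). replace ((- a) ^ 2) with (a ^ 2) in H0 by ring. lra. }
  assert (KX : Rabs (Uc * Vc - Us * Vs) <= / 2 * (t * (Uc ^ 2 + Us ^ 2) + / t * (Vc ^ 2 + Vs ^ 2))).
  { pose proof (K Uc Vc) as K1. pose proof (K Us Vs) as K2.
    abs_lra. }
  assert (KY : Rabs (Us * Vc + Uc * Vs) <= / 2 * (t * (Uc ^ 2 + Us ^ 2) + / t * (Vc ^ 2 + Vs ^ 2))).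
  { pose proof (K Us Vc) as K1. pose proof (K Uc Vs) as K2.
    abs_lra. }
  eapply Rle_trans; [apply Rabs_triang|]. rewrite Rabs_Ropp, !Rabs_mult.
  set (Z := t * (Uc ^ 2 + Us ^ 2) + / t * (Vc ^ 2 + Vs ^ 2)) in *.
  assert (Rabs P * Rabs (Uc * Vc - Us * Vs) <= B * (/ 2 * Z))
    by (apply Rmult_le_compat; auto using Rabs_pos).
  assert (Rabs R0 * Rabs (Us * Vc + Uc * Vs) <= B * (/ 2 * Z))
    by (apply Rmult_le_compat; auto using Rabs_pos).
  lra.
Qed.

(** The weight [t] in [tri_bound_weighted] that makes both terms equal. *)
Theorem tri_bound (l : nat) (e u v : nat -> R) (B A A' : R) :
  0 <= B -> 0 < A -> 0 < A' ->
  (forall xi al, Rabs (Rsum (fun n => e n * cos (xi * INR n + al)) (S l)) <= B) ->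
  Rsum (fun n => u n ^ 2) (S l) <= A -> Rsum (fun n => v n ^ 2) (S l) <= A' ->
  Rabs (tri l e u v) <= 2 * B * sqrt (A * A').
Proof.
  intros HB HA HA' He Hu Hv.
  assert (Ha : 0 < sqrt A) by (apply sqrt_lt_R0; auto).
  assert (Ha' : 0 < sqrt A') by (apply sqrt_lt_R0; auto).
  assert (Ht : 0 < sqrt A' / sqrt A) by (apply Rdiv_lt_0_compat; auto).
  eapply Rle_trans; [apply (tri_bound_weighted l e u v B _ Ht HB He)|].
  rewrite sqrt_mult by lra.
  replace (2 * B * (sqrt A * sqrt A')) with (B * (2 * (sqrt A * sqrt A'))) by ring.
  apply Rmult_le_compat_l; auto.
  apply Rle_trans with (sqrt A' / sqrt A * A + / (sqrt A' / sqrt A) * A').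
  - apply Rplus_le_compat; apply Rmult_le_compat_l; auto; [lra|].
    apply Rlt_le, Rinv_0_lt_compat; auto.
  - right. rewrite <- (sqrt_sqrt A) at 2 by lra. rewrite <- (sqrt_sqrt A') at 3 by lra.
    field; lra.
Qed.

(** * The Gamma function *)

Lemma RInt_gen_nonneg_exists (f : R -> R) (K : R) :
  (forall t, 0 < t -> 0 <= f t) -> (forall t, 0 < t -> continuous f t) ->
  (forall a b, 0 < a <= 1 -> 1 <= b -> RInt f a b <= K) ->
  exists l, is_RInt_gen f (at_right 0) (Rbar_locally p_infty) l /\
    (forall a b, 0 < a <= 1 -> 1 <= b -> RInt f a b <= l).
Proof.
  intros Hpos Hcont HK.
  assert (Hex : forall a b, 0 < a -> 0 < b -> ex_RInt f a b).
  { intros a b Ha Hb. apply (ex_RInt_continuous (V := R_CompleteNormedModule)). intros z Hz. apply Hcont.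
    destruct Hz as [Hz _]. unfold Rmin in Hz; destruct (Rle_dec a b); lra. }
  assert (Hge : forall a b, 0 < a <= b -> 0 <= RInt f a b).
  { intros a b Hab. apply RInt_ge_0; [lra|apply Hex; lra|]. intros x Hx; apply Hpos; lra. }
  assert (Hmono : forall a' a b b', 0 < a' <= a -> a <= b -> b <= b' -> RInt f a b <= RInt f a' b').
  { intros a' a b b' Ha Hab Hb.
    rewrite <- (RInt_Chasles f a' a b') by (apply Hex; lra).
    rewrite <- (RInt_Chasles f a b b') by (apply Hex; lra).
    pose proof (Hge a' a ltac:(lra)). pose proof (Hge b b' ltac:(lra)).
    unfold plus; simpl. lra. }
  set (E := fun z => exists a b, 0 < a <= 1 /\ 1 <= b /\ z = RInt f a b).
  destruct (completeness E) as [l [Hub Hlub]].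
  - exists K. intros z (a & b & Ha & Hb & ->). auto.
  - exists (RInt f 1 1), 1, 1. lra.
  - exists l. split; [|intros a b Ha Hb; apply Hub; exists a, b; auto].
    intros P [eps HP].
    assert (Hz : exists a0 b0, 0 < a0 <= 1 /\ 1 <= b0 /\ l - eps < RInt f a0 b0).
    { apply Classical_Prop.NNPP. intros Hn.
      assert (l <= l - eps); [|destruct eps; simpl in *; lra].
      apply Hlub. intros z (a & b & Ha & Hb & ->).
      destruct (Rle_dec (RInt f a b) (l - eps)); auto.
      exfalso; apply Hn; exists a, b; repeat split; lra. }
    destruct Hz as (a0 & b0 & Ha0 & Hb0 & Hl).
    apply (Filter_prod _ _ _ (fun a => 0 < a < a0) (fun b => b0 < b)).
    + exists (mkposreal a0 (proj1 Ha0)). intros y Hy Hy0.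
      unfold ball in Hy; simpl in Hy; unfold AbsRing_ball, abs, minus, plus, opp in Hy; simpl in Hy.
      split; auto. rewrite Ropp_0, Rplus_0_r, Rabs_right in Hy; lra.
    + exists b0. auto.
    + intros a b Ha Hb. exists (RInt f a b). split; [apply @RInt_correct, Hex; simpl; lra|].
      apply HP. assert (RInt f a b <= l) by (apply Hub; exists a, b; repeat split; lra).
      assert (RInt f a0 b0 <= RInt f a b) by (apply Hmono; lra).
      unfold ball; simpl; unfold AbsRing_ball, abs, minus, plus, opp; simpl.
      apply Rabs_def1; destruct eps; simpl in *; lra.
Qed.

Lemma is_RInt_gen_seq (f : R -> R) (l : R) :
  is_RInt_gen f (at_right 0) (Rbar_locally p_infty) l ->
  is_lim_seq (fun n => RInt f (/ INR (S n)) (INR (S n))) l.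
Proof.
  intros H. apply is_lim_seq_spec. intros eps.
  specialize (H (ball l eps) (locally_ball l eps)).
  destruct H as [Q S0 HQ HS H].
  destruct HQ as [d Hd]. destruct HS as [M HM].
  destruct (nfloor_ex (/ d)) as [n1 Hn1]; [apply Rlt_le, Rinv_0_lt_compat, cond_pos|].
  destruct (nfloor_ex (Rmax M 0)) as [n2 Hn2]; [apply Rmax_r|].
  exists (Nat.max n1 n2). intros n Hn.
  assert (Hp : 0 < INR (S n)) by (apply lt_0_INR; lia).
  pose proof (S_INR n) as Ep. set (p := INR (S n)) in *. clearbody p.
  assert (HQn : Q (/ p)).
  { apply Hd; [|apply Rinv_0_lt_compat; auto].
    unfold ball; simpl; unfold AbsRing_ball, abs, minus, plus, opp; simpl.
    rewrite Ropp_0, Rplus_0_r, Rabs_right by (apply Rle_ge, Rlt_le, Rinv_0_lt_compat; auto).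
    rewrite <- (Rinv_inv d). apply Rinv_lt_contravar.
    - apply Rmult_lt_0_compat; auto. apply Rinv_0_lt_compat, cond_pos.
    - assert (INR n1 <= INR n) by (apply le_INR; lia). lra. }
  assert (HSn : S0 p).
  { apply HM. assert (INR n2 <= INR n) by (apply le_INR; lia).
    pose proof (Rmax_l M 0). lra. }
  destruct (H _ _ HQn HSn) as (y & Hy & Hb). simpl in Hy.
  rewrite (is_RInt_unique _ _ _ _ Hy). exact Hb.
Qed.

Definition gamma_integrand (s t : R) : R := Rpower t (s - 1) * exp (- t).

Lemma gamma_integrand_pos s t : 0 < gamma_integrand s t.
Proof. apply Rmult_lt_0_compat; apply exp_pos. Qed.

Lemma gamma_integrand_continuous s t : 0 < t -> continuous (gamma_integrand s) t.
Proof.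
  intros Ht. apply (ex_derive_continuous (gamma_integrand s)). unfold gamma_integrand, Rpower.
  auto_derive. auto.
Qed.

Lemma gamma_integrand_ex_RInt s a b : 0 < a -> 0 < b -> ex_RInt (gamma_integrand s) a b.
Proof.
  intros Ha Hb. apply (ex_RInt_continuous (V := R_CompleteNormedModule)). intros z Hz.
  apply gamma_integrand_continuous.
  destruct Hz as [Hz _]. unfold Rmin in Hz; destruct (Rle_dec a b); lra.
Qed.

Lemma is_derive_Rpower s t : 0 < t -> is_derive (fun t => Rpower t s) t (s * Rpower t (s - 1)).
Proof.
  intros Ht. unfold Rpower. auto_derive; auto.
  replace ((s - 1) * ln t) with (s * ln t + - ln t) by ring.
  rewrite exp_plus, exp_Ropp, exp_ln by auto. field. lra.
Qed.

Lemma gamma_by_parts s a b : 0 < a -> 0 < b ->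
  RInt (gamma_integrand (s + 1)) a b
  = Rpower a s * exp (- a) - Rpower b s * exp (- b) + s * RInt (gamma_integrand s) a b.
Proof.
  intros Ha Hb.
  assert (H : is_RInt (fun t => s * gamma_integrand s t - gamma_integrand (s + 1) t) a b
    (Rpower b s * exp (- b) - Rpower a s * exp (- a))).
  { apply (is_RInt_derive (fun t => Rpower t s * exp (- t))).
    - intros x Hx. assert (0 < x) by (unfold Rmin in Hx; destruct (Rle_dec a b); lra).
      evar_last.
      + apply (is_derive_mult (fun t => Rpower t s) (fun t => exp (- t)));
          [apply is_derive_Rpower; auto| |intros; apply Rmult_comm].
        instantiate (1 := - exp (- x)). auto_derive; auto. ring.
      + unfold plus, mult, scal, opp, one; simpl; unfold mult; simpl. unfold gamma_integrand.
        replace (s + 1 - 1) with s by ring. ring.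
    - intros x Hx. assert (0 < x) by (unfold Rmin in Hx; destruct (Rle_dec a b); lra).
      apply (continuous_minus (fun t => s * gamma_integrand s t)).
      + apply (continuous_scal_r s (gamma_integrand s)), gamma_integrand_continuous; auto.
      + apply gamma_integrand_continuous; auto. }
  pose proof (gamma_integrand_ex_RInt s a b Ha Hb) as E1.
  pose proof (gamma_integrand_ex_RInt (s + 1) a b Ha Hb) as E2.
  assert (H2 : RInt (fun t => s * gamma_integrand s t - gamma_integrand (s + 1) t) a b
    = s * RInt (gamma_integrand s) a b - RInt (gamma_integrand (s + 1)) a b).
  { apply is_RInt_unique, (is_RInt_minus (V := R_NormedModule) (fun t => s * gamma_integrand s t)).
    - apply (is_RInt_scal (V := R_NormedModule) (gamma_integrand s)), @RInt_correct, E1.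
    - apply @RInt_correct, E2. }
  rewrite (is_RInt_unique _ _ _ _ H) in H2. lra.
Qed.

Lemma exp_le x y : x <= y -> exp x <= exp y.
Proof. intros [H| ->]; [left; apply exp_increasing; auto|lra]. Qed.

Lemma Rpower_le_1 t s : 0 < t <= 1 -> 0 <= s -> Rpower t s <= 1.
Proof.
  intros Ht Hs. unfold Rpower. rewrite <- exp_0.
  assert (ln t <= 0) by (rewrite <- ln_1; apply ln_le; lra).
  apply exp_le. nra.
Qed.

Lemma gamma_bounded_small s : 0 < s <= 1 ->
  forall a b, 0 < a <= 1 -> 1 <= b -> RInt (gamma_integrand s) a b <= / s + 1.
Proof.
  intros Hs a b Ha Hb.
  rewrite <- (RInt_Chasles _ a 1 b) by (apply gamma_integrand_ex_RInt; lra).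
  assert (H1 : RInt (gamma_integrand s) a 1 <= / s).
  { assert (H : is_RInt (fun t => Rpower t (s - 1)) a 1 (/ s * Rpower 1 s - / s * Rpower a s)).
    { apply (is_RInt_derive (fun t => / s * Rpower t s)).
      - intros x Hx. rewrite Rmin_left in Hx by lra.
        evar_last; [apply (is_derive_scal (fun t => Rpower t s)), is_derive_Rpower; lra|].
        simpl. field. lra.
      - intros x Hx. rewrite Rmin_left in Hx by lra.
        apply (ex_derive_continuous (fun t => Rpower t (s - 1))).
        exists ((s - 1) * Rpower x (s - 1 - 1)). apply is_derive_Rpower; lra. }
    apply Rle_trans with (/ s * Rpower 1 s - / s * Rpower a s).
    - rewrite <- (is_RInt_unique _ _ _ _ H). apply RInt_le; [lra| | |].
      + apply gamma_integrand_ex_RInt; lra.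
      + eexists; exact H.
      + intros x Hx. unfold gamma_integrand. rewrite <- (Rmult_1_r (Rpower x (s - 1))) at 2.
        apply Rmult_le_compat_l; [left; apply exp_pos|]. rewrite <- exp_0. apply exp_le. lra.
    - assert (0 < / s) by (apply Rinv_0_lt_compat; lra).
      assert (0 < Rpower a s) by apply exp_pos.
      assert (Rpower 1 s <= 1) by (apply Rpower_le_1; lra). nra. }
  assert (H2 : RInt (gamma_integrand s) 1 b <= 1).
  { assert (H : is_RInt (fun t => exp (- t)) 1 b (- exp (- b) - - exp (- 1))).
    { apply (is_RInt_derive (fun t => - exp (- t))).
      - intros x Hx. auto_derive; auto. ring.
      - intros x Hx. apply (ex_derive_continuous (fun t => exp (- t))). auto_derive; auto. }
    apply Rle_trans with (- exp (- b) - - exp (- 1)).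
    - rewrite <- (is_RInt_unique _ _ _ _ H). apply RInt_le; [lra| | |].
      + apply gamma_integrand_ex_RInt; lra.
      + eexists; exact H.
      + intros x Hx. unfold gamma_integrand. rewrite <- (Rmult_1_l (exp (- x))) at 2.
        apply Rmult_le_compat_r; [left; apply exp_pos|]. unfold Rpower.
        apply Rle_trans with (exp 0); [apply exp_le|rewrite exp_0; lra].
        assert (0 <= ln x) by (rewrite <- ln_1; apply ln_le; lra). nra.
    - pose proof (exp_pos (- b)). assert (exp (- 1) <= exp 0) by (apply exp_le; lra).
      rewrite exp_0 in *. lra. }
  unfold plus; simpl. lra.
Qed.

(** For [s <= 1] the integrand is at most [t ^ (s - 1)] before [1] and at most
    [exp (- t)] after it; larger [s] are reached by integrating by parts. *)
Lemma gamma_bounded s : 0 < s -> exists K,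
  forall a b, 0 < a <= 1 -> 1 <= b -> RInt (gamma_integrand s) a b <= K.
Proof.
  intros Hs. destruct (nfloor_ex s) as [n Hn]; [lra|].
  assert (Hsn : s <= INR (S n)) by (rewrite S_INR; lra). clear Hn. revert s Hs Hsn.
  induction n as [|n IH]; intros s Hs Hsn.
  - exists (/ s + 1). apply gamma_bounded_small. simpl in Hsn; lra.
  - destruct (Rle_dec s 1) as [H1|H1].
    + exists (/ s + 1). apply gamma_bounded_small. lra.
    + rewrite S_INR in Hsn. destruct (IH (s - 1)) as [K HK]; [lra|lra|].
      exists (1 + (s - 1) * K). intros a b Ha Hb.
      replace s with (s - 1 + 1) at 1 by ring. rewrite gamma_by_parts by lra.
      specialize (HK a b Ha Hb).
      assert (Rpower a (s - 1) * exp (- a) <= 1).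
      { rewrite <- (Rmult_1_l 1). apply Rmult_le_compat; try (left; apply exp_pos).
        - apply Rpower_le_1; lra.
        - rewrite <- exp_0. apply exp_le; lra. }
      assert (0 < Rpower b (s - 1) * exp (- b)) by (apply Rmult_lt_0_compat; apply exp_pos).
      assert ((s - 1) * RInt (gamma_integrand (s - 1)) a b <= (s - 1) * K)
        by (apply Rmult_le_compat_l; lra). lra.
Qed.

Lemma Gamma_correct s : 0 < s ->
  is_lim_seq (fun n => RInt (gamma_integrand s) (/ INR (S n)) (INR (S n))) (Gamma s) /\
  0 < Gamma s.
Proof.
  intros Hs. destruct (gamma_bounded s Hs) as [K HK].
  destruct (RInt_gen_nonneg_exists (gamma_integrand s) K) as (l & Hl & Hle); auto.
  - intros t _. left; apply gamma_integrand_pos.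
  - intros t Ht. apply gamma_integrand_continuous; auto.
  - assert (E : Gamma s = l).
    { unfold Gamma. exact (is_RInt_gen_unique _ _ Hl). }
    rewrite E. split; [apply is_RInt_gen_seq; auto|].
    eapply Rlt_le_trans; [|apply (Hle 1 2); lra].
    apply RInt_gt_0; [lra| |].
    + intros; apply gamma_integrand_pos.
    + intros x Hx. apply gamma_integrand_continuous; lra.
Qed.

Lemma Rpower_exp_lim s : 0 < s -> is_lim_seq (fun n => Rpower (INR (S n)) s * exp (- INR (S n))) 0.
Proof.
  intros Hs.
  apply (is_lim_seq_ext (fun n => exp (INR (S n) * (s * (ln (INR (S n)) / INR (S n)) - 1)))).
  { intros n. assert (0 < INR (S n)) by (apply lt_0_INR; lia).
    unfold Rpower. rewrite <- exp_plus. f_equal. field. lra. }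
  assert (HI : is_lim_seq (fun n => INR (S n)) p_infty)
    by apply (is_lim_seq_incr_1 INR), is_lim_seq_INR.
  apply (is_lim_comp_seq exp _ m_infty 0); [apply is_lim_exp_m|exists O; discriminate|].
  apply (is_lim_seq_mult _ _ p_infty (s * 0 - 1)); auto.
  - apply (is_lim_seq_minus' _ _ (s * 0) 1); [|apply is_lim_seq_const].
    apply (is_lim_seq_mult' _ _ s 0); [apply is_lim_seq_const|].
    apply (is_lim_comp_seq (fun x => ln x / x) _ p_infty 0); [apply is_lim_div_ln_p| |auto].
    exists O; discriminate.
  - replace (s * 0 - 1) with (-1) by ring. unfold is_Rbar_mult, Rbar_mult'.
    destruct (Rle_dec 0 (-1)); [exfalso; lra|reflexivity].
Qed.

Lemma Rpower_exp_lim_0 s : 0 < s ->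
  is_lim_seq (fun n => Rpower (/ INR (S n)) s * exp (- / INR (S n))) 0.
Proof.
  intros Hs.
  assert (HI : is_lim_seq (fun n => INR (S n)) p_infty)
    by apply (is_lim_seq_incr_1 INR), is_lim_seq_INR.
  apply (is_lim_seq_le_le (fun _ => 0) _ (fun n => exp (- s * ln (INR (S n))))).
  - intros n. assert (0 < INR (S n)) by (apply lt_0_INR; lia).
    split; [left; apply Rmult_lt_0_compat; apply exp_pos|].
    unfold Rpower. rewrite <- exp_plus. apply exp_le. rewrite ln_Rinv by auto.
    assert (0 < / INR (S n)) by (apply Rinv_0_lt_compat; auto). lra.
  - apply is_lim_seq_const.
  - apply (is_lim_comp_seq exp _ m_infty 0); [apply is_lim_exp_m|exists O; discriminate|].
    apply (is_lim_seq_mult _ _ (- s) p_infty).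
    + apply is_lim_seq_const.
    + apply (is_lim_comp_seq ln _ p_infty p_infty); [apply is_lim_ln_p|exists O; discriminate|auto].
    + unfold is_Rbar_mult, Rbar_mult'. destruct (Rle_dec 0 (- s)) as [H|H]; [exfalso; lra|reflexivity].
Qed.

Lemma is_lim_seq_eq (u : nat -> R) (l l' : R) : is_lim_seq u l -> is_lim_seq u l' -> l = l'.
Proof.
  intros H H'. apply is_lim_seq_unique in H. apply is_lim_seq_unique in H'.
  rewrite H in H'. injection H'; auto.
Qed.

Lemma inv_INR_S_pos n : 0 < / INR (S n).
Proof. apply Rinv_0_lt_compat, lt_0_INR; lia. Qed.

Lemma Gamma_succ s : 0 < s -> Gamma (s + 1) = s * Gamma s.
Proof.
  intros Hs. destruct (Gamma_correct s Hs) as [H _].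
  destruct (Gamma_correct (s + 1) ltac:(lra)) as [H1 _].
  apply (is_lim_seq_eq _ _ _ H1).
  replace (s * Gamma s) with (0 - 0 + s * Gamma s) by ring.
  eapply is_lim_seq_ext.
  { intros n. symmetry. apply gamma_by_parts; [apply inv_INR_S_pos|apply lt_0_INR; lia]. }
  apply is_lim_seq_plus'; [apply is_lim_seq_minus'|].
  - apply Rpower_exp_lim_0; auto.
  - apply Rpower_exp_lim; auto.
  - apply is_lim_seq_mult'; [apply is_lim_seq_const|auto].
Qed.

Lemma Gamma_1 : Gamma 1 = 1.
Proof.
  destruct (Gamma_correct 1 ltac:(lra)) as [H _].
  assert (HI : is_lim_seq (fun n => INR (S n)) p_infty)
    by apply (is_lim_seq_incr_1 INR), is_lim_seq_INR.
  apply (is_lim_seq_eq _ _ _ H).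
  apply (is_lim_seq_ext (fun n => exp (- / INR (S n)) - exp (- INR (S n)))).
  - intros n. symmetry. apply is_RInt_unique.
    apply (is_RInt_ext (fun t => exp (- t))).
    { intros t Ht. unfold gamma_integrand, Rpower. replace ((1 - 1) * ln t) with 0 by ring.
      rewrite exp_0. symmetry; apply Rmult_1_l. }
    replace (exp (- / INR (S n)) - exp (- INR (S n)))
      with (- exp (- INR (S n)) - - exp (- / INR (S n))) by ring.
    apply (is_RInt_derive (fun t => - exp (- t))).
    + intros x Hx. auto_derive; auto. ring.
    + intros x Hx. apply (ex_derive_continuous (fun t => exp (- t))). auto_derive; auto.
  - assert (E : exp (- 0) - 0 = 1) by (rewrite Ropp_0, exp_0; ring). rewrite <- E.
    apply is_lim_seq_minus'.
    + apply (is_lim_seq_continuous (fun x => exp (- x)) (fun n => / INR (S n)) 0).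
      * apply continuity_pt_filterlim, (ex_derive_continuous (fun x => exp (- x))). auto_derive; auto.
      * apply (is_lim_seq_inv _ p_infty) in HI; [exact HI|discriminate].
    + apply (is_lim_comp_seq exp _ m_infty 0); [apply is_lim_exp_m|exists O; discriminate|].
      apply (is_lim_seq_opp _ p_infty); auto.
Qed.

Lemma Gamma_pos s : 0 < s -> 0 < Gamma s.
Proof. intros Hs. apply Gamma_correct; auto. Qed.

(** The graph of [exp] lies above its tangent at [q ln r]; average this at the
    points [ln r] and [0]. *)
Lemma bernoulli_Rpower r q : 0 < r -> 0 <= q <= 1 -> Rpower r q <= q * r + (1 - q).
Proof.
  intros Hr Hq. rewrite <- (exp_ln r Hr) at 2. unfold Rpower. set (x := ln r).
  pose proof (exp_ineq1_le ((1 - q) * x)) as H1. pose proof (exp_ineq1_le (- (q * x))) as H2.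
  assert (E : exp (q * x) * exp (- (q * x)) = 1) by (rewrite <- exp_plus, Rplus_opp_r; apply exp_0).
  replace (exp x) with (exp (q * x) * exp ((1 - q) * x)) by (rewrite <- exp_plus; f_equal; ring).
  pose proof (exp_pos (q * x)) as HE. set (e := exp (q * x)) in *.
  apply Rle_trans with (q * (e * (1 + (1 - q) * x)) + (1 - q) * (e * (1 + - (q * x)))); [right; ring|].
  apply Rplus_le_compat; [|rewrite <- (Rmult_1_r (1 - q)) at 2];
    apply Rmult_le_compat_l; try lra.
  - apply Rmult_le_compat_l; lra.
  - rewrite <- E. apply Rmult_le_compat_l; lra.
Qed.

(** Integrate [t ^ q <= q m ^ (q - 1) t + (1 - q) m ^ q], which is
    [bernoulli_Rpower] for [t / m], against [t ^ (m - 1) exp (- t)]. *)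
Lemma Gamma_log_convex m q : 0 < m -> 0 <= q <= 1 -> Gamma (m + q) <= Rpower m q * Gamma m.
Proof.
  intros Hm Hq.
  destruct (Gamma_correct m Hm) as [H0 _].
  destruct (Gamma_correct (m + 1) ltac:(lra)) as [H1 _].
  destruct (Gamma_correct (m + q) ltac:(lra)) as [Hs _].
  apply Rle_trans with (q * (Rpower m q / m) * Gamma (m + 1) + (1 - q) * Rpower m q * Gamma m).
  2:{ rewrite Gamma_succ by auto. right. field. lra. }
  assert (HL : is_lim_seq (fun n =>
     q * (Rpower m q / m) * RInt (gamma_integrand (m + 1)) (/ INR (S n)) (INR (S n))
     + (1 - q) * Rpower m q * RInt (gamma_integrand m) (/ INR (S n)) (INR (S n)))
     (q * (Rpower m q / m) * Gamma (m + 1) + (1 - q) * Rpower m q * Gamma m)).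
  { apply is_lim_seq_plus'; apply is_lim_seq_mult'; auto; apply is_lim_seq_const. }
  refine (is_lim_seq_le _ _ _ _ _ Hs HL). intros n.
  pose proof (inv_INR_S_pos n) as Ha. assert (Hb : 0 < INR (S n)) by (apply lt_0_INR; lia).
  assert (Hab : / INR (S n) <= INR (S n)).
  { assert (1 <= INR (S n)) by (apply (le_INR 1); lia).
    apply Rle_trans with 1; auto. rewrite <- Rinv_1. apply Rinv_le_contravar; lra. }
  set (k1 := q * (Rpower m q / m)). set (k0 := (1 - q) * Rpower m q).
  assert (HI : is_RInt (fun t => k1 * gamma_integrand (m + 1) t + k0 * gamma_integrand m t)
    (/ INR (S n)) (INR (S n))
    (k1 * RInt (gamma_integrand (m + 1)) (/ INR (S n)) (INR (S n))
     + k0 * RInt (gamma_integrand m) (/ INR (S n)) (INR (S n)))).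
  { apply (is_RInt_plus (V := R_NormedModule) (fun t => k1 * gamma_integrand (m + 1) t)).
    - apply (is_RInt_scal (V := R_NormedModule) (gamma_integrand (m + 1))), @RInt_correct,
        gamma_integrand_ex_RInt; auto.
    - apply (is_RInt_scal (V := R_NormedModule) (gamma_integrand m)), @RInt_correct,
        gamma_integrand_ex_RInt; auto. }
  rewrite <- (is_RInt_unique _ _ _ _ HI).
  apply RInt_le; auto; [apply gamma_integrand_ex_RInt; auto|eexists; exact HI|].
  intros t Ht. assert (Ht0 : 0 < t) by lra.
  unfold gamma_integrand, k1, k0.
  assert (E1 : Rpower t (m + 1 - 1) = t * Rpower t (m - 1)).
  { replace (m + 1 - 1) with (1 + (m - 1)) by ring. rewrite Rpower_plus, Rpower_1; auto. }
  assert (Eq : Rpower t (m + q - 1) = Rpower (t / m) q * Rpower m q * Rpower t (m - 1)).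
  { replace (m + q - 1) with (q + (m - 1)) by ring. rewrite Rpower_plus. f_equal.
    rewrite Rpower_mult_distr by (auto; apply Rdiv_lt_0_compat; auto).
    f_equal. field. lra. }
  rewrite E1, Eq.
  pose proof (bernoulli_Rpower (t / m) q ltac:(apply Rdiv_lt_0_compat; auto) Hq) as HB.
  replace (q * (Rpower m q / m) * (t * Rpower t (m - 1) * exp (- t)) +
     (1 - q) * Rpower m q * (Rpower t (m - 1) * exp (- t)))
    with ((q * (t / m) + (1 - q)) * Rpower m q * Rpower t (m - 1) * exp (- t)) by (field; lra).
  repeat (apply Rmult_le_compat_r; [left; apply exp_pos|]). exact HB.
Qed.

(** * Coefficients of the negative binomial series *)

(** The coefficient of [x ^ n] in [(1 - x) ^ (- s)].  These sequences are closed
    under convolution, with addition of the exponents [s], which makes them exact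
    discrete substitutes for the powers [n ^ (s - 1) / Gamma s]. *)
Fixpoint negbin (s : R) (n : nat) : R :=
  match n with O => 1 | S n => negbin s n * ((s + INR n) / INR (S n)) end.

Lemma negbin_pos s n : 0 < s -> 0 < negbin s n.
Proof.
  intros Hs. induction n as [|n IH]; cbn [negbin]; [lra|].
  apply Rmult_lt_0_compat; auto. apply Rdiv_lt_0_compat; [|apply lt_0_INR; lia].
  pose proof (pos_INR n); lra.
Qed.

Lemma negbin_recurrence s n : INR (S n) * negbin s (S n) = (s + INR n) * negbin s n.
Proof.
  cbn [negbin]. assert (0 < INR (S n)) by (apply lt_0_INR; lia). field. lra.
Qed.

Definition conv (f g : nat -> R) (n : nat) : R := Rsum (fun i => f i * g (n - i)%nat) (S n).

(** Both sides satisfy [(n + 1) c (n + 1) = (s + t + n) c n].  For the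
    convolution, split the factor [n + 1] as [i + (n + 1 - i)] and use the recurrence
    of each factor. *)
Lemma conv_negbin s t n : conv (negbin s) (negbin t) n = negbin (s + t) n.
Proof.
  induction n as [|n IH]; [unfold conv; simpl; ring|].
  assert (Hn : 0 < INR (S n)) by (apply lt_0_INR; lia).
  apply Rmult_eq_reg_l with (INR (S n)); [|lra].
  rewrite negbin_recurrence, <- IH. unfold conv.
  rewrite <- !Rsum_scal.
  rewrite (Rsum_ext (fun i => INR (S n) * (negbin s i * negbin t (S n - i)))
    (fun i => INR i * negbin s i * negbin t (S n - i)
       + negbin s i * (INR (S n - i) * negbin t (S n - i)))).
  2:{ intros i Hi. rewrite (minus_INR (S n) i) by lia. ring. }
  rewrite Rsum_plus.
  rewrite (Rsum_shift (fun i => INR i * negbin s i * negbin t (S n - i))).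
  change (Rsum ?f (S (S n))) with (Rsum f (S n) + f (S n)). cbv beta.
  rewrite Nat.sub_diag. change (INR 0) with 0. rewrite !Rmult_0_l, Rmult_0_r, Rplus_0_l, Rplus_0_r.
  rewrite <- Rsum_plus. apply Rsum_ext. intros i Hi.
  rewrite negbin_recurrence. replace (S n - i)%nat with (S (n - i)) by lia.
  rewrite negbin_recurrence, (minus_INR n i) by lia.
  replace (S n - S i)%nat with (n - i)%nat by lia. ring.
Qed.

Lemma Rsum_unique_index (f : nat -> R) (N m : nat) (P : nat -> Prop)
  (dec : forall k, {P k} + {~ P k}) :
  (m < N)%nat -> (forall k, P k <-> k = m) ->
  Rsum (fun k => if dec k then f k else 0) N = f m.
Proof.
  intros Hm HP. rewrite (Rsum_ext _ (fun k => if Nat.eq_dec k m then f k else 0)).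
  - rewrite Rsum_if_eq. destruct (lt_dec m N); [auto|lia].
  - intros k _. destruct (dec k) as [H|H], (Nat.eq_dec k m) as [E|E]; auto.
    + exfalso; apply E, HP, H.
    + exfalso; apply H, HP, E.
Qed.

Lemma tri_conv l f g h : tri l f g h = conv f (conv g h) l.
Proof.
  unfold tri, conv. apply Rsum_ext. intros i Hi.
  rewrite (Rsum_split_le _ (S l) (S (l - i))) by lia.
  match goal with |- ?x + ?y = _ => assert (Hy : y = 0) end.
  { apply Rsum_zero. intros j Hj. apply Rsum_zero. intros k Hk.
    destruct (Nat.eq_dec _ l); [lia|auto]. }
  rewrite Hy, Rplus_0_r, <- Rsum_scal. apply Rsum_ext. intros j Hj.
  rewrite (Rsum_unique_index (fun k => f i * g j * h k) (S l) (l - i - j)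
     (fun k => (i + j + k)%nat = l)); [ring|lia|intros; lia].
Qed.

Lemma tri_negbin l s t u : tri l (negbin s) (negbin t) (negbin u) = negbin (s + t + u) l.
Proof.
  rewrite tri_conv, Rplus_assoc, <- conv_negbin. unfold conv at 1 3.
  apply Rsum_ext. intros i _. rewrite conv_negbin. auto.
Qed.

Lemma Gamma_add_nat s n : 0 < s -> Gamma (s + INR n) = negbin s n * INR (fact n) * Gamma s.
Proof.
  intros Hs. induction n as [|n IH].
  - simpl. rewrite Rplus_0_r. ring.
  - rewrite S_INR, <- Rplus_assoc, Gamma_succ by (pose proof (pos_INR n); lra).
    rewrite IH. rewrite fact_simpl, mult_INR.
    replace (negbin s (S n) * (INR (S n) * INR (fact n)) * Gamma s)
      with (INR (S n) * negbin s (S n) * INR (fact n) * Gamma s) by ring.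
    rewrite negbin_recurrence. ring.
Qed.

Lemma negbin_1 n : negbin 1 n = 1.
Proof.
  induction n as [|n IH]; [reflexivity|]. cbn [negbin]. rewrite IH.
  assert (0 < INR (S n)) by (apply lt_0_INR; lia). rewrite S_INR in *. field. lra.
Qed.

Lemma Gamma_nat_succ n : Gamma (INR n + 1) = INR (fact n).
Proof. rewrite Rplus_comm, Gamma_add_nat, negbin_1, Gamma_1 by lra. ring. Qed.

(** [negbin s n * Gamma s = Gamma (n + s) / n!], and [Gamma (n + s)] is compared
    with [Gamma n] by log-convexity. *)
Lemma negbin_upper s n : 0 < s <= 1 -> (0 < n)%nat ->
  negbin s n * Gamma s <= Rpower (INR n) (s - 1).
Proof.
  intros Hs Hn. assert (Hn0 : 0 < INR n) by (apply lt_0_INR; auto).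
  pose proof (Gamma_log_convex (INR n) s Hn0 ltac:(lra)) as H.
  rewrite Rplus_comm, Gamma_add_nat in H by lra.
  assert (E : Gamma (INR n) = INR (fact n) / INR n).
  { rewrite <- Gamma_nat_succ, Gamma_succ by auto. field. lra. }
  rewrite E in H. pose proof (lt_0_INR _ (lt_O_fact n)) as Hf.
  replace (Rpower (INR n) (s - 1)) with (Rpower (INR n) s / INR n).
  2:{ unfold Rminus. rewrite Rpower_plus, Rpower_Ropp, Rpower_1; auto. }
  apply Rmult_le_reg_r with (INR (fact n)); auto.
  unfold Rdiv in *. lra.
Qed.

(** Log-convexity again, now between [Gamma (n + s)] and [Gamma (n + 1)]. *)
Lemma negbin_lower s n : 0 < s <= 1 -> (0 < n)%nat ->
  INR n / (INR n + s) * Rpower (INR n) (s - 1) <= negbin s n * Gamma s.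
Proof.
  intros Hs Hn. assert (Hn0 : 0 < INR n) by (apply lt_0_INR; auto).
  pose proof (Gamma_log_convex (s + INR n) (1 - s) ltac:(lra) ltac:(lra)) as H.
  replace (s + INR n + (1 - s)) with (INR n + 1) in H by ring.
  rewrite Gamma_nat_succ, Gamma_add_nat in H by lra.
  pose proof (lt_0_INR _ (lt_O_fact n)) as Hf.
  set (g := negbin s n * Gamma s) in *.
  assert (Hg : 1 <= Rpower (s + INR n) (1 - s) * g).
  { apply Rmult_le_reg_r with (INR (fact n)); auto. unfold g. lra. }
  assert (E : Rpower (s + INR n) (1 - s) * (INR n / (INR n + s) * Rpower (INR n) (s - 1)) <= 1).
  { replace (Rpower (INR n) (s - 1)) with (/ Rpower (INR n) (1 - s)).
    2:{ rewrite <- Rpower_Ropp. f_equal; ring. }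
    assert (Hp : 0 < Rpower (INR n) (1 - s)) by apply exp_pos.
    assert (Er : Rpower (s + INR n) (1 - s)
      = Rpower ((INR n + s) / INR n) (1 - s) * Rpower (INR n) (1 - s)).
    { rewrite Rpower_mult_distr; [f_equal; field; lra| |auto]. apply Rdiv_lt_0_compat; lra. }
    rewrite Er.
    assert (Hr : Rpower ((INR n + s) / INR n) (1 - s) <= (INR n + s) / INR n).
    { eapply Rle_trans; [apply bernoulli_Rpower; [apply Rdiv_lt_0_compat|]; lra|].
      assert (1 <= (INR n + s) / INR n) by (apply Rle_div_r; lra). nra. }
    replace (_ * _) with (Rpower ((INR n + s) / INR n) (1 - s) * (INR n / (INR n + s))) by (field; lra).
    apply Rle_trans with ((INR n + s) / INR n * (INR n / (INR n + s))); [|right; field; lra].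
    apply Rmult_le_compat_r; auto. apply Rdiv_le_0_compat; lra. }
  apply Rmult_le_reg_l with (Rpower (s + INR n) (1 - s)); [apply exp_pos|]. lra.
Qed.

Lemma negbin_shift s n : 0 < s -> s * negbin (s + 1) n = (s + INR n) * negbin s n.
Proof.
  intros Hs. pose proof (lt_0_INR _ (lt_O_fact n)) as Hf. pose proof (Gamma_pos s Hs).
  apply Rmult_eq_reg_r with (INR (fact n) * Gamma s); [|nra].
  replace (s * negbin (s + 1) n * (INR (fact n) * Gamma s))
    with (negbin (s + 1) n * INR (fact n) * (s * Gamma s)) by ring.
  rewrite <- Gamma_succ, <- Gamma_add_nat by lra.
  replace (s + 1 + INR n) with (s + INR n + 1) by ring.
  rewrite Gamma_succ, Gamma_add_nat by (pose proof (pos_INR n); lra). ring.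
Qed.

Lemma is_lim_seq_shifted_ratio s : is_lim_seq (fun n => (INR (S n) + s) / INR (S n)) 1.
Proof.
  assert (HI : is_lim_seq (fun n => INR (S n)) p_infty)
    by apply (is_lim_seq_incr_1 INR), is_lim_seq_INR.
  apply (is_lim_seq_ext (fun n => 1 + s * / INR (S n))).
  - intros n. assert (0 < INR (S n)) by (apply lt_0_INR; lia). field. lra.
  - replace (Finite 1) with (Finite (1 + s * 0)) by (f_equal; ring). apply is_lim_seq_plus'; [apply is_lim_seq_const|].
    apply is_lim_seq_mult'; [apply is_lim_seq_const|].
    apply (is_lim_seq_inv _ p_infty) in HI; [exact HI|discriminate].
Qed.

(** The two bounds above squeeze the ratio for [s <= 1]; the recurrence of [Gamma]
    moves the statement from [s] to [s + 1]. *)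
Theorem negbin_asymptotic s : 0 < s ->
  is_lim_seq (fun n => negbin s (S n) * Gamma s / Rpower (INR (S n)) (s - 1)) 1.
Proof.
  intros Hs. destruct (nfloor_ex s) as [k Hk]; [lra|].
  assert (Hsk : s <= INR (S k)) by (rewrite S_INR; lra). clear Hk. revert s Hs Hsk.
  assert (Hbase : forall s, 0 < s <= 1 ->
    is_lim_seq (fun n => negbin s (S n) * Gamma s / Rpower (INR (S n)) (s - 1)) 1).
  { intros s Hs.
    apply (is_lim_seq_le_le (fun n => / ((INR (S n) + s) / INR (S n))) _ (fun _ => 1)).
    - intros n. assert (0 < INR (S n)) by (apply lt_0_INR; lia).
      assert (Hp : 0 < Rpower (INR (S n)) (s - 1)) by apply exp_pos. split.
      + apply Rle_div_r; auto. eapply Rle_trans; [|apply negbin_lower; auto; lia].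
        right. field. lra.
      + apply Rle_div_l; auto. rewrite Rmult_1_l. apply negbin_upper; auto; lia.
    - replace (Finite 1) with (Rbar_inv 1) by (simpl; f_equal; field).
      apply is_lim_seq_inv; [apply is_lim_seq_shifted_ratio|]. intros E; injection E; lra.
    - apply is_lim_seq_const. }
  induction k as [|k IH]; intros s Hs Hsk.
  - apply Hbase. simpl in Hsk. lra.
  - destruct (Rle_dec s 1) as [H1|H1]; [apply Hbase; lra|].
    rewrite S_INR in Hsk. specialize (IH (s - 1) ltac:(lra) ltac:(lra)).
    replace (Finite 1) with (Finite (1 * 1)) by (f_equal; ring).
    eapply is_lim_seq_ext; [|apply is_lim_seq_mult'; [exact IH|apply (is_lim_seq_shifted_ratio (s - 1))]].
    intros n. assert (Hn : 0 < INR (S n)) by (apply lt_0_INR; lia).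
    pose proof (negbin_shift (s - 1) (S n) ltac:(lra)) as E.
    pose proof (Gamma_succ (s - 1) ltac:(lra)) as EG.
    replace (s - 1 + 1) with s in * by ring. cbv beta. rewrite EG.
    replace (Rpower (INR (S n)) (s - 1)) with (Rpower (INR (S n)) (s - 1 - 1) * INR (S n)).
    2:{ rewrite <- (Rpower_1 (INR (S n))) at 2 by auto. rewrite <- Rpower_plus. f_equal; ring. }
    assert (Hp : 0 < Rpower (INR (S n)) (s - 1 - 1)) by apply exp_pos.
    replace (negbin s (S n) * ((s - 1) * Gamma (s - 1)))
      with (((s - 1) * negbin s (S n)) * Gamma (s - 1)) by ring.
    rewrite E. field. lra.
Qed.

(** * Functions of the class F_c and their inverses *)

Lemma locally_gt (x0 x : R) : x0 < x -> locally x (fun y => x0 < y).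
Proof. apply open_gt. Qed.

Lemma is_derive_on_interior (x0 x : R) (f f' : R -> R) :
  is_derive_on (fun x => x0 <= x) f f' -> x0 < x -> is_derive f x (f' x).
Proof.
  intros H Hx. destruct (H x ltac:(lra)) as [Hl Hd].
  assert (Hin : locally x (fun y => x0 <= y)).
  { eapply filter_imp; [|apply (locally_gt x0 x Hx)]. simpl; intros; lra. }
  split; auto. intros z Hz. specialize (Hd z).
  assert (Hzw : is_filter_lim (within (fun x => x0 <= x) (locally x)) z).
  { intros P HP. specialize (Hz P HP). unfold within. eapply filter_imp; [|exact Hz]. auto. }
  intros eps. specialize (Hd Hzw eps). unfold within in Hd.
  generalize (filter_and _ _ Hd Hin). apply filter_imp. intros y [A B]; auto.
Qed.

Lemma continuous_Rmax (x0 x : R) : continuous (fun t => Rmax t x0) x.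
Proof.
  intros P [d HP]. exists d. intros y Hy. apply HP.
  unfold ball in *; simpl in *; unfold AbsRing_ball, abs, minus, plus, opp in *; simpl in *.
  eapply Rle_lt_trans; [|exact Hy].
  unfold Rmax; destruct (Rle_dec y x0), (Rle_dec x x0);
    unfold Rabs; repeat destruct Rcase_abs; lra.
Qed.

(** Continuing [f] by a constant to the left of [x0] turns one-sided
    continuity at [x0] into continuity, so that the integral of [theta t / t] from
    [x0] is an integral of a continuous function. *)
Lemma is_derive_on_continuous_extension (x0 : R) (f f' : R -> R) :
  is_derive_on (fun x => x0 <= x) f f' ->
  forall x, continuous (fun t => f (Rmax t x0)) x.
Proof.
  intros H x P HP.
  assert (Hm : x0 <= Rmax x x0) by apply Rmax_r.
  pose proof (H _ Hm) as Hd.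
  assert (Hc : filterlim f (within (fun x => x0 <= x) (locally (Rmax x x0))) (locally (f (Rmax x x0)))).
  { apply (filterdiff_continuous_aux f (ex_intro _ _ Hd)).
    intros Q HQ. unfold within. eapply filter_imp; [|exact HQ]; auto. }
  specialize (Hc P HP). pose proof (continuous_Rmax x0 x _ Hc) as Hq.
  unfold filtermap, within in *. eapply filter_imp; [|exact Hq].
  intros y Hy. apply Hy, Rmax_r.
Qed.

Lemma is_derive_log_integral (x0 x : R) (th th' : R -> R) : 1 <= x0 -> x0 < x ->
  is_derive_on (fun x => x0 <= x) th th' ->
  is_derive (fun x => RInt (fun t => th t / t) x0 x) x (th x / x).
Proof.
  intros H1 Hx Hd.
  set (g := fun t => th (Rmax t x0) / (Rmax t x0)).
  assert (Hc : forall y, continuous g y).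
  { intros y. apply (continuous_mult (fun t => th (Rmax t x0)) (fun t => / Rmax t x0)).
    - apply (is_derive_on_continuous_extension x0 th th'); auto.
    - apply (continuous_comp (fun t => Rmax t x0) Rinv).
      + apply continuous_Rmax.
      + apply (ex_derive_continuous Rinv). auto_derive. pose proof (Rmax_r y x0); lra. }
  assert (E : forall y, x0 <= y -> RInt (fun t => th t / t) x0 y = RInt g x0 y).
  { intros y Hy. apply RInt_ext. intros t Ht. rewrite Rmin_left in Ht by lra.
    unfold g. rewrite Rmax_left by lra. auto. }
  apply (is_derive_ext_loc (fun y => RInt g x0 y)).
  { eapply filter_imp; [|apply (locally_gt x0 x Hx)]. simpl; intros. rewrite E; auto; lra. }
  replace (th x / x) with (g x) by (unfold g; rewrite Rmax_left by lra; auto).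
  apply (is_derive_RInt g (fun y => RInt g x0 y) x0).
  - apply filter_forall. intros b. apply @RInt_correct, (ex_RInt_continuous (V := R_CompleteNormedModule)). auto.
  - auto.
Qed.

(** Differentiating [h = C x ^ c exp (integral of theta / t)] expresses [h'] and
    [h''] through [h], [v = theta] and [w = x theta'], which both tend to [0]. *)
Lemma class_F_facts (c x0 : R) (h : R -> R) : 1 <= c -> class_F c x0 h ->
  exists h1 h2 v w : R -> R,
    (forall x, x0 < x ->
       is_derive h x (h1 x) /\ is_derive h1 x (h2 x) /\ 0 < h1 x /\ 0 < h2 x /\ 1 <= h x /\
       h1 x = (c + v x) * h x / x /\
       h2 x = ((c + v x) * (c + v x - 1) + w x) * h x / x ^ 2) /\
    is_lim v p_infty 0 /\ is_lim w p_infty 0 /\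
    (c = 1 ->
      (forall x, x0 < x -> 0 < v x) /\
      (forall eps, 0 < eps -> exists K, 0 < K /\ forall x, x0 < x -> 1 / v x <= K * Rpower x eps) /\
      is_lim (fun x => x / h x) p_infty 0 /\
      is_lim (fun x => w x / v x) p_infty 0).
Proof.
  intros Hc (Hx0 & Hh1 & (h1 & h2 & h3 & D1 & D2 & D3 & _ & Hpos)
    & (th & th' & th'' & Ch & T1 & T2 & _ & HCh & Heq & Hc1 & Hceq)).
  exists h1, h2, th, (fun x => x * th' x).
  set (I := fun x => RInt (fun t => th t / t) x0 x).
  assert (DI : forall x, x0 < x -> is_derive I x (th x / x)).
  { intros x Hx. apply (is_derive_log_integral x0 x th th'); auto. }
  assert (E1 : forall x, x0 < x -> h1 x = (c + th x) * h x / x).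
  { intros x Hx. rewrite <- (is_derive_unique h x (h1 x)) by (apply (is_derive_on_interior x0); auto).
    apply is_derive_unique.
    apply (is_derive_ext_loc (fun x => Ch * Rpower x c * exp (I x))).
    { eapply filter_imp; [|apply (locally_gt x0 x Hx)]. simpl; intros y Hy. symmetry; apply Heq; lra. }
    rewrite Heq by lra. fold (I x).
    evar_last.
    - apply (is_derive_mult (fun x => Ch * Rpower x c) (fun x => exp (I x)));
        [|  |intros; apply Rmult_comm].
      + apply (is_derive_scal (fun x => Rpower x c)), is_derive_Rpower. lra.
      + apply (is_derive_comp exp I); [apply is_derive_exp|apply DI; auto].
    - unfold plus, mult, scal; simpl; unfold mult; simpl.
      replace (Rpower x c) with (Rpower x (c - 1) * x).
      + field. lra.
      + rewrite <- (Rpower_1 x) at 2 by lra. rewrite <- Rpower_plus. f_equal; ring. }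
  assert (E2 : forall x, x0 < x ->
    h2 x = ((c + th x) * (c + th x - 1) + x * th' x) * h x / x ^ 2).
  { intros x Hx. rewrite <- (is_derive_unique h1 x (h2 x)) by (apply (is_derive_on_interior x0); auto).
    apply is_derive_unique.
    apply (is_derive_ext_loc (fun x => (c + th x) * h x * / x)).
    { eapply filter_imp; [|apply (locally_gt x0 x Hx)]. simpl; intros y Hy. symmetry; apply E1; auto. }
    pose proof (is_derive_on_interior x0 x _ _ T1 Hx) as Dt.
    pose proof (is_derive_on_interior x0 x _ _ D1 Hx) as Dh.
    rewrite E1 in Dh by auto.
    assert (is_derive (fun x => (c + th x) * h x * / x) x
      ((th' x * h x + (c + th x) * ((c + th x) * h x / x)) * / x - (c + th x) * h x / x ^ 2)).
    { auto_derive.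
      - repeat split; try lra; eexists; eauto.
      - replace (Derive (fun x => th x) x) with (th' x) by (symmetry; apply is_derive_unique; auto).
        replace (Derive (fun x => h x) x) with ((c + th x) * h x / x)
          by (symmetry; apply is_derive_unique; auto). field. lra. }
    evar_last; [exact H|]. field. lra. }
  assert (Lv : is_lim th p_infty 0).
  { destruct (Rle_lt_or_eq_dec 1 c Hc) as [H|H]; [apply Hc1; auto|apply Hceq; auto]. }
  assert (Lw : is_lim (fun x => x * th' x) p_infty 0).
  { destruct (Rle_lt_or_eq_dec 1 c Hc) as [H|H]; [apply Hc1; auto|].
    destruct (Hceq (eq_sym H)) as (P & _ & _ & _ & _ & L & _).
    apply (is_lim_ext_loc (fun x => th x * (x * th' x / th x))).
    - exists x0. intros y Hy. specialize (P y ltac:(lra)). field. lra.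
    - replace (Finite 0) with (Rbar_mult 0 0) by (simpl; f_equal; ring).
      apply is_lim_mult; auto. simpl; auto. }
  refine (conj _ (conj Lv (conj Lw _))).
  - intros x Hx. pose proof (Hpos x ltac:(lra)) as [P1 P2].
    refine (conj _ (conj _ (conj P1 (conj P2 (conj _ (conj (E1 x Hx) (E2 x Hx))))))).
    + apply (is_derive_on_interior x0); auto.
    + apply (is_derive_on_interior x0); auto.
    + apply Hh1; lra.
  - intros Ec. destruct (Hceq Ec) as (P1 & _ & P2 & P3 & _ & P4 & _).
    refine (conj _ (conj _ (conj P3 P4))).
    + intros x Hx. apply P1; lra.
    + intros eps He. destruct (P2 eps He) as (K & HK & HP).
      exists K. split; auto. intros; apply HP; lra.
Qed.

Ltac intros_max :=
  repeat match goal with |- context [Rmax ?a ?b] =>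
    lazymatch a with context [Rmax _ _] => fail | _ => idtac end;
    lazymatch b with context [Rmax _ _] => fail | _ => idtac end;
    let m := fresh "m" in
    pose proof (Rmax_l a b); pose proof (Rmax_r a b); set (m := Rmax a b) in *; clearbody m
  end.

(** The function [ln f - a ln] has a nonnegative derivative. *)
Lemma growth_ge (f f' : R -> R) (a X : R) : 0 < X ->
  (forall x, X <= x -> 0 < f x /\ is_derive f x (f' x) /\ a * f x <= x * f' x) ->
  forall x y, X <= x -> x <= y -> f x * Rpower (y / x) a <= f y.
Proof.
  intros HX H x y Hx Hxy.
  assert (G : ln (f x) - a * ln x <= ln (f y) - a * ln y).
  { apply (derivative_nonneg_le (fun t => ln (f t) - a * ln t)
      (fun t => f' t / f t - a / t)); auto.
    - intros t Ht. destruct (H t ltac:(lra)) as (P & D & _).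
      auto_derive.
      + repeat split; try lra. eexists; eauto.
      + replace (Derive (fun x => f x) t) with (f' t) by (symmetry; apply is_derive_unique; auto).
        field. lra.
    - intros t Ht. destruct (H t ltac:(lra)) as (P & D & Q).
      replace (f' t / f t - a / t) with ((t * f' t - a * f t) / (t * f t)) by (field; lra).
      apply Rdiv_le_0_compat; nra. }
  destruct (H x Hx) as (P & _). destruct (H y ltac:(lra)) as (P' & _).
  rewrite <- (exp_ln (f x)), <- (exp_ln (f y)) by auto.
  unfold Rpower. rewrite <- exp_plus. apply exp_le. rewrite ln_div by lra. lra.
Qed.

Lemma growth_le (f f' : R -> R) (a X : R) : 0 < X ->
  (forall x, X <= x -> 0 < f x /\ is_derive f x (f' x) /\ x * f' x <= a * f x) ->
  forall x y, X <= x -> x <= y -> f y <= f x * Rpower (y / x) a.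
Proof.
  intros HX H x y Hx Hxy.
  pose proof (growth_ge (fun t => / f t) (fun t => - f' t / f t ^ 2) (- a) X HX) as G.
  assert (G' : / f x * Rpower (y / x) (- a) <= / f y).
  { apply G; auto. intros t Ht. destruct (H t Ht) as (P & D & Q).
    refine (conj _ (conj _ _)); [apply Rinv_0_lt_compat; auto| |].
    - apply is_derive_inv; auto. lra.
    - replace (- a * / f t) with (- (a * f t) / f t ^ 2) by (field; lra).
      replace (t * (- f' t / f t ^ 2)) with (- (t * f' t) / f t ^ 2) by (field; lra).
      apply Rmult_le_compat_r; [left; apply Rinv_0_lt_compat, pow_lt; auto|lra]. }
  destruct (H x Hx) as (P & _). destruct (H y ltac:(lra)) as (P' & _).
  rewrite Rpower_Ropp, <- Rinv_mult in G'.
  apply Rinv_le_contravar in G'; [|apply Rinv_0_lt_compat, Rmult_lt_0_compat; [auto|apply exp_pos]].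
  rewrite !Rinv_inv in G'. exact G'.
Qed.

Lemma is_lim_eventually (f : R -> R) (l eps : R) : is_lim f p_infty l -> 0 < eps ->
  exists M, forall x, M <= x -> l - eps <= f x <= l + eps.
Proof.
  intros H He. apply is_lim_spec in H. destruct (H (mkposreal eps He)) as [M HM].
  exists (M + 1). intros x Hx. specialize (HM x ltac:(lra)). simpl in HM.
  apply Rabs_def2 in HM. lra.
Qed.

Lemma Rpower_eventually (K e : R) : 0 < e -> exists Y, 1 <= Y /\ forall y, Y <= y -> K <= Rpower y e.
Proof.
  intros He. set (K' := Rmax K 1). exists (Rpower K' (/ e)).
  assert (1 <= K') by apply Rmax_r.
  assert (0 < / e) by (apply Rinv_0_lt_compat; auto).
  assert (H1 : 1 <= Rpower K' (/ e)).
  { rewrite <- (Rpower_O K') by lra. apply Rle_Rpower; lra. }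
  split; auto. intros y Hy.
  apply Rle_trans with K'; [apply Rmax_l|].
  rewrite <- (Rpower_1 K') by lra.
  replace 1 with (/ e * e) by (field; lra). rewrite <- Rpower_mult.
  apply Rle_Rpower_l; lra.
Qed.

(** The interface between F_c and the analytic arguments, for the inverse of a
    function in F_c with [g = 1 / c].  If [g < 1], then [pr_conv] follows from
    [pr_lim2]; if [g = 1], it is extra information, which comes from the lower bound
    on [theta], and the second derivative test depends on it. *)
Record profile (g : R) (phi phi1 phi2 : R -> R) (Y : R) : Prop := {
  pr_Y : 1 <= Y;
  pr_pos : forall y, Y <= y -> 0 < phi y;
  pr_d1 : forall y, Y <= y -> is_derive phi y (phi1 y);
  pr_d2 : forall y, Y <= y -> is_derive phi1 y (phi2 y);
  pr_1 : forall y, Y <= y -> 0 < phi1 y <= 1;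
  pr_2 : forall y, Y <= y -> phi2 y <= 0;
  pr_lim2 : is_lim (fun y => y * phi2 y / phi1 y) p_infty (g - 1);
  pr_lim1 : is_lim (fun y => y * phi1 y / phi y) p_infty g;
  pr_conv : forall eps, 0 < eps ->
    exists Y', forall y, Y' <= y -> phi1 y * Rpower y (- 1 - eps) <= - phi2 y }.

Section Inverse.

Variables (X : R) (h h1 h2 phi : R -> R).
Hypothesis Hd1 : forall x, X <= x -> is_derive h x (h1 x).
Hypothesis Hd2 : forall x, X <= x -> is_derive h1 x (h2 x).
Hypothesis Hge : forall x, X <= x -> 1 <= h1 x.
Hypothesis Hinv : forall x, X <= x -> phi (h x) = x.

Lemma h_increment x y : X <= x -> x <= y -> y - x <= h y - h x.
Proof.
  intros Hx Hxy.
  assert (h x - x <= h y - y); [|lra].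
  apply (derivative_nonneg_le (fun t => h t - t) (fun t => h1 t - 1)); auto.
  - intros t Ht. apply @is_derive_minus; [apply Hd1; lra|apply @is_derive_id].
  - intros t Ht. specialize (Hge t ltac:(lra)). lra.
Qed.

Lemma inverse_right y : h X <= y -> X <= phi y /\ h (phi y) = y.
Proof.
  intros Hy. destruct (Req_dec y (h X)) as [->|Hne]; [rewrite Hinv; lra|].
  destruct (IVT_Rbar_incr h X p_infty (h X) p_infty y) as (x & Hx1 & _ & Hx2).
  - apply is_lim_continuity. apply derivable_continuous_pt. exists (h1 X).
    apply is_derive_Reals, Hd1; lra.
  - apply is_lim_spec. intros M. exists (Rmax X (M - h X + X)). intros x Hx.
    pose proof (Rmax_l X (M - h X + X)). pose proof (Rmax_r X (M - h X + X)).
    pose proof (h_increment X x ltac:(lra) ltac:(lra)). lra.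
  - simpl. intros x Hx _. apply derivable_continuous_pt. exists (h1 x).
    apply is_derive_Reals, Hd1; lra.
  - simpl; auto.
  - simpl; split; auto. lra.
  - simpl in Hx1. rewrite <- Hx2, Hinv by lra. lra.
Qed.

Lemma inverse_lipschitz y z : h X <= y -> y <= z -> 0 <= phi z - phi y <= z - y.
Proof.
  intros Hy Hz. destruct (inverse_right y Hy) as [A1 A2].
  destruct (inverse_right z ltac:(lra)) as [B1 B2].
  destruct (Rle_dec (phi y) (phi z)) as [H|H].
  - pose proof (h_increment (phi y) (phi z) A1 H). lra.
  - pose proof (h_increment (phi z) (phi y) B1 ltac:(lra)). lra.
Qed.

Lemma inverse_derivative y : h X < y -> is_derive phi y (/ h1 (phi y)).
Proof.
  intros Hy. destruct (inverse_right y ltac:(lra)) as [A1 A2].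
  set (x := phi y) in *.
  assert (Hc : continuous (fun t => / h1 t) x).
  { apply (continuous_comp h1 Rinv).
    - apply (ex_derive_continuous h1). eexists; apply Hd2; auto.
    - apply (ex_derive_continuous Rinv). auto_derive. specialize (Hge x A1); lra. }
  apply is_derive_Reals. intros eps He.
  destruct (Hc (ball (/ h1 x) (mkposreal eps He)) (locally_ball _ _)) as [d Hd].
  assert (Hm : 0 < Rmin d (y - h X)) by (apply Rmin_pos; [apply cond_pos|lra]).
  exists (mkposreal _ Hm). intros k Hk0 Hk. simpl in Hk.
  pose proof (Rmin_l d (y - h X)) as M1. pose proof (Rmin_r d (y - h X)) as M2.
  apply Rabs_def2 in Hk.
  destruct (inverse_right (y + k) ltac:(lra)) as [B1 B2].
  set (x' := phi (y + k)) in *.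
  assert (E : exists z, X <= z /\ Rabs (z - x) <= Rabs k /\ k = h1 z * (x' - x)).
  { destruct (Rlt_dec 0 k) as [Hp|Hn].
    - pose proof (inverse_lipschitz y (y + k) ltac:(lra) ltac:(lra)) as L. fold x x' in L.
      assert (x <> x') by (intros E; rewrite <- E in B2; lra).
      destruct (MVT_cor2 h h1 x x') as (z & Hz & Hzz); [lra| |].
      + intros t Ht. apply is_derive_Reals, Hd1; lra.
      + exists z. repeat split; [lra| |lra]. rewrite !Rabs_right; lra.
    - pose proof (inverse_lipschitz (y + k) y ltac:(lra) ltac:(lra)) as L. fold x x' in L.
      assert (x <> x') by (intros E; rewrite <- E in B2; lra).
      destruct (MVT_cor2 h h1 x' x) as (z & Hz & Hzz); [lra| |].
      + intros t Ht. apply is_derive_Reals, Hd1; lra.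
      + exists z. repeat split; [lra| |lra]. rewrite !Rabs_left1; lra. }
  destruct E as (z & Hz & Hzx & Ek).
  pose proof (Hge z Hz) as Hz1.
  assert (Hx' : x' - x <> 0) by (intros E; rewrite E, Rmult_0_r in Ek; auto).
  change (phi y) with x. replace ((x' - x) / k) with (/ h1 z) by (rewrite Ek; field; split; lra).
  apply (Hd z). unfold ball; simpl; unfold AbsRing_ball, abs, minus, plus, opp; simpl.
  eapply Rle_lt_trans; [exact Hzx|]. apply Rabs_def1; lra.
Qed.

Lemma inverse_second_derivative y : h X < y ->
  is_derive (fun y => / h1 (phi y)) y (- h2 (phi y) / h1 (phi y) ^ 3).
Proof.
  intros Hy. destruct (inverse_right y ltac:(lra)) as [A1 A2].
  pose proof (inverse_derivative y Hy) as D. pose proof (Hge _ A1).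
  pose proof (Hd2 _ A1) as D2.
  evar_last.
  - apply is_derive_inv; [|lra]. apply (is_derive_comp h1 phi); [exact D2|exact D].
  - unfold scal; simpl; unfold mult; simpl. field. lra.
Qed.

Lemma inverse_lim : is_lim phi p_infty p_infty.
Proof.
  apply is_lim_spec. intros M. exists (h (Rmax X M)). intros y Hy.
  pose proof (Rmax_l X M). pose proof (Rmax_r X M).
  pose proof (h_increment X (Rmax X M) ltac:(lra) ltac:(lra)).
  destruct (inverse_right y ltac:(lra)) as [A1 A2].
  destruct (Rlt_dec M (phi y)) as [|Hn]; auto. exfalso.
  pose proof (h_increment (phi y) (Rmax X M) A1 ltac:(lra)). lra.
Qed.

End Inverse.

(** If [c > 1], then [h'] itself grows like a positive power; if [c = 1], then
    [h'] is about [h / x], which tends to infinity. *)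
Lemma class_F_derivative_large (c x0 : R) (h : R -> R) : 1 <= c -> class_F c x0 h ->
  exists M, x0 < M /\ 1 <= M /\ forall x, M <= x -> 1 <= Derive h x.
Proof.
  intros Hc HF. pose proof HF as (Hx0 & _).
  destruct (class_F_facts c x0 h Hc HF) as (h1 & h2 & v & w & Hx & Lv & Lw & Hc1).
  assert (HD : forall x, x0 < x -> Derive h x = h1 x).
  { intros x Hxx. apply is_derive_unique, Hx; auto. }
  destruct (Rle_lt_or_eq_dec 1 c Hc) as [Hgt|Heq].
    (* any exponent smaller than [c - 1] would do *)
  - set (k := (c - 1) / 4). assert (Hk : 0 < k) by (unfold k; lra).
    destruct (is_lim_eventually v 0 k Lv Hk) as [M1 HM1].
    destruct (is_lim_eventually w 0 k Lw Hk) as [M2 HM2].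
    set (M := Rmax (x0 + 1) (Rmax M1 M2)).
    assert (Hb : x0 + 1 <= M /\ M1 <= M /\ M2 <= M).
    { unfold M. pose proof (Rmax_l (x0 + 1) (Rmax M1 M2)). pose proof (Rmax_r (x0 + 1) (Rmax M1 M2)).
      pose proof (Rmax_l M1 M2). pose proof (Rmax_r M1 M2). lra. }
    assert (G : forall x, M <= x -> h1 M * Rpower (x / M) k <= h1 x).
    { intros x HxM. apply (growth_ge h1 h2 k M); try lra.
      intros t Ht. destruct (Hx t ltac:(lra)) as (_ & D2 & P1 & P2 & P3 & E1 & E2).
      specialize (HM1 t ltac:(lra)). specialize (HM2 t ltac:(lra)).
      refine (conj P1 (conj D2 _)). rewrite E1, E2.
      replace (t * _) with (((c + v t) * (c + v t - 1) + w t) * (h t / t)) by (field; lra).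
      replace (k * _) with (k * (c + v t) * (h t / t)) by (field; lra).
      apply Rmult_le_compat_r; [apply Rdiv_le_0_compat; lra|].
      assert (E : c = 1 + 4 * k) by (unfold k; lra). rewrite E in *. nra. }
    destruct (Hx M ltac:(lra)) as (_ & _ & P1 & _).
    destruct (Rpower_eventually (/ h1 M) k Hk) as (Y & HY & HYb).
    exists (M * Y). repeat split; try nra. intros x Hxx.
    rewrite HD by nra. eapply Rle_trans; [|apply G; nra].
    assert (/ h1 M <= Rpower (x / M) k).
    { apply HYb. apply Rle_div_r; lra. }
    apply Rmult_le_compat_l with (r := h1 M) in H; [|lra]. rewrite Rinv_r in H; lra.
  - destruct (Hc1 (eq_sym Heq)) as (Pv & _ & L & _).
    destruct (is_lim_eventually _ 0 (1 / 2) L ltac:(lra)) as [M1 HM1].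
    exists (Rmax (x0 + 1) M1). pose proof (Rmax_l (x0 + 1) M1). pose proof (Rmax_r (x0 + 1) M1).
    repeat split; try lra. intros x Hxx. rewrite HD by lra.
    destruct (Hx x ltac:(lra)) as (_ & _ & P1 & P2 & P3 & E1 & E2). rewrite E1.
    specialize (HM1 x ltac:(lra)). specialize (Pv x ltac:(lra)).
    assert (x <= h x).
    { apply Rle_trans with (h x * 1); [|lra]. rewrite (Rmult_comm (h x)). apply Rle_div_l; lra. }
    apply Rle_div_r; [lra|]. nra.
Qed.

(** At [y = h x] one has [- y phi'' / phi' = h h'' / h' ^ 2], which in terms of
    [v] and [w] is [((c + v) (c + v - 1) + w) / (c + v) ^ 2].  It tends to [1 - 1 / c],
    and for [c = 1] it is asymptotic to [theta]. *)
Lemma class_F_profile (c x0 : R) (h phi : R -> R) : 1 <= c -> class_F c x0 h ->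
  is_inverse x0 h phi -> exists phi1 phi2 Y, profile (1 / c) phi phi1 phi2 Y.
Proof.
  intros Hc HF Hinv.
  destruct (class_F_derivative_large c x0 h Hc HF) as (X & HX0 & HX1 & HXd).
  destruct (class_F_facts c x0 h Hc HF) as (h1 & h2 & v & w & Hx & Lv & Lw & Hc1).
  assert (HD : forall x, x0 < x -> Derive h x = h1 x).
  { intros x Hxx. apply is_derive_unique, Hx; auto. }
  assert (Hd1 : forall x, X <= x -> is_derive h x (h1 x)) by (intros; apply Hx; lra).
  assert (Hd2 : forall x, X <= x -> is_derive h1 x (h2 x)) by (intros; apply Hx; lra).
  assert (Hge : forall x, X <= x -> 1 <= h1 x) by (intros; rewrite <- HD by lra; auto).
  assert (Hinv' : forall x, X <= x -> phi (h x) = x) by (intros; apply Hinv; lra).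
  pose proof (inverse_right X h h1 phi Hd1 Hge Hinv') as IR.
  pose proof (inverse_lim X h h1 phi Hd1 Hge Hinv') as IL.
  set (Y := h X + 1).
  assert (HhX : 1 <= h X) by (apply Hx; lra).
  assert (Hid : forall y, Y <= y -> X <= phi y /\ h (phi y) = y)
    by (intros; apply IR; unfold Y in *; lra).
  exists (fun y => / h1 (phi y)), (fun y => - h2 (phi y) / h1 (phi y) ^ 3), Y.
  assert (Ecv : forall x, X <= x -> 0 < c + v x).
  { intros x Hxx. destruct (Hx x ltac:(lra)) as (_ & _ & P1 & P2 & P3 & E1 & E2).
    rewrite E1 in P1. assert (0 < h x / x) by (apply Rdiv_lt_0_compat; lra).
    replace ((c + v x) * h x / x) with ((c + v x) * (h x / x)) in P1 by (field; lra). nra. }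
  assert (Eq : forall y, Y <= y -> y * (- h2 (phi y) / h1 (phi y) ^ 3) / (/ h1 (phi y))
    = - (((c + v (phi y)) * (c + v (phi y) - 1) + w (phi y)) / (c + v (phi y)) ^ 2)).
  { intros y Hy. destruct (Hid y Hy) as [A1 A2]. pose proof (Ecv _ A1) as P.
    destruct (Hx (phi y) ltac:(lra)) as (_ & _ & P1 & P2 & P3 & E1 & E2).
    rewrite E1, E2. rewrite <- A2 at 1. field. lra. }
  assert (Lv' : is_lim (fun y => v (phi y)) p_infty 0).
  { apply (is_lim_comp v phi p_infty 0 p_infty); auto. exists 0; discriminate. }
  assert (Lw' : is_lim (fun y => w (phi y)) p_infty 0).
  { apply (is_lim_comp w phi p_infty 0 p_infty); auto. exists 0; discriminate. }
  assert (Lc : is_lim (fun y => c + v (phi y)) p_infty c).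
  { replace (Finite c) with (Finite (c + 0)) by (f_equal; ring).
    apply is_lim_plus'; [apply is_lim_const|auto]. }
  assert (Lq : is_lim (fun y => ((c + v (phi y)) * (c + v (phi y) - 1) + w (phi y)) / (c + v (phi y)) ^ 2)
     p_infty ((c - 1) / c)).
  { replace (Finite ((c - 1) / c)) with (Rbar_div (c * (c - 1) + 0) (c * c))
      by (simpl; f_equal; field; lra).
    apply (is_lim_ext (fun y => ((c + v (phi y)) * (c + v (phi y) - 1) + w (phi y))
        / ((c + v (phi y)) * (c + v (phi y))))); [intros; f_equal; ring|].
    apply is_lim_div.
    - apply is_lim_plus'; auto.
      apply (is_lim_mult _ _ _ c (c - 1)); [auto| |simpl; auto].
      apply is_lim_minus'; [auto|apply is_lim_const].
    - apply (is_lim_mult _ _ _ c c); [auto|auto|simpl; auto].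
    - intros E; injection E; nra.
    - simpl; auto. }
  split.
  - unfold Y; lra.
  - intros y Hy. destruct (Hid y Hy). lra.
  - intros y Hy. apply (inverse_derivative X h h1 h2 phi Hd1 Hd2 Hge Hinv'). unfold Y in *; lra.
  - intros y Hy. apply (inverse_second_derivative X h h1 h2 phi Hd1 Hd2 Hge Hinv'). unfold Y in *; lra.
  - intros y Hy. destruct (Hid y Hy) as [A1 A2]. pose proof (Hge _ A1). split.
    + apply Rinv_0_lt_compat; lra.
    + rewrite <- Rinv_1. apply Rinv_le_contravar; lra.
  - intros y Hy. destruct (Hid y Hy) as [A1 A2].
    destruct (Hx (phi y) ltac:(lra)) as (_ & _ & P1 & P2 & _).
    assert (0 < h2 (phi y) / h1 (phi y) ^ 3) by (apply Rdiv_lt_0_compat; [auto|apply pow_lt; lra]).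
    unfold Rdiv in *. lra.
  - apply (is_lim_ext_loc (fun y => - (((c + v (phi y)) * (c + v (phi y) - 1) + w (phi y)) / (c + v (phi y)) ^ 2))).
    + exists Y. intros y Hy. symmetry; apply Eq; lra.
    + replace (Finite (1 / c - 1)) with (Rbar_opp ((c - 1) / c)) by (simpl; f_equal; field; lra).
      apply is_lim_opp; auto.
  - apply (is_lim_ext_loc (fun y => / (c + v (phi y)))).
    + exists Y. intros y Hy. destruct (Hid y ltac:(lra)) as [A1 A2]. pose proof (Ecv _ A1) as P.
      destruct (Hx (phi y) ltac:(lra)) as (_ & _ & P1 & P2 & P3 & E1 & E2).
      rewrite E1. rewrite <- A2 at 2. field. lra.
    + replace (Finite (1 / c)) with (Rbar_inv c) by (simpl; f_equal; field; lra).
      apply is_lim_inv; auto. intros E; injection E; lra.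
  - intros eps He.
    assert (K : exists Y', Y <= Y' /\ forall y, Y' <= y -> Rpower y (- eps) <=
      ((c + v (phi y)) * (c + v (phi y) - 1) + w (phi y)) / (c + v (phi y)) ^ 2).
    { destruct (Rle_lt_or_eq_dec 1 c Hc) as [Hgt|Heq].
      - set (k := (c - 1) / c / 2). assert (Hk : 0 < k).
        { unfold k. apply Rdiv_lt_0_compat; [apply Rdiv_lt_0_compat|]; lra. }
        destruct (is_lim_eventually _ _ k Lq Hk) as [M1 HM1].
        destruct (Rpower_eventually (/ k) eps He) as (Y1 & HY1 & HY2).
        exists (Rmax Y (Rmax M1 Y1)). split; [apply Rmax_l|]. intros y Hy.
        pose proof (Rmax_r Y (Rmax M1 Y1)). pose proof (Rmax_l M1 Y1). pose proof (Rmax_r M1 Y1).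
        specialize (HM1 y ltac:(lra)). specialize (HY2 y ltac:(lra)).
        rewrite Rpower_Ropp. apply Rle_trans with k; [|unfold k in *; lra].
        rewrite <- (Rinv_inv k). apply Rinv_le_contravar; auto. apply Rinv_0_lt_compat; auto.
      - destruct (Hc1 (eq_sym Heq)) as (Pv & PK & L & Lr).
        assert (Lr' : is_lim (fun y => w (phi y) / v (phi y)) p_infty 0).
        { apply (is_lim_comp (fun x => w x / v x) phi p_infty 0 p_infty); auto. exists 0; discriminate. }
        destruct (is_lim_eventually _ _ (1 / 4) Lr' ltac:(lra)) as [M1 HM1].
        destruct (is_lim_eventually _ _ (1 / 8) Lv' ltac:(lra)) as [M2 HM2].
        destruct (PK (eps / 2) ltac:(lra)) as (K & HK & HKb).
        destruct (Rpower_eventually (2 * K * Rpower 2 (eps / 2)) (eps / 2) ltac:(lra)) as (Y1 & HY1 & HY2).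
        exists (Rmax (Rmax Y X) (Rmax (Rmax M1 M2) Y1)). intros_max.
        split; [lra|]. intros y Hy.
        specialize (HM1 y ltac:(lra)). specialize (HM2 y ltac:(lra)). specialize (HY2 y ltac:(lra)).
        destruct (Hid y ltac:(lra)) as [A1 A2]. specialize (Pv (phi y) ltac:(lra)).
        specialize (HKb (phi y) ltac:(lra)).
        assert (Hphiy : phi y <= 2 * y).
        { pose proof (h_increment X h h1 Hd1 Hge X (phi y) ltac:(lra) A1). lra. }
        rewrite <- Heq. set (u := v (phi y)) in *.
        apply Rle_trans with (u / 2).
        + set (e := eps / 2) in *.
          assert (Rpower (phi y) e <= Rpower 2 e * Rpower y e).
          { rewrite Rpower_mult_distr by lra. apply Rle_Rpower_l; unfold e; lra. }
          replace (- eps) with (- e + - e) by (unfold e; field).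
          rewrite Rpower_plus, Rpower_Ropp.
          assert (P2 : 0 < Rpower 2 e) by apply exp_pos.
          assert (Py : 0 < Rpower y e) by apply exp_pos.
          set (p2 := Rpower 2 e) in *. set (py := Rpower y e) in *.
          assert (Hu : / (K * (p2 * py)) <= u).
          { rewrite <- (Rinv_inv u). apply Rinv_le_contravar; [apply Rinv_0_lt_compat; auto|].
            replace (1 / u) with (/ u) in HKb by (field; lra). nra. }
          apply Rle_trans with (/ (K * (p2 * py)) / 2); [|lra].
          replace (/ (K * (p2 * py)) / 2) with (/ (2 * K * p2) * / py) by (field; lra).
          apply Rmult_le_compat_r; [left; apply Rinv_0_lt_compat; auto|].
          apply Rinv_le_contravar; auto. apply Rmult_lt_0_compat; [lra|auto].
        + assert (Hw : - (u / 4) <= w (phi y)).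
          { replace (w (phi y)) with (w (phi y) / u * u) by (field; lra).
            replace (- (u / 4)) with (- (1 / 4) * u) by field. apply Rmult_le_compat_r; lra. }
          assert (Hp : 0 < (1 + u) ^ 2) by (apply pow_lt; lra).
          apply (proj1 (Rle_div_r (u / 2) _ _ Hp)). nra. }
    destruct K as (Y' & HYY & HK). exists Y'. intros y Hy.
    specialize (HK y Hy). rewrite <- (Ropp_involutive (_ / (c + v (phi y)) ^ 2)) in HK.
    rewrite <- Eq in HK by lra.
    destruct (Hid y ltac:(lra)) as [A1 A2]. pose proof (Hge _ A1).
    assert (Hy0 : 1 <= y) by (unfold Y in *; lra).
    replace (- 1 - eps) with (- (1) + - eps) by ring. rewrite Rpower_plus, Rpower_Ropp, Rpower_1 by lra.
    set (p2 := - h2 (phi y) / h1 (phi y) ^ 3) in *.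
    apply Rle_trans with (/ h1 (phi y) * (/ y * - (y * p2 / / h1 (phi y)))).
    + apply Rmult_le_compat_l; [left; apply Rinv_0_lt_compat; lra|].
      apply Rmult_le_compat_l; [left; apply Rinv_0_lt_compat; lra|]. exact HK.
    + right. field. lra.
Qed.

(** * The smooth model of the counting functions *)

(** The expected number of integers [m] with [floor (h m) = n].  The values
    before [n0] are set to [0], because [phi] is only controlled for large arguments. *)
Definition gaps (phi : R -> R) (n0 n : nat) : R :=
  if lt_dec n n0 then 0 else phi (INR n + 1) - phi (INR n).

(** Times [phi1 l], a majorant of both the gaps and their model: the exponent
    [- 1 / 2] is below [g - 1], and it is still integrable near [0]. *)
Definition root_ratio (l n : nat) : R := sqrt (INR l / (INR n + 1)).

Lemma root_ratio_pos l n : (0 < l)%nat -> 0 < root_ratio l n.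
Proof.
  intros Hl. apply sqrt_lt_R0, Rdiv_lt_0_compat; [apply lt_0_INR; auto|].
  pose proof (pos_INR n); lra.
Qed.

Lemma root_ratio_ge_half l n : (0 < l)%nat -> (n <= l)%nat -> / 2 <= root_ratio l n.
Proof.
  intros Hl Hn.
  assert (1 <= INR l) by (apply (le_INR 1); lia).
  assert (INR n <= INR l) by (apply le_INR; auto). pose proof (pos_INR n).
  unfold root_ratio. rewrite <- (sqrt_square (/ 2)) by lra.
  apply sqrt_le_1_alt. apply le_div; lra.
Qed.

Lemma profile_phi1_decreasing g phi phi1 phi2 Y x y :
  profile g phi phi1 phi2 Y -> Y <= x -> x <= y -> phi1 y <= phi1 x.
Proof.
  intros HP Hx Hxy.
  assert (- phi1 x <= - phi1 y); [|lra].
  apply (derivative_nonneg_le (fun t => - phi1 t) (fun t => - phi2 t)); auto.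
  - intros t Ht. apply @is_derive_opp. apply (pr_d2 _ _ _ _ _ HP); lra.
  - intros t Ht. pose proof (pr_2 _ _ _ _ _ HP t). lra.
Qed.

Lemma profile_gap g phi phi1 phi2 Y x :
  profile g phi phi1 phi2 Y -> Y <= x -> phi1 (x + 1) <= phi (x + 1) - phi x <= phi1 x.
Proof.
  intros HP Hx. destruct (MVT_cor2 phi phi1 x (x + 1)) as (z & Hz & Hzz); [lra| |].
  - intros t Ht. apply is_derive_Reals, (pr_d1 _ _ _ _ _ HP); lra.
  - pose proof (profile_phi1_decreasing _ _ _ _ _ x z HP Hx ltac:(lra)).
    pose proof (profile_phi1_decreasing _ _ _ _ _ z (x + 1) HP ltac:(lra) ltac:(lra)).
    rewrite Hz. lra.
Qed.

Lemma profile_regular g phi phi1 phi2 Y eps : 0 < eps -> profile g phi phi1 phi2 Y ->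
  exists Y1, Y <= Y1 /\ forall x y, Y1 <= x -> x <= y ->
    phi1 x * Rpower (y / x) (g - 1 - eps) <= phi1 y <= phi1 x * Rpower (y / x) (g - 1 + eps).
Proof.
  intros He HP. pose proof (pr_Y _ _ _ _ _ HP) as HY.
  destruct (is_lim_eventually _ _ eps (pr_lim2 _ _ _ _ _ HP) He) as [M HM].
  exists (Rmax Y M). intros_max. split; auto. intros x y Hx Hxy.
  assert (E : forall t, m <= t -> 0 < phi1 t /\ is_derive phi1 t (phi2 t) /\
     (g - 1 - eps) * phi1 t <= t * phi2 t <= (g - 1 + eps) * phi1 t).
  { intros t Ht. specialize (HM t ltac:(lra)). pose proof (pr_1 _ _ _ _ _ HP t ltac:(lra)).
    refine (conj _ (conj _ _)); [lra|apply (pr_d2 _ _ _ _ _ HP); lra|].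
    replace (t * phi2 t) with (t * phi2 t / phi1 t * phi1 t) by (field; lra).
    split; apply Rmult_le_compat_r; lra. }
  split.
  - apply (growth_ge phi1 phi2 _ m); auto; [lra|]. intros t Ht. destruct (E t Ht) as (A & B & C).
    refine (conj A (conj B _)); lra.
  - apply (growth_le phi1 phi2 _ m); auto; [lra|]. intros t Ht. destruct (E t Ht) as (A & B & C).
    refine (conj A (conj B _)); lra.
Qed.

Lemma Rpower_quarter x : 0 < x -> Rpower x (1 / 4) = sqrt (sqrt x).
Proof.
  intros Hx. rewrite <- (Rpower_sqrt x) by auto.
  rewrite <- Rpower_sqrt by apply exp_pos. rewrite Rpower_mult. f_equal. field.
Qed.

(** The factor that makes [negbin g n], which is about
    [n ^ (g - 1) / Gamma g], agree with [phi1] at [n = l]. *)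
Definition model_weight (g : R) (phi1 : R -> R) (l : nat) : R :=
  Gamma g * phi1 (INR l) * Rpower (INR l) (1 - g).

Lemma model_weight_eq g phi1 l n : (0 < n)%nat -> (0 < l)%nat ->
  model_weight g phi1 l * negbin g n
  = phi1 (INR l) * Rpower (INR l / INR n) (1 - g)
    * (negbin g n * Gamma g / Rpower (INR n) (g - 1)).
Proof.
  intros Hn Hl. assert (0 < INR n) by (apply lt_0_INR; auto).
  assert (0 < INR l) by (apply lt_0_INR; auto).
  unfold model_weight. replace (g - 1) with (- (1 - g)) by ring. rewrite Rpower_Ropp.
  assert (E : Rpower (INR l) (1 - g) = Rpower (INR l / INR n) (1 - g) * Rpower (INR n) (1 - g)).
  { rewrite Rpower_mult_distr; [f_equal; field; lra| |auto]. apply Rdiv_lt_0_compat; auto. }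
  rewrite E. assert (0 < Rpower (INR n) (1 - g)) by apply exp_pos. field. lra.
Qed.

Lemma quarter_shift (l n : nat) : (0 < n)%nat -> (n <= l)%nat ->
  Rpower (INR l / INR n) (1 / 4) <= 2 * sqrt (root_ratio l n).
Proof.
  intros Hn Hl. assert (1 <= INR n) by (apply (le_INR 1); auto).
  assert (INR n <= INR l) by (apply le_INR; auto).
  assert (0 < INR l / INR n) by (apply Rdiv_lt_0_compat; lra).
  unfold root_ratio. rewrite <- Rpower_quarter by (apply Rdiv_lt_0_compat; lra).
  apply Rle_trans with (Rpower (2 * (INR l / (INR n + 1))) (1 / 4)).
  - apply Rle_Rpower_l; [lra|]. split; auto.
    apply div_le; [lra|]. replace (2 * (INR l / (INR n + 1)) * INR n)
      with (INR l * (2 * INR n / (INR n + 1))) by (field; lra).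
    rewrite <- (Rmult_1_r (INR l)) at 1. apply Rmult_le_compat_l; [lra|].
    apply le_div; lra.
  - rewrite <- Rpower_mult_distr by (try apply Rdiv_lt_0_compat; lra).
    apply Rmult_le_compat_r; [left; apply exp_pos|].
    rewrite <- (Rpower_1 2) at 2 by lra. apply Rle_Rpower; lra.
Qed.

Section Comparison.

Variables (g : R) (phi phi1 phi2 : R -> R) (Y : R).
Hypothesis Hg : 3 / 4 < g <= 1.
Hypothesis HP : profile g phi phi1 phi2 Y.

Definition dominated_gaps (n0 : nat) : Prop := exists C, 0 < C /\
  forall l n, (0 < l)%nat -> (n0 <= l)%nat -> (n <= l)%nat ->
    0 <= gaps phi n0 n <= C * phi1 (INR l) * sqrt (root_ratio l n) /\
    0 <= model_weight g phi1 l * negbin g n <= C * phi1 (INR l) * sqrt (root_ratio l n).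

(** Both sequences are at most [phi1 l] times a power of [l / (n + 1)] with
    exponent close to [1 - g], which is less than [1 / 4]. *)
Lemma gaps_dominated : exists Y1, Y <= Y1 /\ forall n0, Y1 <= INR n0 -> dominated_gaps n0.
Proof.
  destruct (profile_regular g phi phi1 phi2 Y (g - 3 / 4) ltac:(lra) HP) as (Y1 & HY1 & HR).
  pose proof (pr_Y _ _ _ _ _ HP) as HY.
  exists Y1. split; auto. intros n0 Hn0. exists (2 + 2 * Gamma g).
  pose proof (Gamma_pos g ltac:(lra)) as HG.
  split; [lra|]. intros l n Hl Hl0 Hn.
  assert (Hl1 : INR n0 <= INR l) by (apply le_INR; auto).
  pose proof (pr_1 _ _ _ _ _ HP (INR l) ltac:(lra)) as Hp.
  pose proof (sqrt_pos (root_ratio l n)) as Hq.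
  split.
  - unfold gaps. destruct (lt_dec n n0) as [Hlt|Hge].
    + split; [lra|]. apply Rmult_le_pos; nra.
    + assert (Hn1 : INR n0 <= INR n) by (apply le_INR; lia).
      assert (Hn2 : INR n <= INR l) by (apply le_INR; lia).
      assert (Hn3 : (0 < n)%nat) by (apply INR_lt; simpl; lra).
      destruct (profile_gap _ _ _ _ _ (INR n) HP ltac:(lra)) as [G1 G2].
      pose proof (pr_1 _ _ _ _ _ HP (INR n + 1) ltac:(lra)).
      split; [lra|]. eapply Rle_trans; [exact G2|].
      destruct (HR (INR n) (INR l) ltac:(lra) Hn2) as [R1 _].
      replace (g - 1 - (g - 3 / 4)) with (- (1 / 4)) in R1 by field.
      rewrite Rpower_Ropp in R1.
      pose proof (quarter_shift l n Hn3 Hn) as Q.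
      assert (Hpos : 0 < Rpower (INR l / INR n) (1 / 4)) by apply exp_pos.
      set (z := Rpower (INR l / INR n) (1 / 4)) in *.
      apply Rle_trans with (phi1 (INR l) * z).
      * apply Rmult_le_reg_r with (/ z); [apply Rinv_0_lt_compat; auto|].
        rewrite Rmult_assoc, Rinv_r, Rmult_1_r by lra. exact R1.
      * apply Rle_trans with (phi1 (INR l) * (2 * sqrt (root_ratio l n))); [apply Rmult_le_compat_l; lra|].
        assert (0 <= phi1 (INR l) * sqrt (root_ratio l n)) by (apply Rmult_le_pos; lra). nra.
  - pose proof (negbin_pos g n ltac:(lra)) as Hb.
    split.
    + unfold model_weight. repeat apply Rmult_le_pos; try lra. left; apply exp_pos.
    + destruct (Nat.eq_dec n 0) as [->|Hn0'].
      * simpl negbin. rewrite Rmult_1_r. unfold model_weight.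
        assert (E : sqrt (root_ratio l 0) = Rpower (INR l) (1 / 4)).
        { rewrite Rpower_quarter by lra. unfold root_ratio. simpl INR. do 3 f_equal. field. }
        rewrite E. assert (Rpower (INR l) (1 - g) <= Rpower (INR l) (1 / 4)) by (apply Rle_Rpower; lra).
        apply Rle_trans with (Gamma g * phi1 (INR l) * Rpower (INR l) (1 / 4)).
        -- apply Rmult_le_compat_l; auto. apply Rmult_le_pos; lra.
        -- apply Rmult_le_compat_r; [lra|]. apply Rmult_le_compat_r; lra.
      * rewrite model_weight_eq by lia.
        assert (Hn1 : 1 <= INR n) by (apply (le_INR 1); lia).
        assert (Hn2 : INR n <= INR l) by (apply le_INR; lia).
        assert (U : negbin g n * Gamma g / Rpower (INR n) (g - 1) <= 1).
        { apply div_le; [apply exp_pos|]. rewrite Rmult_1_l. apply negbin_upper; [lra|lia]. }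
        assert (Q : Rpower (INR l / INR n) (1 - g) <= 2 * sqrt (root_ratio l n)).
        { eapply Rle_trans; [|apply quarter_shift; [lia|auto]].
          apply Rle_Rpower; [|lra]. apply le_div; lra. }
        assert (0 < Rpower (INR l / INR n) (1 - g)) by apply exp_pos.
        apply Rle_trans with (phi1 (INR l) * Rpower (INR l / INR n) (1 - g) * 1).
        -- apply Rmult_le_compat_l; auto. apply Rmult_le_pos; lra.
        -- rewrite Rmult_1_r. apply Rle_trans with (phi1 (INR l) * (2 * sqrt (root_ratio l n)));
             [apply Rmult_le_compat_l; lra|].
           assert (0 <= phi1 (INR l) * sqrt (root_ratio l n)) by (apply Rmult_le_pos; lra). nra.
Qed.

(** For [n] comparable with [l], regular variation gives
    [phi1 n = phi1 l (l / n) ^ (1 - g) (1 + o(1))], and [negbin_asymptotic] gives the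
    same for the model. *)
Lemma gaps_close_bulk (H t : R) : 1 < H -> 0 < t < 1 -> exists L : nat,
  forall l n n0, (L <= l)%nat -> (n <= l)%nat -> (n0 <= n)%nat -> (0 < n)%nat ->
    INR l / INR n <= H ->
    Rabs (gaps phi n0 n - model_weight g phi1 l * negbin g n) <= 2 * t * H * phi1 (INR l).
Proof.
  intros HH Ht.
  (* chosen so that [H ^ eps = 1 + t / 2] *)
  set (eps := ln (1 + t / 2) / ln H).
  assert (HlnH : 0 < ln H) by (rewrite <- ln_1; apply ln_increasing; lra).
  assert (Hlnt : 0 < ln (1 + t / 2)) by (rewrite <- ln_1; apply ln_increasing; lra).
  assert (He : 0 < eps) by (apply Rdiv_lt_0_compat; auto).
  assert (EH : Rpower H eps = 1 + t / 2).
  { unfold Rpower, eps. replace (_ * ln H) with (ln (1 + t / 2)) by (field; lra).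
    apply exp_ln; lra. }
  destruct (profile_regular g phi phi1 phi2 Y eps He HP) as (Y1 & HY1 & HR).
  pose proof (pr_Y _ _ _ _ _ HP) as HY.
  destruct (profile_regular g phi phi1 phi2 Y (g - 3 / 4) ltac:(lra) HP) as (Y2 & HY2 & HR2).
  pose proof (negbin_asymptotic g ltac:(lra)) as HA.
  apply is_lim_seq_spec in HA.
  assert (HN : exists N1, forall n, (N1 <= n)%nat ->
    Rabs (negbin g (S n) * Gamma g / Rpower (INR (S n)) (g - 1) - 1) < t)
    by exact (HA (mkposreal t (proj1 Ht))).
  destruct HN as [N1 HN1].
  destruct (nfloor_ex (Rmax 0 (H * (Y1 + Y2 + INR N1 + 1 + 2 / t)))) as [L HL]; [apply Rmax_l|].
  exists (S L). intros l n n0 HLl Hn Hn0 Hn1 Hratio.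
  assert (Hnp : 0 < INR n) by (apply lt_0_INR; auto).
  assert (Hnl : INR n <= INR l) by (apply le_INR; auto).
  assert (HtP : 0 < 2 / t) by (apply Rdiv_lt_0_compat; lra).
  assert (Hnbig : Y1 + Y2 + INR N1 + 1 + 2 / t <= INR n).
  { assert (INR L + 1 <= INR l) by (rewrite <- S_INR; apply le_INR; auto).
    pose proof (Rmax_r 0 (H * (Y1 + Y2 + INR N1 + 1 + 2 / t))).
    apply (proj1 (Rle_div_l _ _ _ Hnp)) in Hratio.
    apply Rmult_le_reg_l with H; lra. }
  pose proof (pos_INR N1) as HN1p.
  unfold gaps. destruct (lt_dec n n0) as [|_]; [lia|].
  rewrite model_weight_eq by lia.
  set (rho := negbin g n * Gamma g / Rpower (INR n) (g - 1)).
  assert (Hrho : 1 - t <= rho <= 1 + t).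
  { assert (N1 <= n - 1)%nat.
    { assert (N1 < n)%nat by (apply INR_lt; lra). lia. }
    specialize (HN1 (n - 1)%nat H0). replace (S (n - 1)) with n in HN1 by lia.
    fold rho in HN1. apply Rabs_def2 in HN1. lra. }
  set (P := phi1 (INR l)). set (B := Rpower (INR l / INR n) (1 - g)).
  pose proof (pr_1 _ _ _ _ _ HP (INR l) ltac:(lra)) as HPl. fold P in HPl.
  assert (Hr1 : 1 <= INR l / INR n) by (apply le_div; lra).
  assert (HB : 0 < B <= H).
  { split; [apply exp_pos|]. apply Rle_trans with (Rpower (INR l / INR n) 1).
    - apply Rle_Rpower; lra.
    - rewrite Rpower_1; lra. }
  assert (Hz : 1 <= Rpower (INR l / INR n) eps <= 1 + t / 2).
  { split.
    - rewrite <- (Rpower_O (INR l / INR n)) by lra. apply Rle_Rpower; lra.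
    - rewrite <- EH. apply Rle_Rpower_l; lra. }
  set (z := Rpower (INR l / INR n) eps) in *.
  assert (Hphi : P * B * / z <= phi1 (INR n) <= P * B * z).
  { destruct (HR (INR n) (INR l) ltac:(lra) Hnl) as [R1 R2]. fold P in R1, R2.
    replace (g - 1 - eps) with (- (1 - g + eps)) in R1 by ring.
    replace (g - 1 + eps) with (- (1 - g) + eps) in R2 by ring.
    rewrite Rpower_Ropp, Rpower_plus in R1. rewrite Rpower_plus, Rpower_Ropp in R2.
    fold B z in R1, R2. split.
    - apply Rmult_le_reg_r with (/ B * z); [apply Rmult_lt_0_compat; [apply Rinv_0_lt_compat|]; lra|].
      replace (P * B * / z * (/ B * z)) with P by (field; lra). exact R2.
    - apply Rmult_le_reg_r with (/ (B * z)); [apply Rinv_0_lt_compat, Rmult_lt_0_compat; lra|].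
      replace (P * B * z * / (B * z)) with P by (field; lra). exact R1. }
  assert (Hgap : phi1 (INR n) * (1 - t / 2) <= phi (INR n + 1) - phi (INR n) <= phi1 (INR n)).
  { destruct (profile_gap _ _ _ _ _ (INR n) HP ltac:(lra)) as [G1 G2]. split; auto.
    eapply Rle_trans; [|exact G1].
    destruct (HR2 (INR n) (INR n + 1) ltac:(lra) ltac:(lra)) as [R1 _].
    pose proof (pr_1 _ _ _ _ _ HP (INR n) ltac:(lra)) as Hpn.
    eapply Rle_trans; [|exact R1]. apply Rmult_le_compat_l; [lra|].
    replace (g - 1 - (g - 3 / 4)) with (- (1 / 4)) by field.
    apply Rle_trans with (Rpower ((INR n + 1) / INR n) (- (1))).
    - rewrite Rpower_Ropp, Rpower_1 by (apply Rdiv_lt_0_compat; lra).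
      replace (/ ((INR n + 1) / INR n)) with (INR n / (INR n + 1)) by (field; lra).
      apply le_div; [lra|].
      assert (Hnt : 2 / t <= INR n) by lra. apply (proj1 (Rle_div_l _ _ _ (proj1 Ht))) in Hnt. nra.
    - apply Rle_Rpower; [|lra]. apply le_div; lra. }
  set (gp := phi (INR n + 1) - phi (INR n)) in *.
  assert (HPB : 0 < P * B) by (apply Rmult_lt_0_compat; lra).
  assert (Hzi : (1 - t) / (1 - t / 2) <= / z).
  { apply Rle_trans with (/ (1 + t / 2)); [|apply Rinv_le_contravar; lra].
    apply div_le; [lra|]. rewrite Rmult_comm. apply le_div; [lra|]. nra. }
  assert (Hlow : P * B * (1 - t) <= gp).
  { eapply Rle_trans; [|apply Hgap].
    apply Rle_trans with (P * B * / z * (1 - t / 2)); [|apply Rmult_le_compat_r; lra].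
    rewrite (Rmult_assoc (P * B)). apply Rmult_le_compat_l; [lra|].
    apply (Rmult_le_compat_r (1 - t / 2)) in Hzi; [|lra].
    replace ((1 - t) / (1 - t / 2) * (1 - t / 2)) with (1 - t) in Hzi by (field; lra). exact Hzi. }
  assert (Hup : gp <= P * B * (1 + t)).
  { eapply Rle_trans; [apply Hgap|]. eapply Rle_trans; [apply Hphi|].
    apply Rmult_le_compat_l; lra. }
  apply Rle_trans with (2 * t * (P * B)).
  - apply Rabs_le_between.
    assert (P * B * (1 - t) <= P * B * rho <= P * B * (1 + t))
      by (split; apply Rmult_le_compat_l; lra). lra.
  - replace (2 * t * H * P) with (2 * t * (P * H)) by ring.
    apply Rmult_le_compat_l; [lra|]. apply Rmult_le_compat_l; lra.
Qed.

(** The two sequences agree in the bulk by [gaps_close_bulk].  For small [n] each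
    is separately small, because [gaps_dominated] is better than the majorant
    [root_ratio] by a power of [l / (n + 1)]. *)
Lemma gaps_close (n0 : nat) (d : R) : dominated_gaps n0 -> 0 < d -> exists L : nat,
  forall l n, (L <= l)%nat -> (n <= l)%nat ->
    Rabs (gaps phi n0 n - model_weight g phi1 l * negbin g n)
      <= d * phi1 (INR l) * root_ratio l n.
Proof.
  intros (C & HC & HD) Hd.
  pose proof (pr_Y _ _ _ _ _ HP) as HY.
  (* if [l / (n + 1) >= T], then [C * sqrt q <= d * q] for [q = root_ratio l n] *)
  set (T := Rmax 2 ((C / d) ^ 4)).
  destruct (gaps_close_bulk (2 * T) (Rmin (1 / 2) (d / (8 * T)))) as [L HL].
  - pose proof (Rmax_l 2 ((C / d) ^ 4)). unfold T; lra.
  - assert (2 <= T) by apply Rmax_l. split; [|apply Rle_lt_trans with (1 / 2); [apply Rmin_l|lra]].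
    apply Rmin_pos; [lra|]. apply Rdiv_lt_0_compat; lra.
  - assert (HT : 2 <= T) by apply Rmax_l. assert (HT' : (C / d) ^ 4 <= T) by apply Rmax_r.
    destruct (nfloor_ex (T * (INR n0 + 2) + Y)) as [L2 HL2]; [pose proof (pos_INR n0); nra|].
    exists (Nat.max L (S L2)). intros l n Hl Hn.
    assert (Hl2 : T * (INR n0 + 2) + Y <= INR l).
    { assert (INR (S L2) <= INR l) by (apply le_INR; lia). rewrite S_INR in *. lra. }
    pose proof (pos_INR n0) as Hn0p. pose proof (pos_INR n) as Hnp.
    assert (Hlp : 0 < INR l) by nra.
    assert (Hl0 : (0 < l)%nat) by (apply INR_lt; simpl; lra).
    assert (Hnl0 : (n0 <= l)%nat) by (apply INR_le; nra).
    pose proof (pr_1 _ _ _ _ _ HP (INR l) ltac:(nra)) as HPl.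
    pose proof (root_ratio_pos l n Hl0) as Hq.
    destruct (Rle_dec T (INR l / (INR n + 1))) as [Hfar|Hnear].
    + destruct (HD l n Hl0 Hnl0 Hn) as [[D1 D2] [D3 D4]].
      apply Rle_trans with (C * phi1 (INR l) * sqrt (root_ratio l n)).
      { apply Rabs_le_between. lra. }
      replace (d * phi1 (INR l) * root_ratio l n) with
        (phi1 (INR l) * (d * (sqrt (root_ratio l n) * sqrt (root_ratio l n))))
        by (rewrite sqrt_sqrt by lra; ring).
      replace (C * phi1 (INR l) * sqrt (root_ratio l n))
        with (phi1 (INR l) * (C * sqrt (root_ratio l n))) by ring.
      apply Rmult_le_compat_l; [lra|].
      assert (Hs : C / d <= sqrt (root_ratio l n)).
      { assert (HCd : 0 < C / d) by (apply Rdiv_lt_0_compat; lra).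
        unfold root_ratio. rewrite <- (sqrt_square (C / d)) by lra. apply sqrt_le_1_alt.
        rewrite <- (sqrt_square (C / d * (C / d))) by nra. apply sqrt_le_1_alt.
        eapply Rle_trans; [|exact Hfar]. eapply Rle_trans; [|exact HT']. right; ring. }
      apply (proj1 (Rle_div_l _ _ _ Hd)) in Hs. nra.
    + assert (Hn1 : INR n0 + 1 < INR n).
      { apply Rnot_le_lt in Hnear. apply (proj1 (Rlt_div_l _ _ (INR n + 1) ltac:(lra))) in Hnear. nra. }
      assert (Hn2 : (0 < n)%nat) by (apply INR_lt; simpl; lra).
      eapply Rle_trans; [apply HL; auto; try lia|].
      * apply INR_le; lra.
      * apply div_le; [lra|]. apply Rnot_le_lt in Hnear.
        apply (proj1 (Rlt_div_l _ _ (INR n + 1) ltac:(lra))) in Hnear. nra.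
      * pose proof (root_ratio_ge_half l n Hl0 Hn) as Hh.
        pose proof (Rmin_r (1 / 2) (d / (8 * T))) as Hm.
        set (t := Rmin (1 / 2) (d / (8 * T))) in *.
        apply Rle_trans with (d / 2 * phi1 (INR l)).
        -- apply Rmult_le_compat_r; [lra|].
           apply Rle_trans with (2 * (d / (8 * T)) * (2 * T)); [|right; field; lra].
           apply Rmult_le_compat_r; lra.
        -- assert (0 <= d * phi1 (INR l)) by (apply Rmult_le_pos; lra). nra.
Qed.

End Comparison.

(** * The main term *)

Lemma tri_abs_le l f g h f' g' h' :
  (forall i, (i <= l)%nat -> Rabs (f i) <= f' i) ->
  (forall i, (i <= l)%nat -> Rabs (g i) <= g' i) ->
  (forall i, (i <= l)%nat -> Rabs (h i) <= h' i) ->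
  Rabs (tri l f g h) <= tri l f' g' h'.
Proof.
  intros Hf Hg Hh. unfold tri. apply Rsum_abs_le; intros i Hi.
  apply Rsum_abs_le; intros j Hj. apply Rsum_abs_le; intros k Hk.
  destruct (Nat.eq_dec (i + j + k) l); [|rewrite Rabs_R0; lra].
  rewrite !Rabs_mult. specialize (Hf i ltac:(lia)). specialize (Hg j ltac:(lia)).
  specialize (Hh k ltac:(lia)).
  apply Rmult_le_compat; auto using Rabs_pos.
  - apply Rmult_le_pos; apply Rabs_pos.
  - apply Rmult_le_compat; auto using Rabs_pos.
Qed.

Lemma tri_scal l a b c f g h :
  tri l (fun i => a * f i) (fun i => b * g i) (fun i => c * h i) = a * b * c * tri l f g h.
Proof.
  unfold tri. rewrite <- Rsum_scal. apply Rsum_ext; intros i _.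
  rewrite <- Rsum_scal. apply Rsum_ext; intros j _.
  rewrite <- Rsum_scal. apply Rsum_ext; intros k _.
  destruct (Nat.eq_dec (i + j + k) l); ring.
Qed.

Lemma negbin_asymptotic_eventually s t : 0 < s -> 0 < t -> exists L, forall l, (L <= l)%nat ->
  Rabs (negbin s l * Gamma s / Rpower (INR l) (s - 1) - 1) <= t.
Proof.
  intros Hs Ht. pose proof (negbin_asymptotic s Hs) as HA. apply is_lim_seq_spec in HA.
  assert (HN : exists N1, forall n, (N1 <= n)%nat ->
    Rabs (negbin s (S n) * Gamma s / Rpower (INR (S n)) (s - 1) - 1) < t)
    by exact (HA (mkposreal t Ht)).
  destruct HN as [N HN]. exists (S N). intros l Hl.
  specialize (HN (l - 1)%nat ltac:(lia)). replace (S (l - 1)) with l in HN by lia. lra.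
Qed.

(** Up to a constant [root_ratio l n] is at most [sqrt l * negbin (1 / 2) n], and
    the convolution of three copies of [negbin (1 / 2)] is [negbin (3 / 2)]. *)
Lemma tri_root_ratio : exists K L, 0 < K /\ forall l, (L <= l)%nat ->
  tri l (root_ratio l) (root_ratio l) (root_ratio l) <= K * INR l ^ 2.
Proof.
  pose proof (Gamma_pos (1 / 2) ltac:(lra)) as G1.
  pose proof (Gamma_pos (1 / 2 + 1 / 2 + 1 / 2) ltac:(lra)) as G3.
  set (c := 1 + 3 / 2 * Gamma (1 / 2)).
  destruct (negbin_asymptotic_eventually (1 / 2 + 1 / 2 + 1 / 2) 1 ltac:(lra) ltac:(lra)) as [L HL].
  exists (c ^ 3 * (2 / Gamma (1 / 2 + 1 / 2 + 1 / 2))), (Nat.max 1 L). split.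
  { apply Rmult_lt_0_compat; [apply pow_lt; unfold c; lra|apply Rdiv_lt_0_compat; lra]. }
  intros l Hl. specialize (HL l ltac:(lia)).
  assert (Hl1 : 1 <= INR l) by (apply (le_INR 1); lia).
  assert (Hb : forall n, (n <= l)%nat -> Rabs (root_ratio l n) <= c * sqrt (INR l) * negbin (1 / 2) n).
  { intros n Hn. rewrite Rabs_right by (apply Rle_ge, sqrt_pos).
    unfold root_ratio. rewrite sqrt_div_alt by (pose proof (pos_INR n); lra).
    assert (Hs : 0 < sqrt (INR l)) by (apply sqrt_lt_R0; lra).
    replace (c * sqrt (INR l) * negbin (1 / 2) n) with (sqrt (INR l) * (c * negbin (1 / 2) n)) by ring.
    apply Rmult_le_compat_l; [lra|].
    destruct (Nat.eq_dec n 0) as [->|Hn0].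
    - simpl. rewrite Rplus_0_l, sqrt_1. unfold c. lra.
    - assert (Hn1 : 1 <= INR n) by (apply (le_INR 1); lia).
      pose proof (negbin_lower (1 / 2) n ltac:(lra) ltac:(lia)) as NL.
      replace (1 / 2 - 1) with (- / 2) in NL by field.
      rewrite Rpower_Ropp, Rpower_sqrt in NL by lra.
      assert (Hsn : 0 < sqrt (INR n)) by (apply sqrt_lt_R0; lra).
      assert (Hi : / sqrt (INR n + 1) <= / sqrt (INR n)).
      { apply Rinv_le_contravar; auto. apply sqrt_le_1; lra. }
      assert (H23 : 2 / 3 <= INR n / (INR n + 1 / 2)) by (apply le_div; lra).
      assert (0 < / sqrt (INR n)) by (apply Rinv_0_lt_compat; auto).
      assert (2 / 3 * / sqrt (INR n) <= negbin (1 / 2) n * Gamma (1 / 2)).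
      { eapply Rle_trans; [|exact NL]. apply Rmult_le_compat_r; lra. }
      unfold c. nra. }
  eapply Rle_trans; [apply Rle_abs|].
  eapply Rle_trans; [apply tri_abs_le; exact Hb|].
  rewrite tri_scal, tri_negbin. set (s := 1 / 2 + 1 / 2 + 1 / 2) in *.
  apply Rabs_le_between in HL.
  assert (E : Rpower (INR l) (s - 1) = sqrt (INR l)).
  { rewrite <- Rpower_sqrt by lra. f_equal. unfold s. field. }
  rewrite E in HL. assert (Hs : 0 < sqrt (INR l)) by (apply sqrt_lt_R0; lra).
  assert (Hn : negbin s l <= 2 / Gamma s * sqrt (INR l)).
  { apply Rmult_le_reg_r with (Gamma s / sqrt (INR l)); [apply Rdiv_lt_0_compat; auto|].
    replace (2 / Gamma s * sqrt (INR l) * (Gamma s / sqrt (INR l))) with 2 by (field; lra).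
    unfold Rdiv in *. lra. }
  assert (Hc : 0 < c) by (unfold c; lra).
  assert (Ess : sqrt (INR l) * sqrt (INR l) = INR l) by (apply sqrt_sqrt; lra).
  set (r := sqrt (INR l)) in *. rewrite <- Ess.
  replace (c ^ 3 * (2 / Gamma s) * (r * r) ^ 2) with (c * r * (c * r) * (c * r) * (2 / Gamma s * r)) by ring.
  apply Rmult_le_compat_l; [|exact Hn].
  apply Rmult_le_pos; nra.
Qed.

Section MainTerm.

Variables (g1 g2 g3 : R) (p1 p1' p1'' p2 p2' p2'' p3 p3' p3'' : R -> R) (Y1 Y2 Y3 : R).
Hypothesis Hg1 : 3 / 4 < g1 <= 1.
Hypothesis Hg2 : 3 / 4 < g2 <= 1.
Hypothesis Hg3 : 3 / 4 < g3 <= 1.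
Hypothesis HP1 : profile g1 p1 p1' p1'' Y1.
Hypothesis HP2 : profile g2 p2 p2' p2'' Y2.
Hypothesis HP3 : profile g3 p3 p3' p3'' Y3.
Variables (n1 n2 n3 : nat).
Hypothesis HD1 : dominated_gaps g1 p1 p1' n1.
Hypothesis HD2 : dominated_gaps g2 p2 p2' n2.
Hypothesis HD3 : dominated_gaps g3 p3 p3' n3.

Let order (l : nat) : R := INR l ^ 2 * p1' (INR l) * p2' (INR l) * p3' (INR l).

Lemma tri_gaps_model eps : 0 < eps -> exists L : nat, forall l, (L <= l)%nat ->
  Rabs (tri l (gaps p1 n1) (gaps p2 n2) (gaps p3 n3)
     - tri l (fun n => model_weight g1 p1' l * negbin g1 n)
         (fun n => model_weight g2 p2' l * negbin g2 n)
         (fun n => model_weight g3 p3' l * negbin g3 n)) <= eps * order l.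
Proof.
  intros He. destruct tri_root_ratio as (K & LK & HK & HLK).
  pose proof HD1 as (C1 & HC1 & D1). pose proof HD2 as (C2 & HC2 & D2). pose proof HD3 as (C3 & HC3 & D3).
  set (C := 2 * (C1 + C2 + C3)).
  set (d := eps / (3 * C ^ 2 * K)).
  assert (HC : 0 < C) by (unfold C; lra).
  assert (HCK : 0 < 3 * C ^ 2 * K) by (apply Rmult_lt_0_compat; [nra|auto]).
  assert (Hd : 0 < d) by (apply Rdiv_lt_0_compat; auto).
  destruct (gaps_close g1 p1 p1' p1'' Y1 Hg1 HP1 n1 d HD1 Hd) as [L1 HL1].
  destruct (gaps_close g2 p2 p2' p2'' Y2 Hg2 HP2 n2 d HD2 Hd) as [L2 HL2].
  destruct (gaps_close g3 p3 p3' p3'' Y3 Hg3 HP3 n3 d HD3 Hd) as [L3 HL3].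
  destruct (nfloor_ex (Rmax 0 (Rmax Y1 (Rmax Y2 Y3)))) as [LY HLY]; [apply Rmax_l|].
  exists (S (LY + n1 + n2 + n3 + LK + L1 + L2 + L3)). intros l Hl.
  assert (HlY : INR LY + 1 <= INR l) by (rewrite <- S_INR; apply le_INR; lia).
  revert HLY. intros_max. intros HLY.
  pose proof (pr_1 _ _ _ _ _ HP1 (INR l) ltac:(lra)) as Q1.
  pose proof (pr_1 _ _ _ _ _ HP2 (INR l) ltac:(lra)) as Q2.
  pose proof (pr_1 _ _ _ _ _ HP3 (INR l) ltac:(lra)) as Q3.
  specialize (HLK l ltac:(lia)).
  assert (Hsq : forall n, (n <= l)%nat -> sqrt (root_ratio l n) <= 2 * root_ratio l n).
  { intros n Hn. pose proof (root_ratio_ge_half l n ltac:(lia) Hn) as Hh.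
    assert (Hs2 : sqrt (root_ratio l n) * sqrt (root_ratio l n) = root_ratio l n) by (apply sqrt_sqrt; lra).
    destruct (Rle_dec (/ 2) (sqrt (root_ratio l n))); [nra|]. nra. }
  set (P1 := p1' (INR l)) in *. set (P2 := p2' (INR l)) in *. set (P3 := p3' (INR l)) in *.
  assert (Hwk : forall x y P Ck n, (n <= l)%nat -> 0 < P -> 0 < Ck <= C / 2 ->
     0 <= x <= Ck * P * sqrt (root_ratio l n) /\ 0 <= y <= Ck * P * sqrt (root_ratio l n) ->
     Rabs x <= C * P * root_ratio l n /\ Rabs y <= C * P * root_ratio l n).
  { intros x y P Ck n Hn HPp HCk [Hx Hy].
    assert (Ck * P * sqrt (root_ratio l n) <= C * P * root_ratio l n).
    { apply Rle_trans with (C / 2 * P * (2 * root_ratio l n)); [|right; field].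
      apply Rmult_le_compat; auto; [nra|apply sqrt_pos|]. apply Rmult_le_compat_r; lra. }
    rewrite !Rabs_right by lra. lra. }
  assert (B1 : forall n, (n <= l)%nat -> Rabs (gaps p1 n1 n) <= C * P1 * root_ratio l n /\
      Rabs (model_weight g1 p1' l * negbin g1 n) <= C * P1 * root_ratio l n).
  { intros n Hn. apply (Hwk _ _ _ C1); auto; [lra|unfold C; lra|apply D1; auto; lia]. }
  assert (B2 : forall n, (n <= l)%nat -> Rabs (gaps p2 n2 n) <= C * P2 * root_ratio l n /\
      Rabs (model_weight g2 p2' l * negbin g2 n) <= C * P2 * root_ratio l n).
  { intros n Hn. apply (Hwk _ _ _ C2); auto; [lra|unfold C; lra|apply D2; auto; lia]. }
  assert (B3 : forall n, (n <= l)%nat -> Rabs (gaps p3 n3 n) <= C * P3 * root_ratio l n /\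
      Rabs (model_weight g3 p3' l * negbin g3 n) <= C * P3 * root_ratio l n).
  { intros n Hn. apply (Hwk _ _ _ C3); auto; [lra|unfold C; lra|apply D3; auto; lia]. }
  assert (Htri : forall a b c f g h, 0 <= a * b * c ->
    (forall n, (n <= l)%nat -> Rabs (f n) <= a * root_ratio l n) ->
    (forall n, (n <= l)%nat -> Rabs (g n) <= b * root_ratio l n) ->
    (forall n, (n <= l)%nat -> Rabs (h n) <= c * root_ratio l n) ->
    Rabs (tri l f g h) <= a * b * c * (K * INR l ^ 2)).
  { intros a b c f g h Habc Hf Hg Hh. eapply Rle_trans; [apply (tri_abs_le l f g h _ _ _ Hf Hg Hh)|].
    rewrite tri_scal. apply Rmult_le_compat_l; auto. }
  assert (HPPP : 0 < P1 * P2 * P3) by (repeat apply Rmult_lt_0_compat; lra).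
  assert (HdC : 0 < d * C * C * (P1 * P2 * P3)) by (apply Rmult_lt_0_compat; [apply Rmult_lt_0_compat; [apply Rmult_lt_0_compat|]|]; auto).
  rewrite tri_telescope.
  eapply Rle_trans; [apply Rabs_triang|].
  eapply Rle_trans; [apply Rplus_le_compat_r, Rabs_triang|].
  apply Rle_trans with (d * P1 * (C * P2) * (C * P3) * (K * INR l ^ 2)
    + d * P2 * (C * P1) * (C * P3) * (K * INR l ^ 2) + d * P3 * (C * P1) * (C * P2) * (K * INR l ^ 2)).
  - apply Rplus_le_compat; [apply Rplus_le_compat|]; apply Htri; try nra.
    + intros n Hn. apply (HL1 l n); lia.
    + intros n Hn; apply B2; auto.
    + intros n Hn; apply B3; auto.
    + intros n Hn. apply (HL2 l n); lia.
    + intros n Hn; apply B1; auto.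
    + intros n Hn; apply B3; auto.
    + intros n Hn. apply (HL3 l n); lia.
    + intros n Hn; apply B1; auto.
    + intros n Hn; apply B2; auto.
  - unfold order. fold P1 P2 P3. right. unfold d. field. repeat split; try lra.
Qed.

(** For the model sequences the trilinear form is exactly the product of the
    weights with [negbin (g1 + g2 + g3) l]; its asymptotic formula produces the
    quotient of Gamma values. *)
Theorem tri_gaps_asymptotic eps : 0 < eps -> exists L : nat, forall l, (L <= l)%nat ->
  Rabs (tri l (gaps p1 n1) (gaps p2 n2) (gaps p3 n3)
     - Gamma g1 * Gamma g2 * Gamma g3 / Gamma (g1 + g2 + g3) * order l) <= eps * order l.
Proof.
  intros He. destruct (tri_gaps_model (eps / 2) ltac:(lra)) as [L1 HL1].
  pose proof (Gamma_pos g1 ltac:(lra)) as G1. pose proof (Gamma_pos g2 ltac:(lra)) as G2.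
  pose proof (Gamma_pos g3 ltac:(lra)) as G3. pose proof (Gamma_pos (g1 + g2 + g3) ltac:(lra)) as Gs.
  set (c := Gamma g1 * Gamma g2 * Gamma g3 / Gamma (g1 + g2 + g3)).
  assert (Hc : 0 < c) by (apply Rdiv_lt_0_compat; auto; repeat apply Rmult_lt_0_compat; auto).
  destruct (negbin_asymptotic_eventually (g1 + g2 + g3) (eps / 2 / c)) as [L2 HL2];
    [lra|apply Rdiv_lt_0_compat; lra|].
  destruct (nfloor_ex (Rmax 0 (Rmax Y1 (Rmax Y2 Y3)))) as [LY HLY]; [apply Rmax_l|].
  exists (S (LY + L1 + L2)). intros l Hl.
  assert (HlY : INR LY + 1 <= INR l) by (rewrite <- S_INR; apply le_INR; lia).
  revert HLY. intros_max. intros HLY.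
  pose proof (pr_1 _ _ _ _ _ HP1 (INR l) ltac:(lra)) as Q1.
  pose proof (pr_1 _ _ _ _ _ HP2 (INR l) ltac:(lra)) as Q2.
  pose proof (pr_1 _ _ _ _ _ HP3 (INR l) ltac:(lra)) as Q3.
  specialize (HL1 l ltac:(lia)). specialize (HL2 l ltac:(lia)).
  assert (Hl0 : 0 < INR l) by lra.
  rewrite tri_scal, tri_negbin in HL1.
  set (s := g1 + g2 + g3) in *.
  set (rho := negbin s l * Gamma s / Rpower (INR l) (s - 1)) in *.
  assert (Hord : 0 < order l).
  { unfold order. repeat apply Rmult_lt_0_compat; try lra. }
  assert (E : model_weight g1 p1' l * model_weight g2 p2' l * model_weight g3 p3' l * negbin s l
    = c * order l * rho).
  { unfold model_weight, order, c, rho.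
    assert (E : Rpower (INR l) (1 - g1) * Rpower (INR l) (1 - g2) * Rpower (INR l) (1 - g3)
      * Rpower (INR l) (s - 1) = INR l ^ 2).
    { rewrite <- !Rpower_plus. rewrite <- Rpower_pow by auto. f_equal. unfold s. simpl. ring. }
    rewrite <- E. assert (0 < Rpower (INR l) (s - 1)) by apply exp_pos. field. lra. }
  rewrite E in HL1.
  replace (_ - c * order l) with ((tri l (gaps p1 n1) (gaps p2 n2) (gaps p3 n3) - c * order l * rho)
     + c * order l * (rho - 1)) by ring.
  eapply Rle_trans; [apply Rabs_triang|].
  rewrite (Rabs_mult (c * order l)), (Rabs_right (c * order l)) by nra.
  assert (c * order l * Rabs (rho - 1) <= c * order l * (eps / 2 / c)) by (apply Rmult_le_compat_l; nra).
  replace (c * order l * (eps / 2 / c)) with (eps / 2 * order l) in * by (field; lra). lra.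
Qed.

End MainTerm.

(** * Sawtooth sums along the inverse function *)

Lemma Rpower_split_div a x y : 0 < x -> 0 < y -> Rpower (y / x) a = Rpower y a * Rpower x (- a).
Proof.
  intros Hx Hy. unfold Rdiv. rewrite <- Rpower_mult_distr by (auto; apply Rinv_0_lt_compat; auto).
  f_equal. unfold Rpower. rewrite ln_Rinv by auto. f_equal. ring.
Qed.

Lemma profile_powers g phi phi1 phi2 Y eps : 0 < eps -> profile g phi phi1 phi2 Y ->
  exists K Y1, 1 <= K /\ Y <= Y1 /\ forall y, Y1 <= y ->
    / K * Rpower y (g - 1 - eps) <= phi1 y <= K * Rpower y (g - 1 + eps) /\
    phi y <= K * Rpower y (g + eps).
Proof.
  intros He HP. pose proof (pr_Y _ _ _ _ _ HP) as HY.
  destruct (profile_regular g phi phi1 phi2 Y eps He HP) as (Y1 & HY1 & HR).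
  destruct (is_lim_eventually _ _ eps (pr_lim1 _ _ _ _ _ HP) He) as [M HM].
  set (X := Rmax Y1 M). assert (HX : Y1 <= X /\ M <= X) by (split; [apply Rmax_l|apply Rmax_r]).
  pose proof (pr_1 _ _ _ _ _ HP X ltac:(lra)) as HpX.
  pose proof (pr_pos _ _ _ _ _ HP X ltac:(lra)) as HposX.
  set (A := phi1 X * Rpower X (- (g - 1 - eps))).
  set (B := phi1 X * Rpower X (- (g - 1 + eps))).
  set (D := phi X * Rpower X (- (g + eps))).
  assert (HA : 0 < A) by (apply Rmult_lt_0_compat; [lra|apply exp_pos]).
  assert (HB : 0 < B) by (apply Rmult_lt_0_compat; [lra|apply exp_pos]).
  assert (HDp : 0 < D) by (apply Rmult_lt_0_compat; [lra|apply exp_pos]).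
  assert (HAi : 0 < / A) by (apply Rinv_0_lt_compat; auto).
  exists (1 + / A + B + D), X. split; [lra|]. split; [lra|]. intros y Hy.
  destruct (HR X y ltac:(lra) Hy) as [R1 R2].
  rewrite Rpower_split_div in R1, R2 by lra.
  assert (R3 : phi y <= phi X * Rpower (y / X) (g + eps)).
  { apply (growth_le phi phi1 (g + eps) X); try lra. intros t Ht.
    specialize (HM t ltac:(lra)). pose proof (pr_pos _ _ _ _ _ HP t ltac:(lra)).
    refine (conj _ (conj _ _)); [lra|apply (pr_d1 _ _ _ _ _ HP); lra|].
    replace (t * phi1 t) with (t * phi1 t / phi t * phi t) by (field; lra).
    apply Rmult_le_compat_r; lra. }
  rewrite Rpower_split_div in R3 by lra.
  pose proof (exp_pos ((g - 1 - eps) * ln y)) as P1. pose proof (exp_pos ((g - 1 + eps) * ln y)) as P2.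
  pose proof (exp_pos ((g + eps) * ln y)) as P3.
  fold (Rpower y (g - 1 - eps)) in P1. fold (Rpower y (g - 1 + eps)) in P2.
  fold (Rpower y (g + eps)) in P3.
  repeat split.
  - apply Rle_trans with (A * Rpower y (g - 1 - eps)); [|unfold A; lra].
    apply Rmult_le_compat_r; [lra|]. apply Rle_trans with (/ / A); [apply Rinv_le_contravar; lra|rewrite Rinv_inv; lra].
  - apply Rle_trans with (B * Rpower y (g - 1 + eps)); [unfold B; lra|].
    apply Rmult_le_compat_r; lra.
  - apply Rle_trans with (D * Rpower y (g + eps)); [unfold D; lra|].
    apply Rmult_le_compat_r; lra.
Qed.

Lemma profile_second_gap g phi phi1 phi2 Y x m : profile g phi phi1 phi2 Y -> Y <= x ->
  (forall z, x <= z <= x + 2 -> phi2 z <= - m) ->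
  (phi (x + 2) - phi (x + 1)) - (phi (x + 1) - phi x) <= - m.
Proof.
  intros HP Hx Hm.
  destruct (MVT_cor2 (fun t => phi (t + 1) - phi t) (fun t => phi1 (t + 1) - phi1 t) x (x + 1))
    as (z & Hz & Hzz); [lra| |].
  - intros t Ht. apply is_derive_Reals.
    pose proof (pr_d1 _ _ _ _ _ HP (t + 1) ltac:(lra)) as D1.
    pose proof (pr_d1 _ _ _ _ _ HP t ltac:(lra)) as D0.
    apply @is_derive_minus; [|exact D0].
    evar_last; [apply (is_derive_comp phi (fun t => t + 1)); [exact D1|]|].
    + apply @is_derive_plus; [apply @is_derive_id|apply @is_derive_const].
    + unfold scal, plus, one, zero; simpl; unfold mult; simpl. ring.
  - destruct (MVT_cor2 phi1 phi2 z (z + 1)) as (w & Hw & Hww); [lra| |].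
    + intros t Ht. apply is_derive_Reals, (pr_d2 _ _ _ _ _ HP); lra.
    + specialize (Hm w ltac:(lra)). replace (x + 1 + 1) with (x + 2) in Hz by ring.
      rewrite Hz, Hw. lra.
Qed.

Section TwistedProfile.

Variables (g : R) (phi phi1 phi2 : R -> R) (Y kap : R).
Hypothesis Hg : 3 / 4 < g <= 1.
Hypothesis HP : profile g phi phi1 phi2 Y.
Hypothesis Hkap : 0 < kap < 1.
Hypothesis Hkap1 : 2 * kap + g / 2 < 1.
Hypothesis Hkap2 : kap < g / 2.

(** [twisted_saw_bound] on one dyadic block, with about [X ^ kap] harmonics.  The
    total variation of the increments is about [X ^ (g - 1)] and their second
    differences are about [X ^ (g - 2)], so the bounds are [X ^ (1 - kap)],
    [X ^ (g / 2 + kap)] and [X ^ (1 - g / 2)], up to small powers of [X]. *)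
Lemma twisted_block : exists C A : R, 0 < C /\ 1 <= A /\ Y <= A /\ forall (a N : nat) xi al,
  A <= INR a -> (N <= a)%nat ->
  Rabs (Rsum (fun i => saw (phi (INR (a + i))) * cos (xi * INR i + al)) N)
    <= C * Rpower (INR a) (1 - kap).
Proof.
  set (eps := Rmin ((1 - 2 * kap - g / 2) / 2) (Rmin (g / 2 - kap) (1 / 2))).
  assert (He : 0 < eps) by (apply Rmin_pos; [lra|apply Rmin_pos; lra]).
  assert (He1 : 2 * kap + g / 2 + 2 * eps <= 1).
  { pose proof (Rmin_l ((1 - 2 * kap - g / 2) / 2) (Rmin (g / 2 - kap) (1 / 2))).
    unfold eps; lra. }
  assert (He2 : kap + eps <= g / 2 /\ eps <= 1 / 2).
  { pose proof (Rmin_r ((1 - 2 * kap - g / 2) / 2) (Rmin (g / 2 - kap) (1 / 2))).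
    pose proof (Rmin_l (g / 2 - kap) (1 / 2)).
    unfold eps; lra. }
  clearbody eps.
  destruct (profile_powers g phi phi1 phi2 Y eps He HP) as (K & Y1 & HK & HY1 & HKb).
  destruct (pr_conv _ _ _ _ _ HP eps He) as [Y2 HY2].
  pose proof (pr_Y _ _ _ _ _ HP) as HY.
  set (c27 := 27 * K).
  exists (4 + 69 * sqrt c27 * (2 * K + 8)), (Rmax Y1 Y2).
  assert (Hc27 : 0 < sqrt c27) by (apply sqrt_lt_R0; unfold c27; lra).
  intros_max. split; [apply Rplus_lt_0_compat; [lra|apply Rmult_lt_0_compat; lra]|].
  split; [lra|]. split; [lra|].
  intros a N xi al Ha HN.
  set (X := INR a) in *.
  assert (HNX : INR N <= X) by (apply le_INR; auto).
  set (mu := Rpower X (g - 2 - 2 * eps) / c27).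
  set (V := K * Rpower X (g - 1 + eps)).
  assert (HXp : 0 < Rpower X (g - 2 - 2 * eps)) by apply exp_pos.
  assert (Hmu : 0 < mu) by (apply Rdiv_lt_0_compat; [auto|unfold c27; lra]).
  assert (HV : 0 <= V) by (apply Rmult_le_pos; [lra|left; apply exp_pos]).
  (* [L] of order [X ^ kap] is what makes [2 N / L] of order [X ^ (1 - kap)] *)
  destruct (nfloor_ex (Rpower X kap)) as [L HL]; [left; apply exp_pos|].
  assert (HXk : 1 <= Rpower X kap).
  { rewrite <- (Rpower_O X) by lra. apply Rle_Rpower; lra. }
  assert (HL0 : (0 < L)%nat) by (apply INR_lt; simpl; lra).
  assert (HL1 : 1 <= INR L) by (apply (le_INR 1); lia).
  assert (Hphi2 : forall z, X <= z <= 2 * X -> phi2 z <= - mu).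
  { intros z Hz. specialize (HY2 z ltac:(lra)). destruct (HKb z ltac:(lra)) as [[B1 _] _].
    assert (E : mu <= phi1 z * Rpower z (- 1 - eps)); [|lra].
    apply Rle_trans with (/ K * Rpower z (g - 1 - eps) * Rpower z (- 1 - eps)).
    2:{ apply Rmult_le_compat_r; [left; apply exp_pos|auto]. }
    rewrite Rmult_assoc, <- Rpower_plus.
    replace (g - 1 - eps + (- 1 - eps)) with (g - 2 - 2 * eps) by ring.
    assert (Hz3 : / 27 * Rpower X (g - 2 - 2 * eps) <= Rpower z (g - 2 - 2 * eps)).
    { assert (Hb : 2 - g + 2 * eps <= 3) by lra.
      set (b := 2 - g + 2 * eps) in *. replace (g - 2 - 2 * eps) with (- b) by (unfold b; ring).
      rewrite !Rpower_Ropp, <- Rinv_mult. apply Rinv_le_contravar; [apply exp_pos|].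
      apply Rle_trans with (Rpower (3 * X) b).
      - apply Rle_Rpower_l; unfold b; lra.
      - rewrite <- Rpower_mult_distr by lra. apply Rmult_le_compat_r; [left; apply exp_pos|].
        apply Rle_trans with (Rpower 3 (INR 3)); [apply Rle_Rpower; simpl; lra|].
        rewrite Rpower_pow by lra. lra. }
    apply Rle_trans with (/ K * (/ 27 * Rpower X (g - 2 - 2 * eps))).
    - unfold mu, c27. right. field. lra.
    - apply Rmult_le_compat_l; [left; apply Rinv_0_lt_compat; lra|auto]. }
  assert (Hc : forall n, (S n < N)%nat ->
    phi (INR (a + S (S n))) - phi (INR (a + S n)) <= phi (INR (a + S n)) - phi (INR (a + n)) - mu).
  { intros n Hn. rewrite !plus_INR, !S_INR. fold X.
    assert (Hn2 : INR n + 2 <= INR N).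
    { replace (INR n + 2) with (INR (S (S n))) by (rewrite !S_INR; ring). apply le_INR; lia. }
    pose proof (pos_INR n) as Hn0.
    pose proof (profile_second_gap _ _ _ _ _ (X + INR n) mu HP ltac:(lra)) as G.
    replace (X + (INR n + 1 + 1)) with (X + INR n + 2) by ring.
    replace (X + (INR n + 1)) with (X + INR n + 1) by ring.
    assert (G' : forall z, X + INR n <= z <= X + INR n + 2 -> phi2 z <= - mu)
      by (intros; apply Hphi2; lra). specialize (G G'). lra. }
  assert (Hvar : forall n m, (n < N)%nat -> (m < N)%nat ->
    (phi (INR (a + S n)) - phi (INR (a + n))) - (phi (INR (a + S m)) - phi (INR (a + m))) <= V).
  { intros n k Hn Hk. rewrite !plus_INR, !S_INR. fold X.
    pose proof (pos_INR n) as Hn0. pose proof (pos_INR k) as Hk0.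
    destruct (profile_gap _ _ _ _ _ (X + INR n) HP ltac:(lra)) as [_ G1].
    destruct (profile_gap _ _ _ _ _ (X + INR k) HP ltac:(lra)) as [G2 _].
    pose proof (pr_1 _ _ _ _ _ HP (X + INR k + 1) ltac:(lra)).
    pose proof (profile_phi1_decreasing _ _ _ _ _ X (X + INR n) HP ltac:(lra) ltac:(lra)).
    destruct (HKb X ltac:(lra)) as [[_ B2] _]. fold V in B2.
    replace (X + (INR n + 1)) with (X + INR n + 1) by ring.
    replace (X + (INR k + 1)) with (X + INR k + 1) by ring. lra. }
  assert (H9 : INR (L * L) * mu <= 9).
  { rewrite mult_INR. apply Rle_trans with (Rpower X kap * Rpower X kap * Rpower X (g - 2 - 2 * eps)).
    - apply Rmult_le_compat; [nra|lra|apply Rmult_le_compat; lra|].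
      unfold mu. apply div_le; [unfold c27; lra|]. unfold c27; nra.
    - rewrite <- !Rpower_plus. apply Rle_trans with (Rpower X 0).
      + apply Rle_Rpower; lra.
      + rewrite Rpower_O; lra. }
  pose proof (twisted_saw_bound (fun n => phi (INR (a + n))) N mu V Hmu HV Hc Hvar L xi al HL0 H9) as T.
  eapply Rle_trans; [exact T|].
  (* the three exponents are at most [1 - kap] *)
  set (Z := Rpower X (1 - kap)).
  assert (HZ : 0 < Z) by apply exp_pos.
  assert (T1 : 2 * INR N / INR L <= 4 * Z).
  { apply div_le; [lra|].
    assert (EX : X = Z * Rpower X kap).
    { unfold Z. rewrite <- Rpower_plus. replace (1 - kap + kap) with 1 by ring. rewrite Rpower_1; lra. }
    assert (Z * Rpower X kap <= Z * (2 * INR L)) by (apply Rmult_le_compat_l; lra). lra. }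
  assert (E1 : / sqrt mu = sqrt c27 * Rpower X (1 - g / 2 + eps)).
  { unfold mu. rewrite sqrt_div_alt by (unfold c27; lra).
    rewrite <- Rpower_sqrt by auto. rewrite Rpower_mult.
    replace ((g - 2 - 2 * eps) * / 2) with (- (1 - g / 2 + eps)) by field.
    rewrite Rpower_Ropp. assert (0 < Rpower X (1 - g / 2 + eps)) by apply exp_pos.
    field. lra. }
  assert (T2 : Rpower X (1 - g / 2 + eps) <= Z) by (apply Rle_Rpower; lra).
  assert (T3 : Rpower X (1 - g / 2 + eps) * (V * INR L) <= K * Z).
  { apply Rle_trans with (Rpower X (1 - g / 2 + eps) * (V * Rpower X kap)).
    - apply Rmult_le_compat_l; [left; apply exp_pos|]. apply Rmult_le_compat_l; lra.
    - unfold V. replace (_ * (_ * _ * _)) with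
        (K * (Rpower X (1 - g / 2 + eps) * Rpower X (g - 1 + eps) * Rpower X kap)) by ring.
      apply Rmult_le_compat_l; [lra|]. rewrite <- !Rpower_plus. apply Rle_Rpower; lra. }
  unfold Rdiv at 2. rewrite E1.
  replace (69 * (sqrt c27 * Rpower X (1 - g / 2 + eps)) * (2 * V * INR L + 8))
    with (69 * sqrt c27 * (2 * (Rpower X (1 - g / 2 + eps) * (V * INR L)) + 8 * Rpower X (1 - g / 2 + eps)))
    by ring.
  replace ((4 + 69 * sqrt c27 * (2 * K + 8)) * Z)
    with (4 * Z + 69 * sqrt c27 * (2 * (K * Z) + 8 * Z)) by ring.
  apply Rplus_le_compat; auto. apply Rmult_le_compat_l; lra.
Qed.

(** Remove the upper half of the range as one block and use induction; the
    resulting geometric series converges because [1 - kap > 0]. *)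
Lemma twisted_range : exists C, 0 < C /\ forall (n0 N : nat) xi al, (n0 <= N)%nat -> (0 < N)%nat ->
  Rabs (Rsum (fun i => saw (phi (INR (n0 + i))) * cos (xi * INR (n0 + i) + al)) (N - n0))
    <= C * Rpower (INR N) (1 - kap).
Proof.
  destruct twisted_block as (C & A & HC & HA & HAY & HB).
  (* halving a number [N >= 3] upwards leaves at most [2 N / 3] *)
  set (r := Rpower (2 / 3) (1 - kap)).
  assert (Hr : 0 < r < 1).
  { split; [apply exp_pos|]. unfold r, Rpower.
    apply Rlt_le_trans with (exp 0); [apply exp_increasing|rewrite exp_0; lra].
    assert (ln (2 / 3) < 0) by (rewrite <- ln_1; apply ln_increasing; lra). nra. }
  (* solves [(C' + C) r <= C'] and covers the initial range trivially *)
  set (C' := C + 2 * A + 3 + C * r / (1 - r)).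
  assert (HCr : 0 < C * r / (1 - r)) by (apply Rdiv_lt_0_compat; [apply Rmult_lt_0_compat|]; lra).
  assert (HC' : C + 2 * A + 3 <= C' /\ C * r / (1 - r) <= C') by (unfold C'; lra).
  exists C'. split; [lra|].
  assert (Hs : forall y, Rabs (saw y) <= 1).
  { intros y. pose proof (ceiling_bounds y). unfold saw. apply Rabs_le_between. lra. }
  intros n0 N. induction N as [N IH] using lt_wf_ind. intros xi al Hn0 HN.
  assert (HN1 : 1 <= INR N) by (apply (le_INR 1); lia).
  assert (Htriv : Rabs (Rsum (fun i => saw (phi (INR (n0 + i))) * cos (xi * INR (n0 + i) + al)) (N - n0))
    <= INR N).
  { apply Rle_trans with (INR (N - n0)); [|apply le_INR; lia].
    rewrite <- (Rmult_1_r (INR (N - n0))), <- Rsum_const. apply Rsum_abs_le. intros i _.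
    rewrite Rabs_mult. assert (Rabs (cos (xi * INR (n0 + i) + al)) <= 1) by (apply Rabs_le_between, COS_bound).
    pose proof (Hs (phi (INR (n0 + i)))).
    pose proof (Rabs_pos (cos (xi * INR (n0 + i) + al))). nra. }
  assert (HNp : 1 <= Rpower (INR N) (1 - kap)).
  { apply Rle_trans with (Rpower (INR N) 0); [rewrite Rpower_O; lra|]. apply Rle_Rpower; lra. }
  destruct (Rle_dec (INR N) (2 * A + 3)) as [Hsmall|Hbig].
  { apply Rle_trans with (C' * 1); [lra|]. apply Rmult_le_compat_l; lra. }
  apply Rnot_le_lt in Hbig.
  set (M := (N - N / 2)%nat).
  pose proof (Nat.div_mod_eq N 2) as Hdm. pose proof (Nat.mod_upper_bound N 2 ltac:(lia)) as Hmu.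
  assert (HM : (2 * M = N \/ 2 * M = N + 1)%nat) by (unfold M; lia).
  assert (HMr : INR N <= 2 * INR M <= INR N + 1).
  { destruct HM as [HM|HM]; apply (f_equal INR) in HM; rewrite mult_INR, ?plus_INR in HM; simpl in HM; lra. }
  assert (HN3 : (3 <= N)%nat) by (apply INR_le; simpl; lra).
  assert (HMN : Rpower (INR M) (1 - kap) <= r * Rpower (INR N) (1 - kap)).
  { unfold r. rewrite Rpower_mult_distr by lra. apply Rle_Rpower_l; [lra|].
    lra. }
  assert (Hgoal : (C' + C) * Rpower (INR M) (1 - kap) <= C' * Rpower (INR N) (1 - kap)).
  { apply Rle_trans with ((C' + C) * r * Rpower (INR N) (1 - kap)).
    - rewrite Rmult_assoc. apply Rmult_le_compat_l; [lra|auto].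
    - apply Rmult_le_compat_r; [lra|].
      assert (C * r <= C' * (1 - r)); [|lra].
      apply Rle_trans with (C * r / (1 - r) * (1 - r)); [right; field; lra|].
      apply Rmult_le_compat_r; lra. }
  assert (HBlock : forall a k xi al, (M <= a)%nat -> (a + k = N)%nat ->
     Rabs (Rsum (fun i => saw (phi (INR (a + i))) * cos (xi * INR (a + i) + al)) k)
     <= C * Rpower (INR N) (1 - kap)).
  { intros a k xi' al' Ha Hk.
    assert (Ha' : INR M <= INR a) by (apply le_INR; auto).
    rewrite (Rsum_ext _ (fun i => saw (phi (INR (a + i))) * cos (xi' * INR i + (xi' * INR a + al')))).
    - eapply Rle_trans; [apply HB; [lra|lia]|].
      apply Rmult_le_compat_l; [lra|]. apply Rle_Rpower_l; [lra|]. split; [lra|].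
      apply le_INR; lia.
    - intros i _. rewrite plus_INR. do 2 f_equal. ring. }
  destruct (le_dec n0 M) as [HnM|HnM].
  - rewrite (Rsum_split_le _ (N - n0) (M - n0)) by lia.
    eapply Rle_trans; [apply Rabs_triang|]. eapply Rle_trans; [|exact Hgoal].
    rewrite Rmult_plus_distr_r. apply Rplus_le_compat.
    + apply IH; lia.
    + rewrite (Rsum_ext _ (fun i => saw (phi (INR (M + i))) * cos (xi * INR i + (xi * INR M + al)))).
      * apply HB; [lra|lia].
      * intros i _. replace (n0 + (M - n0 + i))%nat with (M + i)%nat by lia.
        rewrite plus_INR. do 2 f_equal. ring.
  - eapply Rle_trans; [apply HBlock; lia|].
    apply Rmult_le_compat_r; lra.
Qed.

End TwistedProfile.

(** * Counting the values of floor h *)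

Definition ind_lt (x y : R) : R := if Rlt_dec x y then 1 else 0.
Definition ind_eq (a b : Z) : R := if Z.eq_dec a b then 1 else 0.

Lemma ind_eq_floor (v : R) (n : Z) :
  ind_eq (Int_part v) n = ind_lt v (IZR n + 1) - ind_lt v (IZR n).
Proof.
  destruct (base_Int_part v) as [B1 B2]. unfold ind_eq, ind_lt.
  destruct (Z.eq_dec (Int_part v) n) as [<-|Hn].
  - destruct (Rlt_dec v (IZR (Int_part v) + 1)), (Rlt_dec v (IZR (Int_part v))); lra.
  - destruct (Z_lt_ge_dec (Int_part v) n) as [H|H].
    + assert (IZR (Int_part v) + 1 <= IZR n) by (rewrite <- plus_IZR; apply IZR_le; lia).
      destruct (Rlt_dec v (IZR n + 1)), (Rlt_dec v (IZR n)); lra.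
    + assert (IZR n + 1 <= IZR (Int_part v)) by (rewrite <- plus_IZR; apply IZR_le; lia).
      destruct (Rlt_dec v (IZR n + 1)), (Rlt_dec v (IZR n)); lra.
Qed.

Lemma ceiling_unique z k : IZR k - 1 < z <= IZR k -> ceiling z = k.
Proof.
  intros H. pose proof (ceiling_bounds z) as B.
  assert (IZR k < IZR (ceiling z + 1)) by (rewrite plus_IZR; lra).
  assert (IZR (ceiling z) < IZR (k + 1)) by (rewrite plus_IZR; lra).
  apply lt_IZR in H0. apply lt_IZR in H1. lia.
Qed.

Lemma count_integers_below (N0 : Z) (K : nat) (z : R) :
  IZR N0 <= z <= IZR N0 + INR K ->
  Rsum (fun i => ind_lt (IZR (N0 + Z.of_nat i)) z) K = IZR (ceiling z) - IZR N0.
Proof.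
  induction K as [|K IH]; intros Hz.
  - simpl in *. rewrite (ceiling_unique z N0) by lra. ring.
  - cbn [Rsum]. rewrite S_INR in Hz. unfold ind_lt at 2.
    assert (E : IZR (N0 + Z.of_nat K) = IZR N0 + INR K) by (rewrite plus_IZR, <- INR_IZR_INZ; auto).
    destruct (Rlt_dec (IZR (N0 + Z.of_nat K)) z) as [H|H].
    + rewrite (Rsum_ext _ (fun _ => 1)).
      * rewrite Rsum_const, (ceiling_unique z (N0 + Z.of_nat K + 1)).
        -- rewrite plus_IZR, E. simpl. ring.
        -- rewrite plus_IZR, E. simpl. lra.
      * intros i Hi. unfold ind_lt. destruct (Rlt_dec (IZR (N0 + Z.of_nat i)) z); auto.
        exfalso; apply n. apply Rle_lt_trans with (IZR (N0 + Z.of_nat K)); auto.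
        apply IZR_le; lia.
    + rewrite IH by lra. ring.
Qed.

(** As [h] is at least [1] at [N0] and increases with slope at least [1], every
    integer [m >= N0] with [floor (h m) <= l] is among the first [l + 1]. *)
Definition hits (h : R -> R) (N0 : Z) (l n : nat) : R :=
  Rsum (fun i => ind_eq (Int_part (h (IZR (N0 + Z.of_nat i)))) (Z.of_nat n)) (S l).

Section Counting.

Variables (h h1 h2 phi : R -> R) (N0 : Z).
Hypothesis Hd1 : forall x, IZR N0 <= x -> is_derive h x (h1 x).
Hypothesis Hd2 : forall x, IZR N0 <= x -> is_derive h1 x (h2 x).
Hypothesis Hge : forall x, IZR N0 <= x -> 1 <= h1 x.
Hypothesis Hinv : forall x, IZR N0 <= x -> phi (h x) = x.
Hypothesis HN0 : (0 <= N0)%Z.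

Let below (l : nat) (y : R) : R :=
  Rsum (fun i => ind_lt (h (IZR (N0 + Z.of_nat i))) y) (S l).

Lemma hits_below l n : hits h N0 l n = below l (INR n + 1) - below l (INR n).
Proof.
  unfold hits, below. rewrite <- Rsum_minus. apply Rsum_ext. intros i _.
  rewrite ind_eq_floor, <- INR_IZR_INZ. auto.
Qed.

Lemma ind_lt_mono x y z : y <= z -> 0 <= ind_lt x y <= ind_lt x z.
Proof. intros H. unfold ind_lt. destruct (Rlt_dec x y), (Rlt_dec x z); lra. Qed.

Lemma below_mono l y z : y <= z -> 0 <= below l y <= below l z.
Proof.
  intros H. split; [apply Rsum_nonneg|apply Rsum_le]; intros; apply (ind_lt_mono _ y z H).
Qed.

(** [h m < y] means [m < phi y], so the count is the number of integers from [N0]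
    on that lie below [phi y]. *)
Lemma below_eq l y : h (IZR N0) <= y <= INR l + 1 -> 1 <= h (IZR N0) ->
  below l y = saw (phi y) + phi y + / 2 - IZR N0.
Proof.
  intros Hy Hh1.
  destruct (inverse_right (IZR N0) h h1 phi Hd1 Hge Hinv y ltac:(lra)) as [A1 A2].
  assert (Hz : phi y <= IZR N0 + INR (S l)).
  { pose proof (inverse_lipschitz (IZR N0) h h1 phi Hd1 Hge Hinv (h (IZR N0)) y ltac:(lra) ltac:(lra)) as L.
    rewrite Hinv in L by lra. rewrite S_INR. lra. }
  transitivity (IZR (ceiling (phi y)) - IZR N0); [|unfold saw; field].
  rewrite <- (count_integers_below N0 (S l) (phi y)) by lra.
  apply Rsum_ext. intros i _.
  assert (Hi : IZR N0 <= IZR (N0 + Z.of_nat i)) by (apply IZR_le; lia).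
  set (x := IZR (N0 + Z.of_nat i)) in *. unfold ind_lt.
  destruct (Rlt_dec (h x) y) as [H|H], (Rlt_dec x (phi y)) as [H'|H']; auto; exfalso.
  - pose proof (h_increment (IZR N0) h h1 Hd1 Hge (phi y) x A1 ltac:(lra)). lra.
  - pose proof (h_increment (IZR N0) h h1 Hd1 Hge x (phi y) Hi ltac:(lra)). lra.
Qed.

Hypothesis Hh1 : 1 <= h (IZR N0).
Variable n0 : nat.
Hypothesis Hn0 : h (IZR N0) <= INR n0.

Lemma hits_nonneg l n : 0 <= hits h N0 l n.
Proof.
  rewrite hits_below. pose proof (below_mono l (INR n) (INR n + 1) ltac:(lra)). lra.
Qed.

Lemma hits_eq l n : (n0 <= n <= l)%nat ->
  hits h N0 l n = (saw (phi (INR (S n))) - saw (phi (INR n))) + (phi (INR n + 1) - phi (INR n)).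
Proof.
  intros Hn. assert (INR n0 <= INR n <= INR l) by (split; apply le_INR; lia).
  rewrite hits_below, !below_eq, S_INR by lra. ring.
Qed.

(** The counts are differences of [below], hence differ from the gaps of [phi]
    by differences of the sawtooth. *)
Lemma hits_error l n : (n0 <= n <= l)%nat ->
  hits h N0 l n - gaps phi n0 n = saw (phi (INR (S n))) - saw (phi (INR n)).
Proof.
  intros Hn. rewrite hits_eq by lia. unfold gaps. destruct (lt_dec n n0); [lia|]. ring.
Qed.

Lemma hits_le_1 l n : (n0 <= n <= l)%nat -> hits h N0 l n <= 1.
Proof.
  intros Hn. assert (Hn' : INR n0 <= INR n <= INR l) by (split; apply le_INR; lia).
  pose proof (inverse_lipschitz (IZR N0) h h1 phi Hd1 Hge Hinv (INR n) (INR n + 1) ltac:(lra) ltac:(lra)) as L.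
  rewrite hits_eq by lia. rewrite S_INR. unfold saw.
  pose proof (ceiling_bounds (phi (INR n + 1))). pose proof (ceiling_bounds (phi (INR n))).
  assert (IZR (ceiling (phi (INR n + 1))) < IZR (ceiling (phi (INR n)) + 2)) by (rewrite plus_IZR; lra).
  apply lt_IZR in H1.
  assert (IZR (ceiling (phi (INR n + 1))) <= IZR (ceiling (phi (INR n)) + 1)) by (apply IZR_le; lia).
  rewrite plus_IZR in H2. lra.
Qed.

Let start_bound : R := phi (INR n0) + 1.

Lemma below_le l y : h (IZR N0) <= y <= INR l + 1 -> below l y <= phi y + 1.
Proof.
  intros Hy. rewrite below_eq by lra. pose proof (ceiling_bounds (phi y)). unfold saw.
  apply IZR_le in HN0. lra.
Qed.

Lemma hits_small l n : (n < n0 <= l)%nat -> hits h N0 l n <= start_bound.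
Proof.
  intros Hn. rewrite hits_below.
  assert (INR n + 1 <= INR n0) by (rewrite <- S_INR; apply le_INR; lia).
  assert (INR n0 <= INR l) by (apply le_INR; lia).
  pose proof (below_mono l (INR n + 1) (INR n0) ltac:(lra)).
  pose proof (below_mono l (INR n) (INR n) ltac:(lra)).
  pose proof (below_le l (INR n0) ltac:(lra)). unfold start_bound. lra.
Qed.

Lemma start_bound_nonneg : 0 <= start_bound.
Proof.
  destruct (inverse_right (IZR N0) h h1 phi Hd1 Hge Hinv (INR n0) Hn0).
  apply IZR_le in HN0. unfold start_bound. lra.
Qed.

Lemma sum_hits_sq l : (n0 <= l)%nat ->
  Rsum (fun n => hits h N0 l n ^ 2) (S l) <= INR n0 * start_bound ^ 2 + (phi (INR l + 1) + 1).
Proof.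
  intros Hl. rewrite (Rsum_split_le _ (S l) n0) by lia. apply Rplus_le_compat.
  - rewrite <- Rsum_const. apply Rsum_le. intros n Hn. pose proof (hits_nonneg l n).
    apply pow_incr. split; auto. apply hits_small; lia.
  - apply Rle_trans with (Rsum (fun n => hits h N0 l n) (S l)).
    + rewrite (Rsum_split_le (fun n => hits h N0 l n) (S l) n0) by lia.
      assert (0 <= Rsum (fun n => hits h N0 l n) n0) by (apply Rsum_nonneg; intros; apply hits_nonneg).
      assert (Rsum (fun i => hits h N0 l (n0 + i) ^ 2) (S l - n0)
        <= Rsum (fun i => hits h N0 l (n0 + i)) (S l - n0)); [|lra].
      apply Rsum_le. intros i Hi. pose proof (hits_nonneg l (n0 + i)).
      pose proof (hits_le_1 l (n0 + i) ltac:(lia)). nra.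
    + rewrite (Rsum_ext _ (fun n => below l (INR (S n)) - below l (INR n)))
        by (intros; rewrite hits_below, S_INR; auto).
      rewrite (Rsum_telescope (fun n => below l (INR n))), S_INR.
      assert (INR n0 <= INR l) by (apply le_INR; lia).
      pose proof (below_mono l (INR 0) (INR 0) ltac:(lra)).
      pose proof (below_le l (INR l + 1) ltac:(lra)). lra.
Qed.

Lemma sum_gaps_sq l : (n0 <= l)%nat -> Rsum (fun n => gaps phi n0 n ^ 2) (S l) <= phi (INR l + 1).
Proof.
  intros Hl. rewrite (Rsum_split_le _ (S l) n0) by lia.
  rewrite (Rsum_zero (fun n => gaps phi n0 n ^ 2) n0).
  2:{ intros i Hi. unfold gaps. destruct (lt_dec i n0); [ring|lia]. }
  apply Rle_trans with (Rsum (fun i => phi (INR (n0 + S i)) - phi (INR (n0 + i))) (S l - n0)).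
  - rewrite Rplus_0_l. apply Rsum_le. intros i Hi. unfold gaps.
    destruct (lt_dec (n0 + i) n0); [lia|]. rewrite !plus_INR, S_INR.
    pose proof (pos_INR i).
    pose proof (inverse_lipschitz (IZR N0) h h1 phi Hd1 Hge Hinv (INR n0 + INR i) (INR n0 + INR i + 1)
      ltac:(lra) ltac:(lra)).
    replace (INR n0 + (INR i + 1)) with (INR n0 + INR i + 1) by ring. nra.
  - rewrite (Rsum_telescope (fun i => phi (INR (n0 + i)))).
    replace (n0 + (S l - n0))%nat with (S l) by lia. rewrite S_INR.
    destruct (inverse_right (IZR N0) h h1 phi Hd1 Hge Hinv (INR (n0 + 0))).
    + rewrite Nat.add_0_r; auto.
    + apply IZR_le in HN0. lra.
Qed.

(** A sum of differences of the sawtooth against a linear twist is a difference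
    of two twisted sawtooth sums. *)
Lemma twisted_hits_error (C kap : R) : 0 < C ->
  (forall (n0 N : nat) xi al, (n0 <= N)%nat -> (0 < N)%nat ->
    Rabs (Rsum (fun i => saw (phi (INR (n0 + i))) * cos (xi * INR (n0 + i) + al)) (N - n0))
      <= C * Rpower (INR N) (1 - kap)) ->
  forall l xi al, (n0 <= l)%nat ->
    Rabs (Rsum (fun n => (hits h N0 l n - gaps phi n0 n) * cos (xi * INR n + al)) (S l))
      <= INR n0 * start_bound + (C * Rpower (INR (S (S l))) (1 - kap) + C * Rpower (INR (S l)) (1 - kap)).
Proof.
  intros HC HT l xi al Hl. rewrite (Rsum_split_le _ (S l) n0) by lia.
  eapply Rle_trans; [apply Rabs_triang|]. apply Rplus_le_compat.
  - rewrite <- Rsum_const. apply Rsum_abs_le. intros n Hn. unfold gaps.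
    destruct (lt_dec n n0); [|lia]. rewrite Rminus_0_r, Rabs_mult.
    assert (Rabs (cos (xi * INR n + al)) <= 1) by (apply Rabs_le_between, COS_bound).
    pose proof (hits_nonneg l n). pose proof (hits_small l n ltac:(lia)).
    rewrite (Rabs_right (hits h N0 l n)) by lra. nra.
  - rewrite (Rsum_ext _ (fun i => saw (phi (INR (S n0 + i))) * cos (xi * INR (S n0 + i) + (al - xi))
      - saw (phi (INR (n0 + i))) * cos (xi * INR (n0 + i) + al))).
    + rewrite Rsum_minus. eapply Rle_trans; [apply Rabs_triang|]. rewrite Rabs_Ropp.
      apply Rplus_le_compat.
      * replace (S l - n0)%nat with (S (S l) - S n0)%nat by lia. apply HT; lia.
      * apply HT; lia.
    + intros i Hi. rewrite hits_error by lia. cbn [Nat.add]. rewrite S_INR.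
      replace (xi * (INR (n0 + i) + 1) + (al - xi)) with (xi * INR (n0 + i) + al) by ring. ring.
Qed.

End Counting.

(** * Representations as a trilinear form *)

Lemma cardinal_of_list (T : Type) (P : Ensemble T) (s : list T) :
  NoDup s -> (forall x, P x <-> List.In x s) -> cardinal T P (length s).
Proof.
  revert P. induction s as [|a s IH]; intros P Hs HP.
  - replace P with (Empty_set T); [constructor|].
    apply functional_extensionality. intros x. apply propositional_extensionality.
    split; [intros []|]. intros Hx. apply HP in Hx. destruct Hx.
  - inversion Hs as [|a' s' Ha Hs']; subst.
    replace P with (Add T (fun x => List.In x s) a).
    + constructor; auto. apply IH; auto. tauto.
    + apply functional_extensionality. intros x. apply propositional_extensionality.
      rewrite HP. split.
      * intros [y Hy|y Hy]; [right; auto|]. destruct Hy; left; auto.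
      * intros [<-|Hx]; [right; constructor|left; auto].
Qed.

Definition lsum {T : Type} (s : list T) (f : T -> R) : R := fold_right (fun x a => f x + a) 0 s.

Lemma lsum_app {T : Type} (s t : list T) (f : T -> R) : lsum (s ++ t) f = lsum s f + lsum t f.
Proof. induction s as [|a s IH]; simpl; [ring|rewrite IH; ring]. Qed.

Lemma lsum_map {S T : Type} (s : list S) (g : S -> T) (f : T -> R) :
  lsum (map g s) f = lsum s (fun x => f (g x)).
Proof. induction s as [|a s IH]; simpl; [auto|rewrite IH; auto]. Qed.

Lemma lsum_list_prod {S T : Type} (s : list S) (t : list T) (f : S * T -> R) :
  lsum (list_prod s t) f = lsum s (fun x => lsum t (fun y => f (x, y))).
Proof.
  induction s as [|a s IH]; simpl; auto. rewrite lsum_app, lsum_map, IH. auto.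
Qed.

Lemma lsum_seq (f : nat -> R) (n : nat) : lsum (seq 0 n) f = Rsum f n.
Proof.
  induction n as [|n IH]; auto. rewrite seq_S, lsum_app, IH. simpl. ring.
Qed.

Lemma length_filter {T : Type} (P : T -> bool) (s : list T) :
  INR (length (filter P s)) = lsum s (fun x => if P x then 1 else 0).
Proof.
  induction s as [|a s IH]; simpl filter; auto.
  simpl lsum. destruct (P a); simpl length; rewrite <- IH; [rewrite S_INR|]; ring.
Qed.

Lemma NoDup_list_product {S T : Type} (s : list S) (t : list T) :
  NoDup s -> NoDup t -> NoDup (list_prod s t).
Proof.
  intros Hs Ht. induction s as [|a s IH]; simpl; [constructor|].
  inversion Hs as [|a' s' Ha Hs']; subst. apply NoDup_app.
  - apply Injective_map_NoDup; auto. intros x y E; injection E; auto.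
  - auto.
  - intros [x y] H1 H2. apply in_map_iff in H1. destruct H1 as (z & Hz & _).
    injection Hz; intros; subst. apply in_prod_iff in H2. tauto.
Qed.

Definition int_range (N0 : Z) (K : nat) : list Z := map (fun i => (N0 + Z.of_nat i)%Z) (seq 0 K).

Lemma NoDup_int_range N0 K : NoDup (int_range N0 K).
Proof.
  apply Injective_map_NoDup; [|apply seq_NoDup]. intros x y E. lia.
Qed.

Lemma in_int_range N0 K z : List.In z (int_range N0 K) <-> (N0 <= z < N0 + Z.of_nat K)%Z.
Proof.
  unfold int_range. rewrite in_map_iff. split.
  - intros (i & <- & Hi). apply in_seq in Hi. lia.
  - intros Hz. exists (Z.to_nat (z - N0)). rewrite in_seq. lia.
Qed.

Definition solutions (h1 h2 h3 : R -> R) (N0 : Z) (l : nat) : list (Z * Z * Z) :=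
  filter (fun '(m1, m2, m3) =>
    Z.eqb (Int_part (h1 (IZR m1)) + Int_part (h2 (IZR m2)) + Int_part (h3 (IZR m3))) (Z.of_nat l))
    (list_prod (list_prod (int_range N0 (S l)) (int_range N0 (S l))) (int_range N0 (S l))).

Lemma Int_part_ge (v : R) (n : Z) : IZR n <= v -> (n <= Int_part v)%Z.
Proof.
  intros H. destruct (base_Int_part v). assert (IZR n < IZR (Int_part v + 1)) by (rewrite plus_IZR; lra).
  apply lt_IZR in H2. lia.
Qed.

(** This bounds the variables of a representation of [l] by [N0 + l], which makes
    the set of representations finite. *)
Definition expanding (h : R -> R) (N0 : Z) : Prop :=
  forall m, (N0 <= m)%Z -> IZR m - IZR N0 + 1 <= h (IZR m).

Lemma expanding_floor h N0 m : expanding h N0 -> (N0 <= m)%Z -> (m - N0 + 1 <= Int_part (h (IZR m)))%Z.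
Proof.
  intros H Hm. apply Int_part_ge. rewrite plus_IZR, minus_IZR. specialize (H m Hm). lra.
Qed.

Lemma solutions_cardinal h1 h2 h3 N0 l :
  expanding h1 N0 -> expanding h2 N0 -> expanding h3 N0 ->
  cardinal (Z * Z * Z) (representations h1 h2 h3 N0 l) (length (solutions h1 h2 h3 N0 l)).
Proof.
  intros H1 H2 H3. apply cardinal_of_list.
  - apply NoDup_filter. repeat apply NoDup_list_product; apply NoDup_int_range.
  - intros [[m1 m2] m3]. unfold solutions. rewrite filter_In, !in_prod_iff, !in_int_range, Z.eqb_eq.
    unfold representations. split.
    + intros (A & B & C & E).
      pose proof (expanding_floor h1 N0 m1 H1 A). pose proof (expanding_floor h2 N0 m2 H2 B).
      pose proof (expanding_floor h3 N0 m3 H3 C). lia.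
    + intros (((A & B) & C) & E). lia.
Qed.

Definition point_mass (u : nat) (n : nat) : R := if Nat.eq_dec n u then 1 else 0.

Lemma tri_point_masses l u v w :
  tri l (point_mass u) (point_mass v) (point_mass w) = if Nat.eq_dec (u + v + w) l then 1 else 0.
Proof.
  unfold tri, point_mass.
  rewrite (Rsum_ext _ (fun i => if Nat.eq_dec i u then
     Rsum (fun j => Rsum (fun k => if Nat.eq_dec (u + j + k) l then
       (if Nat.eq_dec j v then 1 else 0) * (if Nat.eq_dec k w then 1 else 0) else 0) (S l)) (S l) else 0)).
  2:{ intros i _. destruct (Nat.eq_dec i u) as [->|].
      - apply Rsum_ext2; intros. destruct (Nat.eq_dec (u + _ + _) l); ring.
      - apply Rsum_zero; intros. apply Rsum_zero; intros.
        destruct (Nat.eq_dec (i + _ + _) l); ring. }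
  rewrite (Rsum_if_eq (fun i => Rsum (fun j => Rsum (fun k => if Nat.eq_dec (u + j + k) l then
       (if Nat.eq_dec j v then 1 else 0) * (if Nat.eq_dec k w then 1 else 0) else 0) (S l)) (S l))).
  rewrite (Rsum_ext _ (fun j => if Nat.eq_dec j v then
     Rsum (fun k => if Nat.eq_dec (u + v + k) l then (if Nat.eq_dec k w then 1 else 0) else 0) (S l) else 0)).
  2:{ intros j _. destruct (Nat.eq_dec j v) as [->|].
      - apply Rsum_ext; intros. destruct (Nat.eq_dec (u + _ + _) l); ring.
      - apply Rsum_zero; intros. destruct (Nat.eq_dec (u + _ + _) l); ring. }
  rewrite (Rsum_if_eq (fun j => Rsum (fun k => if Nat.eq_dec (u + v + k) l then (if Nat.eq_dec k w then 1 else 0) else 0) (S l))).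
  rewrite (Rsum_ext _ (fun k => if Nat.eq_dec k w then (if Nat.eq_dec (u + v + w) l then 1 else 0) else 0)).
  2:{ intros k _. destruct (Nat.eq_dec k w) as [->|]; auto. destruct (Nat.eq_dec (u + v + k) l); auto. }
  rewrite (Rsum_if_eq (fun _ => if Nat.eq_dec (u + v + w) l then 1 else 0)).
  destruct (Nat.eq_dec (u + v + w) l), (lt_dec u (S l)), (lt_dec v (S l)), (lt_dec w (S l));
    auto; lia.
Qed.

Lemma tri_Rsum_l l K (F : nat -> nat -> R) g h :
  tri l (fun a => Rsum (fun i => F i a) K) g h = Rsum (fun i => tri l (F i) g h) K.
Proof.
  induction K as [|K IH]; cbn [Rsum].
  - unfold tri. apply Rsum_zero; intros. apply Rsum_zero; intros. apply Rsum_zero; intros.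
    destruct (Nat.eq_dec _ l); ring.
  - rewrite <- IH. unfold tri. rewrite <- Rsum_plus. apply Rsum_ext; intros.
    rewrite <- Rsum_plus. apply Rsum_ext; intros. rewrite <- Rsum_plus. apply Rsum_ext; intros.
    destruct (Nat.eq_dec _ l); ring.
Qed.

Lemma hits_point_mass h N0 l n : expanding h N0 ->
  hits h N0 l n = Rsum (fun i => point_mass (Z.to_nat (Int_part (h (IZR (N0 + Z.of_nat i))))) n) (S l).
Proof.
  intros H. apply Rsum_ext. intros i _. unfold ind_eq, point_mass.
  pose proof (expanding_floor h N0 (N0 + Z.of_nat i) H ltac:(lia)).
  destruct (Z.eq_dec _ (Z.of_nat n)), (Nat.eq_dec n _); auto; lia.
Qed.

Lemma solutions_count h1 h2 h3 N0 l :
  expanding h1 N0 -> expanding h2 N0 -> expanding h3 N0 ->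
  INR (length (solutions h1 h2 h3 N0 l)) = tri l (hits h1 N0 l) (hits h2 N0 l) (hits h3 N0 l).
Proof.
  intros H1 H2 H3.
  rewrite (tri_ext l _ _ _ _ _ _ (fun n _ => hits_point_mass h1 N0 l n H1)
    (fun n _ => hits_point_mass h2 N0 l n H2) (fun n _ => hits_point_mass h3 N0 l n H3)).
  rewrite tri_Rsum_l.
  unfold solutions. rewrite length_filter, !lsum_list_prod.
  unfold int_range. rewrite lsum_map, lsum_seq. apply Rsum_ext. intros i _.
  rewrite tri_swap12, tri_Rsum_l, lsum_map, lsum_seq. apply Rsum_ext. intros j _.
  rewrite tri_swap12, tri_swap23, tri_swap12, tri_Rsum_l, lsum_map, lsum_seq. apply Rsum_ext. intros k _.
  rewrite tri_swap12, tri_swap23, tri_point_masses.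
  pose proof (expanding_floor h1 N0 (N0 + Z.of_nat i) H1 ltac:(lia)).
  pose proof (expanding_floor h2 N0 (N0 + Z.of_nat j) H2 ltac:(lia)).
  pose proof (expanding_floor h3 N0 (N0 + Z.of_nat k) H3 ltac:(lia)).
  destruct (Nat.eq_dec _ l) as [E|E].
  - rewrite (proj2 (Z.eqb_eq _ _)); auto. lia.
  - rewrite (proj2 (Z.eqb_neq _ _)); auto. lia.
Qed.

(** * The error terms *)

Definition power_bounded (F : nat -> R) (a : R) : Prop :=
  exists C L, 0 < C /\ forall l : nat, (L <= l)%nat -> F l <= C * Rpower (INR l) a.

Definition tame_squares (g : R) (u : nat -> nat -> R) : Prop :=
  forall eps, 0 < eps -> power_bounded (fun l => Rsum (fun n => u l n ^ 2) (S l)) (g + eps).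

(** The range of [kap] is the one in [twisted_range]. *)
Definition small_twists (g : R) (e : nat -> nat -> R) : Prop :=
  forall kap, 0 < kap < 1 -> 2 * kap + g / 2 < 1 -> kap < g / 2 ->
    exists C L, 0 < C /\ forall l : nat, (L <= l)%nat -> forall xi al,
      Rabs (Rsum (fun n => e l n * cos (xi * INR n + al)) (S l)) <= C * Rpower (INR l) (1 - kap).

Definition power_below (q : R -> R) (a : R) : Prop :=
  forall eps, 0 < eps -> exists c L, 0 < c /\ forall l : nat, (L <= l)%nat ->
    c * Rpower (INR l) (a - eps) <= q (INR l).

(** By [tri_bound] the form is at most a power of [l] with exponent
    [1 - kap + (g2 + g3) / 2], up to an arbitrarily small amount, while the main term
    has exponent [g1 + g2 + g3 - 1].  So [kap] must exceed
    [beta = (1 - g1) + ((1 - g2) + (1 - g3)) / 2], and the hypothesis on the exponents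
    leaves room below the bound [1 / 2 - g1 / 4] that comes from [small_twists]. *)
Lemma error_negligible (g1 g2 g3 : R) (q1 q2 q3 : R -> R) (e u v : nat -> nat -> R) :
  3 / 4 < g1 <= 1 -> 3 / 4 < g2 <= 1 -> 3 / 4 < g3 <= 1 ->
  4 * (1 - g1) + 5 / 2 * (1 - g2) + 5 / 2 * (1 - g3) < 1 ->
  small_twists g1 e -> tame_squares g2 u -> tame_squares g3 v ->
  power_below q1 (g1 - 1) -> power_below q2 (g2 - 1) -> power_below q3 (g3 - 1) ->
  forall d, 0 < d -> exists L, forall l, (L <= l)%nat ->
    Rabs (tri l (e l) (u l) (v l)) <= d * (INR l ^ 2 * q1 (INR l) * q2 (INR l) * q3 (INR l)).
Proof.
  intros Hg1 Hg2 Hg3 Hsum He Hu Hv Hq1 Hq2 Hq3 d Hd.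
  set (beta := 2 - g1 - (g2 + g3) / 2).
  set (kap := (beta + (1 / 2 - g1 / 4)) / 2).
  (* four small losses: one from the mean squares and three from the main term *)
  set (eps := (kap - beta) / 8).
  assert (Hb : beta < 1 / 2 - g1 / 4) by (unfold beta; lra).
  assert (Hk : 0 < kap < 1 /\ 2 * kap + g1 / 2 < 1 /\ kap < g1 / 2).
  { unfold kap, beta in *. repeat split; lra. }
  assert (Heps : 0 < eps) by (unfold eps, kap; lra).
  destruct Hk as (Hk1 & Hk2 & Hk3).
  destruct (He kap Hk1 Hk2 Hk3) as (C0 & L0 & HC0 & HE).
  destruct (Hu eps Heps) as (Cu & Lu & HCu & HU).
  destruct (Hv eps Heps) as (Cv & Lv & HCv & HV).
  destruct (Hq1 eps Heps) as (c1 & L1 & Hc1 & HQ1).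
  destruct (Hq2 eps Heps) as (c2 & L2 & Hc2 & HQ2).
  destruct (Hq3 eps Heps) as (c3 & L3 & Hc3 & HQ3).
  set (C := 2 * C0 * sqrt (Cu * Cv)).
  assert (Hs : 0 < sqrt (Cu * Cv)) by (apply sqrt_lt_R0, Rmult_lt_0_compat; auto).
  assert (Hc : 0 < d * c1 * c2 * c3) by (repeat apply Rmult_lt_0_compat; auto).
  destruct (Rpower_eventually (C / (d * c1 * c2 * c3)) (4 * eps) ltac:(lra)) as (Yb & HYb & HYB).
  destruct (nfloor_ex Yb ltac:(lra)) as [Lb HLb].
  exists (S (L0 + Lu + Lv + L1 + L2 + L3 + Lb)). intros l Hl.
  assert (HlY : INR Lb + 1 <= INR l) by (rewrite <- S_INR; apply le_INR; lia).
  specialize (HYB (INR l) ltac:(lra)).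
  set (X := INR l) in *.
  assert (HB : Rabs (tri l (e l) (u l) (v l)) <=
    2 * (C0 * Rpower X (1 - kap)) * sqrt (Cu * Rpower X (g2 + eps) * (Cv * Rpower X (g3 + eps)))).
  { apply tri_bound.
    - apply Rmult_le_pos; [lra|left; apply exp_pos].
    - apply Rmult_lt_0_compat; [auto|apply exp_pos].
    - apply Rmult_lt_0_compat; [auto|apply exp_pos].
    - intros xi al. apply HE; lia.
    - apply HU; lia.
    - apply HV; lia. }
  eapply Rle_trans; [exact HB|].
  replace (Cu * Rpower X (g2 + eps) * (Cv * Rpower X (g3 + eps)))
    with (Cu * Cv * (Rpower X (g2 + eps) * Rpower X (g3 + eps))) by ring.
  rewrite <- Rpower_plus, sqrt_mult_alt by nra.
  rewrite <- (Rpower_sqrt (Rpower _ _)) by apply exp_pos. rewrite Rpower_mult.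
  set (E1 := (g2 + eps + (g3 + eps)) * / 2).
  replace (2 * (C0 * Rpower X (1 - kap)) * (sqrt (Cu * Cv) * Rpower X E1))
    with (C * (Rpower X (1 - kap) * Rpower X E1)) by (unfold C; ring).
  rewrite <- Rpower_plus.
  specialize (HQ1 l ltac:(lia)). specialize (HQ2 l ltac:(lia)). specialize (HQ3 l ltac:(lia)).
  fold X in HQ1, HQ2, HQ3.
  assert (P1 : 0 < Rpower X (g1 - 1 - eps)) by apply exp_pos.
  assert (P2 : 0 < Rpower X (g2 - 1 - eps)) by apply exp_pos.
  assert (P3 : 0 < Rpower X (g3 - 1 - eps)) by apply exp_pos.
  set (E2 := 2 + (g1 - 1 - eps) + (g2 - 1 - eps) + (g3 - 1 - eps)).
  assert (HX2 : Rpower X 2 = X ^ 2).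
  { replace 2 with (INR 2) at 1 by (simpl; ring). apply Rpower_pow. lra. }
  apply Rle_trans with (d * c1 * c2 * c3 * Rpower X E2).
  - apply Rle_trans with (d * c1 * c2 * c3 * (Rpower X (4 * eps) * Rpower X (1 - kap + E1))).
    + rewrite <- Rmult_assoc. apply Rmult_le_compat_r; [left; apply exp_pos|].
      apply (proj1 (Rle_div_l _ _ _ Hc)) in HYB. lra.
    + apply Rmult_le_compat_l; [lra|]. rewrite <- Rpower_plus. apply Rle_Rpower; [lra|].
      unfold E1, E2, eps, beta. unfold eps, beta in *. clearbody kap. lra.
  - unfold E2. rewrite !Rpower_plus, HX2.
    assert (0 < X ^ 2) by (apply pow_lt; lra).
    replace (d * c1 * c2 * c3 * _) with (d * (X ^ 2 * (c1 * Rpower X (g1 - 1 - eps))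
      * (c2 * Rpower X (g2 - 1 - eps)) * (c3 * Rpower X (g3 - 1 - eps)))) by ring.
    apply Rmult_le_compat_l; [lra|].
    assert (K1 : 0 < c1 * Rpower X (g1 - 1 - eps)) by nra.
    assert (K2 : 0 < c2 * Rpower X (g2 - 1 - eps)) by nra.
    assert (K3 : 0 < c3 * Rpower X (g3 - 1 - eps)) by nra.
    apply Rmult_le_compat; try lra; [apply Rmult_le_pos; [apply Rmult_le_pos|]; lra|].
    apply Rmult_le_compat; try lra; [apply Rmult_le_pos; lra|].
    apply Rmult_le_compat_l; lra.
Qed.

Lemma Rpower_shift_le (l k : nat) (a : R) : (1 <= l)%nat -> (k <= 2)%nat -> 0 <= a <= 2 ->
  Rpower (INR (l + k)) a <= 9 * Rpower (INR l) a.
Proof.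
  intros Hl Hk Ha. assert (H1 : 1 <= INR l) by (apply (le_INR 1); auto).
  assert (H2 : INR k <= 2) by (apply (le_INR k 2) in Hk; simpl in Hk; lra).
  pose proof (pos_INR k). rewrite plus_INR.
  apply Rle_trans with (Rpower (3 * INR l) a); [apply Rle_Rpower_l; lra|].
  rewrite <- Rpower_mult_distr by lra. apply Rmult_le_compat_r; [left; apply exp_pos|].
  apply Rle_trans with (Rpower 3 (INR 2)); [apply Rle_Rpower; simpl; lra|].
  rewrite Rpower_pow by lra. simpl; lra.
Qed.

Record hit_data (g : R) (h phi phi1 : R -> R) (N0 : Z) (n0 : nat) : Prop := {
  hd_dom : dominated_gaps g phi phi1 n0;
  hd_twist : small_twists g (fun l n => hits h N0 l n - gaps phi n0 n);
  hd_hits : tame_squares g (hits h N0);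
  hd_gaps : tame_squares g (fun _ => gaps phi n0);
  hd_below : power_below phi1 (g - 1);
  hd_exp : expanding h N0 }.

Lemma constant_absorbed (A B a : R) (l : nat) : 0 <= A -> 0 <= a -> (1 <= l)%nat ->
  A + B * Rpower (INR l) a <= (A + B) * Rpower (INR l) a.
Proof.
  intros HA Ha Hl. assert (H1 : 1 <= INR l) by (apply (le_INR 1); auto).
  assert (1 <= Rpower (INR l) a).
  { rewrite <- (Rpower_O (INR l)) at 1 by lra. apply Rle_Rpower; lra. }
  nra.
Qed.

Lemma class_F_hits (c x0 : R) (h phi : R -> R) : 1 <= c < 4 / 3 -> class_F c x0 h ->
  is_inverse x0 h phi ->
  exists phi1 phi2 Y (M : Z), profile (1 / c) phi phi1 phi2 Y /\ (0 < M)%Z /\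
    forall N0, (M <= N0)%Z -> admissible_start x0 h N0 /\
      exists n0, hit_data (1 / c) h phi phi1 N0 n0.
Proof.
  intros Hc HF Hinv.
  destruct (class_F_profile c x0 h phi ltac:(lra) HF Hinv) as (phi1 & phi2 & Y & HP).
  destruct (class_F_derivative_large c x0 h ltac:(lra) HF) as (X & HX0 & HX1 & HXd).
  destruct (class_F_facts c x0 h ltac:(lra) HF) as (h1 & h2 & v & w & Hx & _).
  destruct (archimed X) as [HU _].
  exists phi1, phi2, Y, (up X).
  assert (HM : (0 < up X)%Z) by (apply lt_IZR; lra).
  split; [exact HP|]. split; [exact HM|]. intros N0 HN0.
  assert (HNX : X < IZR N0) by (apply IZR_le in HN0; lra).
  split.
  { split; [lra|]. intros x Hxx. apply HXd; lra. }
  assert (Hg : 3 / 4 < 1 / c <= 1).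
  { split; [|apply div_le; lra].
    apply Rmult_lt_reg_r with c; [lra|]. replace (1 / c * c) with 1 by (field; lra). lra. }
  set (g := 1 / c) in *. clearbody g.
  assert (Hd1 : forall x, IZR N0 <= x -> is_derive h x (h1 x)) by (intros; apply Hx; lra).
  assert (Hge : forall x, IZR N0 <= x -> 1 <= h1 x).
  { intros x Hxx. destruct (Hx x ltac:(lra)) as (D & _).
    rewrite <- (is_derive_unique h x (h1 x) D). apply HXd; lra. }
  assert (Hinv' : forall x, IZR N0 <= x -> phi (h x) = x) by (intros; apply Hinv; lra).
  assert (HN00 : (0 <= N0)%Z) by lia.
  assert (Hh1 : 1 <= h (IZR N0)) by (apply Hx; lra).
  destruct (gaps_dominated g phi phi1 phi2 Y Hg HP) as (Y1 & HY1 & HD).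
  destruct (nfloor_ex (Rmax 0 (Rmax Y1 (h (IZR N0))))) as [m Hm]; [apply Rmax_l|].
  set (n0 := S m). exists n0.
  assert (Hn0 : Y1 <= INR n0 /\ h (IZR N0) <= INR n0).
  { unfold n0. rewrite S_INR. revert Hm. intros_max. lra. }
  destruct Hn0 as [Hn0Y Hn0].
  set (D := phi (INR n0) + 1).
  assert (HDp : 0 <= D).
  { apply (start_bound_nonneg h h1 phi N0 Hd1 Hge Hinv' HN00 n0 Hn0). }
  assert (HnD : 0 <= INR n0 * D) by (apply Rmult_le_pos; [apply pos_INR|auto]).
  assert (HnD2 : 0 <= INR n0 * D ^ 2) by (apply Rmult_le_pos; [apply pos_INR|apply pow2_ge_0]).
  assert (HPhi : forall eps, 0 < eps -> exists K L, 1 <= K /\ forall l : nat, (L <= l)%nat ->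
     phi (INR l + 1) <= K * Rpower (INR l) (g + eps)).
  { assert (H0 : forall eps, 0 < eps < 1 -> exists K L, 1 <= K /\ forall l : nat, (L <= l)%nat ->
       phi (INR l + 1) <= K * Rpower (INR l) (g + eps)).
    { intros eps Heps. destruct (profile_powers g phi phi1 phi2 Y eps ltac:(lra) HP) as (K & Y2 & HK & HY2 & HKb).
      destruct (nfloor_ex (Rmax 0 Y2)) as [L HL]; [apply Rmax_l|].
      exists (K * 9), (S L). split; [lra|]. intros l Hl.
      assert (INR L + 1 <= INR l) by (rewrite <- S_INR; apply le_INR; lia).
      destruct (HKb (INR l + 1)) as [_ B]; [revert HL; intros_max; lra|].
      eapply Rle_trans; [exact B|]. rewrite Rmult_assoc. apply Rmult_le_compat_l; [lra|].
      replace (INR l + 1) with (INR (l + 1)) by (rewrite plus_INR; auto).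
      apply Rpower_shift_le; [lia|lia|lra]. }
    intros eps Heps. destruct (H0 (Rmin eps (1 / 2))) as (K & L & HK & HL).
    { split; [apply Rmin_pos; lra|]. pose proof (Rmin_r eps (1 / 2)); lra. }
    exists K, (S L). split; auto. intros l Hl. eapply Rle_trans; [apply HL; lia|].
    apply Rmult_le_compat_l; [lra|]. apply Rle_Rpower; [apply (le_INR 1); lia|].
    pose proof (Rmin_l eps (1 / 2)); lra. }
  split.
  - apply HD; auto.
  - intros kap Hk1 Hk2 Hk3.
    destruct (twisted_range g phi phi1 phi2 Y kap Hg HP Hk1 Hk2 Hk3) as (C & HC & HT).
    exists (INR n0 * D + 18 * C), (S n0). split; [lra|]. intros l Hl xi al.
    eapply Rle_trans.
    + apply (twisted_hits_error h h1 phi N0 Hd1 Hge Hinv' HN00 Hh1 n0 Hn0 C kap HC HT). lia.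
    + eapply Rle_trans; [|apply constant_absorbed; [auto|lra|lia]]. fold D.
      apply Rplus_le_compat_l.
      pose proof (Rpower_shift_le l 2 (1 - kap) ltac:(lia) ltac:(lia) ltac:(lra)) as S2.
      pose proof (Rpower_shift_le l 1 (1 - kap) ltac:(lia) ltac:(lia) ltac:(lra)) as S1.
      replace (l + 2)%nat with (S (S l)) in S2 by lia. replace (l + 1)%nat with (S l) in S1 by lia.
      nra.
  - intros eps Heps. destruct (HPhi eps Heps) as (K & L & HK & HL).
    exists (INR n0 * D ^ 2 + 1 + K), (S (n0 + L)). split; [lra|]. intros l Hl.
    eapply Rle_trans; [apply (sum_hits_sq h h1 phi N0 Hd1 Hge Hinv' HN00 Hh1 n0 Hn0); lia|]. fold D.
    eapply Rle_trans; [|apply constant_absorbed; [lra|lra|lia]].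
    specialize (HL l ltac:(lia)). lra.
  - intros eps Heps. destruct (HPhi eps Heps) as (K & L & HK & HL).
    exists K, (S (n0 + L)). split; [lra|]. intros l Hl.
    eapply Rle_trans; [apply (sum_gaps_sq h h1 phi N0 Hd1 Hge Hinv' HN00 n0 Hn0); lia|].
    apply HL; lia.
  - intros eps Heps. destruct (profile_powers g phi phi1 phi2 Y eps Heps HP) as (K & Y2 & HK & HY2 & HKb).
    destruct (nfloor_ex (Rmax 0 Y2)) as [L HL]; [apply Rmax_l|].
    exists (/ K), (S L). split; [apply Rinv_0_lt_compat; lra|]. intros l Hl.
    assert (INR L + 1 <= INR l) by (rewrite <- S_INR; apply le_INR; lia).
    apply HKb. revert HL; intros_max; lra.
  - intros k Hk. apply IZR_le in Hk.
    pose proof (h_increment (IZR N0) h h1 Hd1 Hge (IZR N0) (IZR k) ltac:(lra) Hk). lra.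
Qed.

Theorem theorem1p2
  (c1 c2 c3 gamma1 gamma2 gamma3 x1 x2 x3 : R)
  (h1 h2 h3 phi1 phi2 phi3 : R -> R)
  (Hc1 : 1 <= c1 < 4 / 3) (Hc2 : 1 <= c2 < 4 / 3) (Hc3 : 1 <= c3 < 4 / 3)
  (Hgamma1 : gamma1 = 1 / c1) (Hgamma2 : gamma2 = 1 / c2)
  (Hgamma3 : gamma3 = 1 / c3)
  (Hsum1 : 4 * (1 - gamma1) + 5 / 2 * (1 - gamma2) + 5 / 2 * (1 - gamma3) < 1)
  (Hsum2 : 5 / 2 * (1 - gamma1) + 4 * (1 - gamma2) + 5 / 2 * (1 - gamma3) < 1)
  (Hsum3 : 5 / 2 * (1 - gamma1) + 5 / 2 * (1 - gamma2) + 4 * (1 - gamma3) < 1)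
  (Hh1 : class_F c1 x1 h1) (Hh2 : class_F c2 x2 h2) (Hh3 : class_F c3 x3 h3)
  (Hphi1 : is_inverse x1 h1 phi1) (Hphi2 : is_inverse x2 h2 phi2)
  (Hphi3 : is_inverse x3 h3 phi3) :
  exists Nmin : Z, (0 < Nmin)%Z /\
    forall N0 : Z, (Nmin <= N0)%Z ->
      admissible_start x1 h1 N0 /\ admissible_start x2 h2 N0 /\
      admissible_start x3 h3 N0 /\
      exists r : nat -> nat,
        (forall lambda : nat, (0 < lambda)%nat ->
           cardinal (Z * Z * Z) (representations h1 h2 h3 N0 lambda) (r lambda)) /\
        is_domin eventually (main_order phi1 phi2 phi3)
          (fun lambda : nat =>
             INR (r lambda)
             - Gamma gamma1 * Gamma gamma2 * Gamma gamma3
               / Gamma (gamma1 + gamma2 + gamma3)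
               * main_order phi1 phi2 phi3 lambda).
Proof.
  destruct (class_F_hits c1 x1 h1 phi1 Hc1 Hh1 Hphi1) as (q1 & r1 & Y1 & M1 & P1 & HM1 & D1).
  destruct (class_F_hits c2 x2 h2 phi2 Hc2 Hh2 Hphi2) as (q2 & r2 & Y2 & M2 & P2 & HM2 & D2).
  destruct (class_F_hits c3 x3 h3 phi3 Hc3 Hh3 Hphi3) as (q3 & r3 & Y3 & M3 & P3 & HM3 & D3).
  assert (Hgam : forall c g, 1 <= c < 4 / 3 -> g = 1 / c -> 3 / 4 < g <= 1).
  { intros c g Hc ->. split; [|apply div_le; lra].
    apply Rmult_lt_reg_r with c; [lra|]. replace (1 / c * c) with 1 by (field; lra). lra. }
  pose proof (Hgam _ _ Hc1 Hgamma1) as G1. pose proof (Hgam _ _ Hc2 Hgamma2) as G2.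
  pose proof (Hgam _ _ Hc3 Hgamma3) as G3.
  exists (Z.max M1 (Z.max M2 M3)). split; [lia|]. intros N0 HN0.
  destruct (D1 N0 ltac:(lia)) as (A1 & n1 & E1).
  destruct (D2 N0 ltac:(lia)) as (A2 & n2 & E2).
  destruct (D3 N0 ltac:(lia)) as (A3 & n3 & E3).
  rewrite <- Hgamma1 in *. rewrite <- Hgamma2 in *. rewrite <- Hgamma3 in *.
  refine (conj A1 (conj A2 (conj A3 _))).
  exists (fun l => length (solutions h1 h2 h3 N0 l)). split.
  { intros l _. apply solutions_cardinal; eapply hd_exp; eauto. }
  destruct E1 as [dom1 tw1 hit1 gap1 low1 exp1].
  destruct E2 as [dom2 tw2 hit2 gap2 low2 exp2].
  destruct E3 as [dom3 tw3 hit3 gap3 low3 exp3].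
  intros eps. pose proof (cond_pos eps) as Heps. set (d := eps / 4).
  assert (Hd : 0 < d) by (unfold d; lra).
  destruct (tri_gaps_asymptotic gamma1 gamma2 gamma3 phi1 q1 r1 phi2 q2 r2 phi3 q3 r3 Y1 Y2 Y3
    G1 G2 G3 P1 P2 P3 n1 n2 n3 dom1 dom2 dom3 d Hd) as [L0 T0].
  destruct (error_negligible gamma1 gamma2 gamma3 q1 q2 q3
    (fun l n => hits h1 N0 l n - gaps phi1 n1 n) (hits h2 N0) (hits h3 N0)
    G1 G2 G3 ltac:(lra) tw1 hit2 hit3 low1 low2 low3 d Hd) as [L1 T1].
  destruct (error_negligible gamma2 gamma1 gamma3 q2 q1 q3
    (fun l n => hits h2 N0 l n - gaps phi2 n2 n) (fun _ => gaps phi1 n1) (hits h3 N0)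
    G2 G1 G3 ltac:(lra) tw2 gap1 hit3 low2 low1 low3 d Hd) as [L2 T2].
  destruct (error_negligible gamma3 gamma1 gamma2 q3 q1 q2
    (fun l n => hits h3 N0 l n - gaps phi3 n3 n) (fun _ => gaps phi1 n1) (fun _ => gaps phi2 n2)
    G3 G1 G2 ltac:(lra) tw3 gap1 gap2 low3 low1 low2 d Hd) as [L3 T3].
  destruct (nfloor_ex (Rmax 0 (Rmax Y1 (Rmax Y2 Y3)))) as [LY HLY]; [apply Rmax_l|].
  exists (S (LY + L0 + L1 + L2 + L3)). intros l Hl.
  assert (HlY : INR LY + 1 <= INR l) by (rewrite <- S_INR; apply le_INR; lia).
  revert HLY. intros_max. intros HLY.
  rewrite solutions_count by auto.
  specialize (T0 l ltac:(lia)). specialize (T1 l ltac:(lia)).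
  specialize (T2 l ltac:(lia)). specialize (T3 l ltac:(lia)).
  assert (EO : main_order phi1 phi2 phi3 l = INR l ^ 2 * q1 (INR l) * q2 (INR l) * q3 (INR l)).
  { unfold main_order.
    rewrite (is_derive_unique phi1 _ (q1 (INR l))) by (apply (pr_d1 _ _ _ _ _ P1); lra).
    rewrite (is_derive_unique phi2 _ (q2 (INR l))) by (apply (pr_d1 _ _ _ _ _ P2); lra).
    rewrite (is_derive_unique phi3 _ (q3 (INR l))) by (apply (pr_d1 _ _ _ _ _ P3); lra). auto. }
  rewrite EO.
  set (O := INR l ^ 2 * q1 (INR l) * q2 (INR l) * q3 (INR l)) in *.
  replace (INR l ^ 2 * q2 (INR l) * q1 (INR l) * q3 (INR l)) with O in T2 by (unfold O; ring).
  replace (INR l ^ 2 * q3 (INR l) * q1 (INR l) * q2 (INR l)) with O in T3 by (unfold O; ring).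
  set (c := Gamma gamma1 * Gamma gamma2 * Gamma gamma3 / Gamma (gamma1 + gamma2 + gamma3)) in *.
  pose proof (tri_telescope l (hits h1 N0 l) (hits h2 N0 l) (hits h3 N0 l)
    (gaps phi1 n1) (gaps phi2 n2) (gaps phi3 n3)) as TT.
  change (Rabs (tri l (hits h1 N0 l) (hits h2 N0 l) (hits h3 N0 l) - c * O) <= eps * Rabs O).
  apply Rle_trans with (eps * O); [|apply Rmult_le_compat_l; [lra|apply Rle_abs]].
  apply Rabs_le_between in T0. apply Rabs_le_between in T1.
  apply Rabs_le_between in T2. apply Rabs_le_between in T3.
  apply Rabs_le_between. unfold d in *. lra.
Qed.
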